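(* (Identifiability) Consider the complex ICA model $x=As$, with $x$ a $p$-dimensional complex random vector, $p\ge2$. The model is identifiable if either of the following assumptions is made: (i) no source random variable is complex normal; or (ii) the mixing matrix $A$ is of full column rank and there are no two complex normal source random variables with the same circularity coefficient. That is: let $(A,s)$ and $(B,r)$ be two reduced representations of the same random vector $x$ which both satisfy assumption (i), or which both satisfy assumption (ii) (with $(B,r)$ in place of $(A,s)$ for the second). Then every column of $A$ is collinear with a column of $B$, and every column of $B$ is collinear with a column of $A$.
   Context: A complex random variable is $y=y_R+\jmath y_I$ with $y_R,y_I$ real random variables; it is non-degenerate if it is not almost surely constant. It is complex normal (in the wide sense) if $(y_R,y_I)^T$ is a bivariate normal real random vector (possibly with singular covariance). For a non-degenerate complex random variable $y$ with $E|y|^2<\infty$, put $\operatorname{cov}[y]=E[|y-E y|^2]$ and $\operatorname{pcov}[y]=E[(y-E y)^2]$. The circularity coefficient of $y$ is the unique $\lambda\ge0$ for which there is a nonzero $c\in\mathbb{C}$ with $\operatorname{cov}[cy]=1$ and $\operatorname{pcov}[cy]=\lambda$; equivalently $\lambda=|\operatorname{pcov}[y]|/\operatorname{cov}[y]$. A representation of a $p$-dimensional complex random vector $x$ is a pair $(A,s)$ with $x=As$, where $A$ is a constant complex $p\times m$ matrix (for some $m$, which may differ between representations) and $s=(s_1,\ldots,s_m)^T$ has independent non-degenerate complex components (the sources). Two vectors are collinear if they are linearly dependent. The representation is reduced if the columns of $A$ are nonzero and pairwise linearly independent. A reduced representation is proper if it satisfies all the assumptions made about the model. The model is identifiable if for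 any two proper representations $(A,s)$ and $(B,r)$ of $x$, every column of $A$ is collinear with a column of $B$ and vice versa. *)

(* Defs.v *)
From HB Require Import structures.
From mathcomp Require Import all_boot all_order all_algebra.
From mathcomp Require Import all_classical all_reals all_analysis.
From mathcomp Require Import complex.

Set Implicit Arguments.
Unset Strict Implicit.
Unset Printing Implicit Defensive.

Import Order.TTheory GRing.Theory Num.Theory.
Import numFieldNormedType.Exports.

Local Open Scope classical_set_scope.
Local Open Scope ring_scope.
Local Open Scope complex_scope.

Section ComplexRandomVariable.
Context {d : measure_display} {T : measurableType d} {R : realType}.
Variable P : probability T R.
Implicit Types (y : T -> R[i]) (Y : T -> R).

(* [R[i]] carries no sigma-algebra in the library; it is identified with the
   product space [R * R] through [complex_pair]. *)
Definition complex_pair (z : R[i]) : R * R := (complex.Re z, complex.Im z).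

Definition complex_rv y : Prop :=
  measurable_fun setT (@complex.Re R \o y) /\
  measurable_fun setT (@complex.Im R \o y).

Definition non_degenerate y : Prop :=
  ~ exists c : R[i], {ae P, forall w, y w = c}.

(* The degenerate normal law is a separate case because [normal_prob mu 0] is
   by convention the uniform law on [0, 1], not the Dirac mass at [mu]. *)
Definition real_normal Y : Prop :=
  measurable_fun setT Y /\
  ((exists mu : R, {ae P, forall w, Y w = mu}) \/
   (exists mu sigma : R, 0 < sigma /\
      forall B : set R, measurable B -> P (Y @^-1` B) = normal_prob mu sigma B)).

(* Bivariate normality, singular covariance allowed: every real linear
   combination is (possibly degenerate) normal. *)
Definition bivariate_normal (Y1 Y2 : T -> R) : Prop :=
  forall a b : R, real_normal (fun w => a * Y1 w + b * Y2 w).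

Definition complex_normal y : Prop :=
  bivariate_normal (@complex.Re R \o y) (@complex.Im R \o y).

(* The moments below are meaningful under [square_integrable]; [fine] and the
   totalized integral return junk values otherwise. *)
Definition square_integrable y : Prop :=
  ('E_P[fun w => complex.Re (`|y w| ^+ 2)%R] < +oo)%E.

Definition cexpectation y : R[i] :=
  fine 'E_P[@complex.Re R \o y]%E +i* fine 'E_P[@complex.Im R \o y]%E.

Definition cov y : R[i] :=
  cexpectation (fun w => `|y w - cexpectation y| ^+ 2).

Definition pcov y : R[i] :=
  cexpectation (fun w => (y w - cexpectation y) ^+ 2).

Definition circularity_coefficient y (lambda : R) : Prop :=
  [/\ complex_rv y, non_degenerate y, square_integrable y, 0 <= lambda &
   exists2 c : R[i], c != 0 &
     cov (fun w => c * y w) = 1 /\ pcov (fun w => c * y w) = lambda%:C].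

Definition independent_crv (m : nat) (s : 'I_m -> T -> R[i]) : Prop :=
  forall (J : {set 'I_m}) (B : 'I_m -> set (R * R)),
    (forall i, measurable (B i)) ->
    P (\bigcap_(i in [set i | i \in J]) ((complex_pair \o s i) @^-1` B i)) =
    (\prod_(i in J) P ((complex_pair \o s i) @^-1` B i))%E.

Definition coordinate (m : nat) (s : T -> 'cV[R[i]]_m) (i : 'I_m) : T -> R[i] :=
  fun w => s w i ord0.

Definition complex_rvec (m : nat) (s : T -> 'cV[R[i]]_m) : Prop :=
  forall i, complex_rv (coordinate s i).

End ComplexRandomVariable.

Definition collinear (K : fieldType) (p : nat) (u v : 'cV[K]_p) : Prop :=
  ~~ free [:: u; v].

Section ICA.
Context {d : measure_display} {T : measurableType d} {R : realType}.
Variables (P : probability T R) (p : nat) (x : T -> 'cV[R[i]]_p).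

Record representation (m : nat) (A : 'M[R[i]]_(p, m)) (s : T -> 'cV[R[i]]_m) :
    Prop := Representation {
  repr_rvec : complex_rvec s ;
  repr_non_degenerate : forall i, non_degenerate P (coordinate s i) ;
  repr_independent : independent_crv P (coordinate s) ;
  (* equality of random vectors is almost sure equality *)
  repr_eq : {ae P, forall w, x w = A *m s w} }.

Definition reduced (m : nat) (A : 'M[R[i]]_(p, m)) : Prop :=
  (forall i, col i A != 0) /\
  (forall i j, i != j -> ~ collinear (col i A) (col j A)).

Definition model_assumption : Type :=
  forall m : nat, 'M[R[i]]_(p, m) -> (T -> 'cV[R[i]]_m) -> Prop.

Definition no_normal_source : model_assumption :=
  fun m A s => forall i, ~ complex_normal P (coordinate s i).

Definition full_rank_distinct_circularity : model_assumption :=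
  fun m A s => \rank A = m /\
    ~ exists i j, [/\ i != j, complex_normal P (coordinate s i),
        complex_normal P (coordinate s j) &
        exists lambda, circularity_coefficient P (coordinate s i) lambda /\
                       circularity_coefficient P (coordinate s j) lambda].

Definition proper (H : model_assumption) (m : nat) (A : 'M[R[i]]_(p, m))
    (s : T -> 'cV[R[i]]_m) : Prop :=
  [/\ representation A s, reduced A & H m A s].

Definition identifiable (H : model_assumption) : Prop :=
  forall (m n : nat) (A : 'M[R[i]]_(p, m)) (s : T -> 'cV[R[i]]_m)
         (B : 'M[R[i]]_(p, n)) (r : T -> 'cV[R[i]]_n),
    proper H A s -> proper H B r ->
    (forall i, exists j, collinear (col i A) (col j B)) /\
    (forall j, exists i, collinear (col j B) (col i A)).

End ICA.

(* Main.v *)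
(** The argument is via characteristic functions.  For two representations of
    [x], independence turns the characteristic function of [u x] into a product
    over the sources, and near the origin the logarithms of the two products
    agree.  If column [k] of [A] is collinear with no other column of [A] or
    [B], finite differences along row vectors annihilating those columns one by
    one show that [log E exp (i t Re (e s_k))] is a polynomial in [t] near 0.
    By Marcinkiewicz's theorem (all exponential moments exist, the transform is
    [exp Q] on the whole plane, and [|E exp (z Y)| <= E exp (Re z Y)] forces
    [deg Q <= 2]) every real projection of [s_k] is normal.  This settles (i).

    For (ii), left inverses of [A] and [B] give [s = C r] and [C^-1].  A column
    of [B] not matched in [A] gives a column of [C] with two nonzero entries,
    and every such column belongs to a normal source.  Comparing the quadratic
    parts of the logarithms shows that [C K C^*] and [C Q C^T] are diagonal,
    where [K] and [Q] carry the variances and pseudo-variances of these normal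
    sources.  Hence those with a nonzero entry in a given row of [C] have the
    same circularity coefficient, so there is at most one per row, which
    contradicts an off-diagonal entry of [C K C^*] being zero. *)

Require Import Defs.
From mathcomp Require Import all_boot all_order all_algebra.
From mathcomp Require Import all_classical all_reals all_analysis.
From mathcomp Require Import measurable_realfun complex.
From mathcomp Require Import ring lra.

Set Implicit Arguments.
Unset Strict Implicit.
Unset Printing Implicit Defensive.

Import Order.TTheory GRing.Theory Num.Theory.
Import numFieldNormedType.Exports.
Import Normc.

Local Open Scope classical_set_scope.
Local Open Scope ring_scope.
Local Open Scope complex_scope.

(** The logarithm is known to be a polynomial only on a segment of the imaginary axis, while the
    degree bound needs the whole plane. No analytic continuation is used; the passage goes through
    moments. The expansion at 0 gives finite even moments (symmetric differences and Fatou's lemma),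
    all moments are then matched with the coefficients of the formal series [exp Q], and a majorant
    of this series bounds every exponential moment; after that both sides are the same convergent
    power series.

    A second obstacle is that normality is a statement about the law, not about the transform. Hence
    a uniqueness theorem is proved, with indicators of intervals obtained as bounded limits of
    trigonometric polynomials.

    Logarithms are principal ones near 1, with arguments so small that their sums cannot differ by a
    nonzero multiple of [2 pi]. In case (ii) only the log-modulus is compared, because the means
    affect only the phase. *)

Local Notation Re := (@complex.Re _).
Local Notation Im := (@complex.Im _).

(** * The complex exponential and its Taylor remainder *)

Section ComplexExponential.
Context {R : realType}.
Implicit Types (z w : R[i]) (x y : R).

Definition cexp z : R[i] :=
  (expR (Re z) * cos (Im z)) +i* (expR (Re z) * sin (Im z)).

Lemma ReD z w : Re (z + w) = Re z + Re w. Proof. by case: z; case: w. Qed.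
Lemma ImD z w : Im (z + w) = Im z + Im w. Proof. by case: z; case: w. Qed.
Lemma ReN z : Re (- z) = - Re z. Proof. by case: z. Qed.
Lemma ImN z : Im (- z) = - Im z. Proof. by case: z. Qed.
Lemma ReM z w : Re (z * w) = Re z * Re w - Im z * Im w.
Proof. by case: z; case: w. Qed.
Lemma ImM z w : Im (z * w) = Re z * Im w + Im z * Re w.
Proof. by case: z; case: w. Qed.
Lemma ReMr x z : Re (x%:C * z) = x * Re z.
Proof. by rewrite ReM /= mul0r subr0. Qed.
Lemma ImMr x z : Im (x%:C * z) = x * Im z.
Proof. by rewrite ImM /= mul0r addr0. Qed.

Lemma Re_sum (I : Type) (r : seq I) (Q : pred I) (F : I -> R[i]) :
  Re (\sum_(i <- r | Q i) F i) = \sum_(i <- r | Q i) Re (F i).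
Proof. by elim/big_rec2: _ => // i a b _ <-; rewrite ReD. Qed.
Lemma Im_sum (I : Type) (r : seq I) (Q : pred I) (F : I -> R[i]) :
  Im (\sum_(i <- r | Q i) F i) = \sum_(i <- r | Q i) Im (F i).
Proof. by elim/big_rec2: _ => // i a b _ <-; rewrite ImD. Qed.

Lemma complex_eqP z w : Re z = Re w -> Im z = Im w -> z = w.
Proof. by case: z => a b; case: w => c d /= -> ->. Qed.

Lemma cexp0 : cexp 0 = 1.
Proof. by apply: complex_eqP; rewrite /= expR0 (cos0, sin0) mul1r. Qed.

Lemma cexpD z w : cexp (z + w) = cexp z * cexp w.
Proof.
by apply: complex_eqP; rewrite ?ReM ?ImM /= ReD ImD expRD (cosD, sinD); ring.
Qed.

Lemma cexp_sum (I : Type) (r : seq I) (Q : pred I) (F : I -> R[i]) :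
  cexp (\sum_(i <- r | Q i) F i) = \prod_(i <- r | Q i) cexp (F i).
Proof. exact: (big_morph cexp cexpD cexp0). Qed.

Lemma sqr_normcE z : normc z ^+ 2 = Re z ^+ 2 + Im z ^+ 2.
Proof. by case: z => a b /=; rewrite sqr_sqrtr // addr_ge0 ?sqr_ge0. Qed.

Lemma normc_ge0 z : 0 <= normc z.
Proof. by case: z => a b; exact: sqrtr_ge0. Qed.
Hint Resolve normc_ge0 : core.

Lemma normc_le z x : 0 <= x -> Re z ^+ 2 + Im z ^+ 2 <= x ^+ 2 -> normc z <= x.
Proof.
by move=> x0; rewrite -sqr_normcE ler_pXn2r // nnegrE.
Qed.

Lemma normc_cexp z : normc (cexp z) = expR (Re z).
Proof.
have /eqP : normc (cexp z) ^+ 2 = expR (Re z) ^+ 2.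
  by rewrite sqr_normcE /= !exprMn -mulrDr cos2Dsin2 mulr1.
by rewrite eqrXn2 ?expR_ge0 // => /eqP.
Qed.

Lemma normc_Re z : `|Re z| <= normc z.
Proof.
by rewrite -(@ler_pXn2r _ 2) ?nnegrE // real_normK ?num_real // sqr_normcE
  lerDl sqr_ge0.
Qed.

Lemma normc_Im z : `|Im z| <= normc z.
Proof.
by rewrite -(@ler_pXn2r _ 2) ?nnegrE // real_normK ?num_real // sqr_normcE
  lerDr sqr_ge0.
Qed.

Lemma normc_leD z : normc z <= `|Re z| + `|Im z|.
Proof.
apply: normc_le; first exact: addr_ge0.
rewrite sqrrD !real_normK ?num_real //.
have : 0 <= `|Re z| * `|Im z| by exact: mulr_ge0.
by lra.
Qed.

Lemma normc_real x : normc (x%:C) = `|x|.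
Proof. by rewrite /= expr0n /= addr0 sqrtr_sqr. Qed.

Lemma normcX z n : normc (z ^+ n) = normc z ^+ n.
Proof. by elim: n => [|n IH]; rewrite ?normc1 // !exprS normcM IH. Qed.

Lemma normcD z w : normc (z + w) <= normc z + normc w.
Proof. exact: (@le_normcD R z w). Qed.

Lemma normc_opp z : normc (- z) = normc z.
Proof. exact: (@normcN R z). Qed.

Lemma normc_sum (I : Type) (r : seq I) (Q : pred I) (F : I -> R[i]) :
  normc (\sum_(i <- r | Q i) F i) <= \sum_(i <- r | Q i) normc (F i).
Proof.
elim/big_rec2: _ => [|i y z _ H]; first by rewrite normc0.
by apply: le_trans (normcD _ _) _; rewrite lerD2l.
Qed.

Definition expp (n : nat) : {poly R[i]} := \poly_(i < n) (i`!%:R^-1).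

Lemma expp_horner n z : (expp n).[z] = \sum_(i < n) z ^+ i / i`!%:R.
Proof.
by rewrite horner_poly; apply: eq_bigr => i _; rewrite mulrC.
Qed.

Lemma ge0_of_derive (f f' : R -> R) x : 0 <= x ->
  (forall s : R, is_derive s 1 f (f' s)) ->
  (forall s, 0 <= s -> s <= x -> 0 <= f' s) -> 0 <= f 0 -> 0 <= f x.
Proof.
move=> x0 df f'0 f0; have [->//|xn0] := eqVneq x 0.
have x_gt0 : 0 < x by rewrite lt_def xn0.
have [|c] := @MVT R f f' 0 x x_gt0 (fun s _ => df s).
  apply: continuous_subspaceT => s.
  exact/differentiable_continuous/derivable1_diffP.
rewrite in_itv /= => /andP[c0 cx] /eqP; rewrite subr_eq => /eqP ->.
by rewrite addr_ge0 // mulr_ge0 ?subr_ge0 // f'0 // ltW.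
Qed.

Lemma fact_pow_derive x n (c : R) :
  is_derive x 1 (fun s : R => c * (s ^+ n.+1 / n.+1`!%:R)) (c * (x ^+ n / n`!%:R)).
Proof.
have -> : (fun s : R => c * (s ^+ n.+1 / n.+1`!%:R)) =
    (c / n.+1`!%:R) \*: ((id : R -> R) ^+ n.+1).
  by apply/funext => s /=; rewrite fctE /GRing.scale /=; ring.
apply: is_derive_eq.
rewrite /GRing.scale /= factS natrM mulr1.
have h : n.+1%:R != 0 :> R by rewrite pnatr_eq0.
have h' : n`!%:R != 0 :> R by rewrite pnatr_eq0 -lt0n fact_gt0.
by move: h h'; move: n.+1%:R n`!%:R => a b h h'; field; rewrite h h'.
Qed.

Lemma is_derive_scaled (f : R -> R) (f' a x : R) :
  is_derive (x * a) 1 f f' -> is_derive x 1 (fun s : R => f (s * a)) (a * f').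
Proof.
move=> df.
have da : is_derive x 1 (fun s : R => s * a) a.
  have -> : (fun s : R => s * a) = a \*: (id : R -> R).
    by apply/funext => s; exact: mulrC.
  by apply: is_derive_eq; rewrite /GRing.scale /= mulr1.
have := @is_derive1_comp _ f (fun s : R => s * a) x f' a df da.
by rewrite mulrC.
Qed.

Lemma exp_ray_derive (w z : R[i]) x :
  is_derive x 1 (fun s : R => Re (w * cexp (s%:C * z)))
                (Re (w * z * cexp (x%:C * z))).
Proof.
have -> : (fun s : R => Re (w * cexp (s%:C * z))) =
    (fun s : R => expR (s * Re z)) *
    (Re w \*: (fun s : R => cos (s * Im z)) -
     Im w \*: (fun s : R => sin (s * Im z))).
  by apply/funext => s; rewrite !fctE /= ReM /= ReMr ImMr /GRing.scale /=; ring.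
have d1 := is_derive_scaled (is_derive_expR (x * Re z)).
have d2 := is_derive_scaled (is_derive_cos (x * Im z)).
have d3 := is_derive_scaled (is_derive_sin (x * Im z)).
apply: is_derive_eq.
by rewrite /GRing.scale /= !fctE !ReM /= ReMr ImMr ImM /GRing.scale /=; ring.
Qed.

(** Real-valued Taylor remainder along the ray through [z]. The weight [w] keeps the family closed
    under differentiation ([w] becomes [w * z]), and [w = 1] or [w = -i] recovers the real or the
    imaginary part. *)
Definition exp_rem (n : nat) (w z : R[i]) (s : R) : R :=
  Re (w * cexp (s%:C * z)) - \sum_(i < n) Re (w * z ^+ i) * (s ^+ i / i`!%:R).

Lemma exp_remE n w z s :
  exp_rem n w z s = Re (w * (cexp (s%:C * z) - (expp n).[s%:C * z])).
Proof.
rewrite /exp_rem expp_horner mulrBr ReD ReN; congr (_ - _).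
rewrite mulr_sumr Re_sum; apply: eq_bigr => i _.
have -> : w * ((s%:C * z) ^+ i / i`!%:R) = (s ^+ i / i`!%:R)%:C * (w * z ^+ i).
  by rewrite rmorphM fmorphV rmorph_nat rmorphXn exprMn /=; ring.
by rewrite ReMr mulrC.
Qed.

Lemma exp_rem_derive n w z x :
  is_derive x 1 (exp_rem n.+1 w z) (exp_rem n (w * z) z x).
Proof.
elim: n => [|n IH].
  have -> : exp_rem 1 w z =
      (fun s : R => Re (w * cexp (s%:C * z))) - cst (Re w).
    apply/funext => s; rewrite /exp_rem big_ord1 !fctE expr0 mulr1.
    by rewrite fact0 invr1 mulr1 mulr1.
  have d := exp_ray_derive w z x.
  by apply: is_derive_eq; rewrite /exp_rem big_ord0.
have -> : exp_rem n.+2 w z = exp_rem n.+1 w z -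
    (fun s : R => Re (w * z ^+ n.+1) * (s ^+ n.+1 / n.+1`!%:R)).
  by apply/funext => s; rewrite !fctE /exp_rem big_ord_recr /= opprD addrA.
have d := fact_pow_derive x n (Re (w * z ^+ n.+1)).
apply: is_derive_eq; rewrite /exp_rem [in RHS]big_ord_recr /= opprD addrA.
by have -> : w * z ^+ n.+1 = w * z * z ^+ n by rewrite exprS mulrA.
Qed.

(** Induction for all weights at once: the remainder of order [n.+1] has the remainder of order [n]
    as its derivative, and the bounds are related in the same way. *)
Lemma exp_rem_bound n (w z : R[i]) x : 0 <= x -> x <= 1 ->
  `|exp_rem n w z x| <=
    normc w * normc z ^+ n * expR `|Re z| * (x ^+ n / n`!%:R).
Proof.
elim: n w x => [|n IH] w x x0 x1.
  rewrite /exp_rem big_ord0 subr0 expr0 mulr1 fact0 invr1 !mulr1.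
  apply: le_trans (normc_Re _) _; rewrite normcM normc_cexp ler_wpM2l // ler_expR.
  rewrite ReMr; apply: le_trans (ler_norm _) _.
  by rewrite normrM ger0_norm // ler_piMl.
set c := (X in X * (_ / _)).
(* [e] is a sign; its two values together bound the absolute value. *)
have key (e : R) : `|e| = 1 -> 0 <= c * (x ^+ n.+1 / n.+1`!%:R) + e * exp_rem n.+1 w z x.
  move=> e1.
  pose f (s : R) : R := c * (s ^+ n.+1 / n.+1`!%:R) + e * exp_rem n.+1 w z s.
  pose f' (s : R) : R := c * (s ^+ n / n`!%:R) + e * exp_rem n (w * z) z s.
  apply: (@ge0_of_derive f f' x x0) => [s|s s0 sx|].
  - have -> : f = (fun s : R => c * (s ^+ n.+1 / n.+1`!%:R)) +
        e \*: exp_rem n.+1 w z by apply/funext.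
    have d1 := fact_pow_derive s n c.
    have d2 := exp_rem_derive n w z s.
    by apply: is_derive_eq.
  - have := IH (w * z) s s0 (le_trans sx x1).
    rewrite normcM.
    have -> : normc w * normc z * normc z ^+ n * expR `|Re z| = c.
      by rewrite /c exprS mulrA.
    move=> h.
    have : `|e * exp_rem n (w * z) z s| <= c * (s ^+ n / n`!%:R).
      by rewrite normrM e1 mul1r.
    by rewrite ler_norml => /andP[+ _]; rewrite /f'; lra.
  - rewrite /f expr0n /= mul0r mulr0 add0r.
    rewrite exp_remE mul0r cexp0 expp_horner big_ord_recl expr0 fact0 invr1 mulr1.
    rewrite big1 ?addr0 ?subrr ?mulr0 /= ?mulr0 // => i _.
    by rewrite expr0n /= mul0r.
rewrite ler_norml; have := key 1 (normr1 _); have := key (-1) (normrN1 _).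
by rewrite mul1r mulN1r; lra.
Qed.

(** The factor 2 comes from adding the bounds for the real part ([w = 1]) and the imaginary part
    ([w = -i]). *)
Lemma cexp_taylor n z :
  normc (cexp z - (expp n).[z]) <= 2 * (normc z ^+ n / n`!%:R) * expR `|Re z|.
Proof.
have H w : normc w = 1 ->
    `|Re (w * (cexp z - (expp n).[z]))| <= normc z ^+ n / n`!%:R * expR `|Re z|.
  move=> w1; have := @exp_rem_bound n w z 1 ler01 (lexx _).
  by rewrite exp_remE !mul1r w1 expr1n !mul1r; congr (_ <= _); ring.
apply: le_trans (normc_leD _) _.
rewrite -mulrA mulr_natl mulr2n; apply: lerD.
  by have := H 1 (normc1 R); rewrite mul1r.
have := H (- 'i%C); rewrite ReM /= oppr0 mul0r sub0r mulN1r opprK.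
by apply; rewrite expr0n /= sqrrN expr1n add0r sqrtr1.
Qed.

Lemma exp_partial_sum n x : 0 <= x -> \sum_(i < n) x ^+ i / i`!%:R <= expR x.
Proof.
elim: n x => [|n IH] x x0; first by rewrite big_ord0 expR_ge0.
pose f (s : R) := expR s - \sum_(i < n.+1) s ^+ i / i`!%:R.
pose f' (s : R) := expR s - \sum_(i < n) s ^+ i / i`!%:R.
have df m (s : R) : is_derive s 1 (fun s : R => \sum_(i < m.+1) s ^+ i / i`!%:R)
    (\sum_(i < m) s ^+ i / i`!%:R).
  elim: m => [|m IHm].
    have -> : (fun s : R => \sum_(i < 1) s ^+ i / i`!%:R) = cst 1.
      by apply/funext => t; rewrite big_ord1 fact0 invr1 mulr1.
    by rewrite big_ord0; exact: is_derive_cst.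
  have -> : (fun s : R => \sum_(i < m.+2) s ^+ i / i`!%:R) =
      (fun s : R => \sum_(i < m.+1) s ^+ i / i`!%:R) +
      (fun s : R => 1 * (s ^+ m.+1 / m.+1`!%:R)).
    by apply/funext => t; rewrite !fctE big_ord_recr /= mul1r.
  have d := fact_pow_derive s m 1.
  by apply: is_derive_eq; rewrite [RHS]big_ord_recr /= mul1r.
have f0 : 0 <= f 0.
  rewrite /f expR0 big_ord_recl expr0 fact0 invr1 mulr1 big1 ?addr0 ?subrr //.
  by move=> i _; rewrite expr0n /= mul0r.
have f'0 s : 0 <= s -> s <= x -> 0 <= f' s.
  by move=> s0 _; rewrite /f' subr_ge0; exact: IH.
have df' (s : R) : is_derive s 1 f (f' s) by exact: (is_deriveB (is_derive_expR s) (df n s)).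
by rewrite -subr_ge0; exact: (@ge0_of_derive f f' x x0 df' f'0 f0).
Qed.

Lemma cvg_pow_fact x : (fun n => x ^+ n / n`!%:R) @ \oo --> 0.
Proof.
have := cvg_series_cvg_0 (is_cvg_series_exp_coeff x).
by congr (_ @ \oo --> 0).
Qed.
End ComplexExponential.

(** * The exponential of a polynomial as a formal series *)

Section ExpSeriesPoly.
Variable F : fieldType.
Implicit Types (Q : {poly F}).

Definition exp_series N Q : {poly F} := \sum_(k < N) k`!%:R^-1 *: Q ^+ k.

Lemma coef_exp_low Q k n : Q`_0 = 0 -> (n < k)%N -> (Q ^+ k)`_n = 0.
Proof.
move=> Q0 nk; have [Q1 ->] : exists Q1, Q = Q1 * 'X.
  have : root Q 0 by rewrite rootE horner_coef0 Q0.
  by case/factor_theorem => q ->; exists q; rewrite subr0.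
by rewrite exprMn coefMXn nk.
Qed.

(** [Q ^+ k] is divisible by ['X^k], so powers with [k > n] do not reach the coefficient [n]: it is
    stable from [N = n.+1] on, and is that of the formal series [exp Q]. *)
Lemma coef_exp_series Q N n : Q`_0 = 0 -> (n < N)%N ->
  (exp_series N Q)`_n = (exp_series n.+1 Q)`_n.
Proof.
move=> Q0 nN; rewrite /exp_series !coef_sum.
rewrite (big_ord_widen_cond N xpredT (fun k => (k`!%:R^-1 *: Q ^+ k)`_n) nN) /=.
rewrite [LHS](bigID (fun i : 'I_N => (i < n.+1)%N)) /= [X in _ + X]big1 ?addr0 //.
by move=> i; rewrite -leqNgt => ni; rewrite coefZ coef_exp_low // mulr0.
Qed.

Lemma horner_exp_series Q N w :
  (exp_series N Q).[w] = \sum_(k < N) Q.[w] ^+ k / k`!%:R.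
Proof.
rewrite /exp_series horner_sum; apply: eq_bigr => k _.
by rewrite hornerZ horner_exp mulrC.
Qed.

End ExpSeriesPoly.

(** * Convergence of the series [exp Q] by a majorant *)

Section ExpPoly.
Context {R : realType}.
Implicit Types (Q : {poly R[i]}) (w : R[i]).

(** A majorant of [Q]: it reduces estimates on [exp Q] to series with nonnegative terms. *)
Definition abs_poly Q : {poly R} := \poly_(i < size Q) normc Q`_i.

Lemma coef_abs_poly Q i : (abs_poly Q)`_i = normc Q`_i.
Proof.
rewrite coef_poly; case: ltnP => // h.
by rewrite nth_default // normc0.
Qed.

Lemma normc_coef_exp Q k n : normc (Q ^+ k)`_n <= (abs_poly Q ^+ k)`_n.
Proof.
elim: k n => [|k IH] n.
  by rewrite !expr0 !coef1; case: (n == 0%N); rewrite ?normc1 ?normc0.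
rewrite !exprS !coefM; apply: le_trans (normc_sum _ _ _) _.
apply: ler_sum => i _; rewrite normcM coef_abs_poly.
exact: ler_wpM2l (normc_ge0 _) _ _ _.
Qed.

Lemma coef_abs_exp_ge0 Q k n : 0 <= (abs_poly Q ^+ k)`_n.
Proof. exact: le_trans (normc_ge0 _) (normc_coef_exp Q k n). Qed.

Lemma normc_factV k : normc (k`!%:R^-1 : R[i]) = k`!%:R^-1.
Proof.
have -> : (k`!%:R : R[i]) = (k`!%:R)%:C by rewrite rmorph_nat.
by rewrite -fmorphV normc_real ger0_norm.
Qed.

Variable Q : {poly R[i]}.
Hypothesis Q0 : Q`_0 = 0.

(** Taylor coefficient of [exp Q] at 0; by [coef_exp_series], [n.+1] terms are enough. *)
Definition exp_coef n : R[i] := (exp_series n.+1 Q)`_n.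
Definition exp_abs_coef n : R := (exp_series n.+1 (abs_poly Q))`_n.

Lemma abs_poly0 : (abs_poly Q)`_0 = 0.
Proof. by rewrite coef_abs_poly Q0 normc0. Qed.

Lemma exp_series_abs_ge0 N n : 0 <= (exp_series N (abs_poly Q))`_n.
Proof.
rewrite coef_sum sumr_ge0 // => k _.
by rewrite coefZ mulr_ge0 ?invr_ge0 ?coef_abs_exp_ge0.
Qed.

(** The truncation [N] is arbitrary: coefficients with [n >= N] need not be stable yet, but omitting
    terms only lowers the majorant. [cexp_poly_tail] meets such coefficients. *)
Lemma exp_series_le N n : normc (exp_series N Q)`_n <= exp_abs_coef n.
Proof.
have H M : normc (exp_series M Q)`_n <= (exp_series M (abs_poly Q))`_n.
  rewrite /exp_series !coef_sum; apply: le_trans (normc_sum _ _ _) _.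
  apply: ler_sum => k _; rewrite !coefZ normcM normc_factV.
  by rewrite ler_wpM2l ?invr_ge0 ?normc_coef_exp.
have [nN|Nn] := ltnP n N; first by rewrite coef_exp_series.
apply: le_trans (H N) _; rewrite /exp_abs_coef /exp_series !coef_sum.
rewrite (big_ord_widen_cond n.+1 xpredT
  (fun k => (k`!%:R^-1 *: abs_poly Q ^+ k)`_n) (leqW Nn)) /=.
rewrite [leRHS](bigID (fun i : 'I_n.+1 => (i < N)%N)) /= lerDl sumr_ge0 // => k _.
by rewrite coefZ mulr_ge0 ?invr_ge0 ?coef_abs_exp_ge0.
Qed.

Lemma exp_coef_le n : normc (exp_coef n) <= exp_abs_coef n.
Proof. exact: exp_series_le. Qed.

Lemma exp_abs_coef_ge0 n : 0 <= exp_abs_coef n.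
Proof. exact: exp_series_abs_ge0. Qed.

(** The first [M] coefficients are those of the polynomial [S], whose other coefficients are
    nonnegative, and the value of [S] at [r] is a partial sum of a real exponential. *)
Lemma exp_abs_coef_sum M (r : R) : 0 <= r ->
  \sum_(n < M) exp_abs_coef n * r ^+ n <= expR (abs_poly Q).[r].
Proof.
move=> r0; pose S := exp_series M (abs_poly Q).
have -> : \sum_(n < M) exp_abs_coef n * r ^+ n = \sum_(n < M) S`_n * r ^+ n.
  by apply: eq_bigr => n _; rewrite /exp_abs_coef -(coef_exp_series abs_poly0 (ltn_ord n)).
have : \sum_(n < M) S`_n * r ^+ n <= S.[r].
  rewrite (horner_coef_wide r (leq_maxl (size S) M)).
  rewrite (big_ord_widen_cond (maxn (size S) M) xpredT
    (fun n => S`_n * r ^+ n) (leq_maxr _ _)) /=.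
  rewrite [leRHS](bigID (fun i : 'I_(maxn (size S) M) => (i < M)%N)) /=.
  rewrite lerDl sumr_ge0 // => k _.
  by rewrite mulr_ge0 ?exp_series_abs_ge0 ?exprn_ge0.
move=> /le_trans; apply; rewrite horner_exp_series exp_partial_sum //.
rewrite horner_coef sumr_ge0 // => i _.
by rewrite mulr_ge0 ?exprn_ge0 // coef_abs_poly normc_ge0.
Qed.

(** Cauchy's estimate at radius [tau], obtained by isolating one term of a nonnegative sum. *)
Lemma exp_abs_coef_bound n (tau : R) : 0 <= tau ->
  exp_abs_coef n * tau ^+ n <= expR (abs_poly Q).[tau].
Proof.
move=> t0; apply: le_trans (exp_abs_coef_sum n.+1 t0).
rewrite big_ord_recr /= lerDr sumr_ge0 // => i _.
by rewrite mulr_ge0 ?exp_abs_coef_ge0 ?exprn_ge0.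
Qed.

Lemma geometric_tail (q : R) M S : 0 <= q -> q <= 2^-1 ->
  \sum_(M <= n < S) q ^+ n <= 2 * q ^+ M.
Proof.
move=> q0 q2; have [SM|MS] := leqP S M.
  by rewrite big_geq // mulr_ge0 ?exprn_ge0.
rewrite -(subnKC (ltnW MS)); move: (S - M)%N => j.
(* The extra term [2 * q ^+ (M + j)] makes the induction close with [2 * q <= 1] alone. *)
suff: \sum_(M <= n < M + j) q ^+ n + 2 * q ^+ (M + j) <= 2 * q ^+ M.
  by apply: le_trans; rewrite lerDl mulr_ge0 ?exprn_ge0.
elim: j => [|j IH]; first by rewrite addn0 big_geq // add0r.
rewrite addnS big_nat_recr ?leq_addr //=; apply: le_trans IH.
rewrite -addrA lerD2l exprS mulrA.
have : 2 * q <= 1 by lra.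
have : 0 <= q ^+ (M + j) by exact: exprn_ge0.
by nra.
Qed.

Lemma le_add_cvg0 (a b : R) (u : nat -> R) M :
  (forall n, (M <= n)%N -> a <= b + u n) -> u @ \oo --> 0 -> a <= b.
Proof.
move=> H u0; rewrite -[b]addr0.
have : (fun n => b + u n) @ \oo --> b + 0 by apply: cvgD => //; exact: cvg_cst.
move=> h; rewrite -(cvg_lim _ h) //; apply: limr_ge; first exact: cvgP h.
by exists M.
Qed.

(** For [N >= M] the polynomial [exp_series N Q] has the exact first [M] coefficients. By Cauchy's
    estimate its other terms are bounded by a geometric series of ratio [normc w / tau], at most
    1/2; then [N] tends to infinity. *)
Lemma cexp_poly_tail (tau : R) w M : 0 < tau -> normc w <= tau / 2 ->
  normc (cexp Q.[w] - \sum_(n < M) exp_coef n * w ^+ n) <=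
    2 * expR (abs_poly Q).[tau] * (normc w / tau) ^+ M.
Proof.
move=> t0 wt; set K := expR _.
have q2 : normc w / tau <= 2^-1 by rewrite ler_pdivrMr // mulrC.
have q0 : 0 <= normc w / tau by rewrite divr_ge0 ?normc_ge0 ?ltW.
pose u N := 2 * (normc Q.[w] ^+ N / N`!%:R) * expR `|Re Q.[w]|.
apply: (@le_add_cvg0 _ _ u M) => [N MN|]; last first.
  have -> : u = (fun N => (2 * expR `|Re Q.[w]|) * (normc Q.[w] ^+ N / N`!%:R)).
    by apply/funext => N; rewrite /u; ring.
  rewrite -[X in _ --> X](mulr0 (2 * expR `|Re Q.[w]|)).
  apply: cvgM; [exact: cvg_cst|exact: cvg_pow_fact].
have -> : cexp Q.[w] - \sum_(n < M) exp_coef n * w ^+ n =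
  ((exp_series N Q).[w] - \sum_(n < M) exp_coef n * w ^+ n) +
  (cexp Q.[w] - (expp N).[Q.[w]]).
  by rewrite horner_exp_series expp_horner; ring.
apply: le_trans (normcD _ _) _; apply: lerD; last exact: cexp_taylor.
pose S := maxn (size (exp_series N Q)) M.
rewrite (horner_coef_wide w (leq_maxl (size (exp_series N Q)) M)) -/S.
rewrite -(big_mkord xpredT (fun i => (exp_series N Q)`_i * w ^+ i)).
rewrite (big_cat_nat (leq0n M) (leq_maxr _ _)) /= big_mkord.
have -> : \sum_(i < M) (exp_series N Q)`_i * w ^+ i =
          \sum_(n < M) exp_coef n * w ^+ n.
  apply: eq_bigr => i _; rewrite /exp_coef -(coef_exp_series (N := N)) //.
  exact: leq_trans (ltn_ord i) MN.
rewrite addrAC subrr add0r; apply: le_trans (normc_sum _ _ _) _.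
have : \sum_(M <= i < S) normc ((exp_series N Q)`_i * w ^+ i) <=
       \sum_(M <= i < S) K * (normc w / tau) ^+ i.
  apply: ler_sum => i _; rewrite normcM normcX expr_div_n mulrA.
  rewrite ler_pdivlMr ?exprn_gt0 // mulrAC ler_wpM2r ?exprn_ge0 ?normc_ge0 //.
  apply: le_trans (exp_abs_coef_bound i (ltW t0)).
  by rewrite ler_wpM2r ?exprn_ge0 ?(ltW t0) // exp_series_le.
move=> /le_trans; apply; rewrite -mulr_sumr [2 * K]mulrC -mulrA.
by rewrite ler_wpM2l ?expR_ge0 // geometric_tail.
Qed.

End ExpPoly.

(** * Expectations of real and complex random variables *)

Section Expectation.
Context {d : measure_display} {T : measurableType d} {R : realType}.
Variable P : probability T R.
Implicit Types (f g : T -> R) (F G : T -> R[i]).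

Definition integ f := P.-integrable setT (EFin \o f).
Definition mean f : R := \int[P]_w f w.

Lemma integ_meas f : integ f -> measurable_fun setT f.
Proof. by move=> /measurable_int /measurable_EFinP. Qed.

Lemma integ_le f g : measurable_fun setT f -> integ g ->
  (forall w, `|f w| <= g w) -> integ f.
Proof.
move=> mf ig fg; apply: (le_integrable _ _ _ ig) => //.
  exact/measurable_EFinP.
by move=> w _ /=; rewrite lee_fin (le_trans (fg w)) // ler_norm.
Qed.

Lemma integ_cst (c : R) : integ (fun=> c).
Proof. exact: finite_measure_integrable_cst. Qed.

Lemma integ_bounded f (C : R) : measurable_fun setT f ->
  (forall w, `|f w| <= C) -> integ f.
Proof. by move=> mf fC; exact: (integ_le mf (integ_cst C)). Qed.

Lemma integD f g : integ f -> integ g -> integ (fun w => f w + g w).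
Proof. by move=> hf hg; have := integrableD measurableT hf hg. Qed.

Lemma integZ (k : R) f : integ f -> integ (fun w => k * f w).
Proof. by move=> hf; have := integrableZl measurableT k hf. Qed.

Lemma integN f : integ f -> integ (fun w => - f w).
Proof. by move=> hf; have := integrableN hf. Qed.

Lemma integB f g : integ f -> integ g -> integ (fun w => f w - g w).
Proof. by move=> hf hg; apply: integD => //; exact: integN. Qed.

Lemma integ_norm f : integ f -> integ (fun w => `|f w|).
Proof. exact: integrable_norm. Qed.

Lemma integ_sum (I : Type) (r : seq I) (Q : pred I) (h : I -> T -> R) :
  (forall i, Q i -> integ (h i)) -> integ (fun w => \sum_(i <- r | Q i) h i w).
Proof.
move=> H; elim: r => [|i r IH].
  by under eq_fun do rewrite big_nil; apply: integ_cst.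
under eq_fun do rewrite big_cons.
case Qi: (Q i) => //.
by apply: integD => //; exact: H.
Qed.

Lemma mean_cst (c : R) : mean (fun=> c) = c.
Proof. by rewrite /mean Rintegral_cst // [X in fine X](probability_setT P) mulr1. Qed.

Lemma meanD f g : integ f -> integ g ->
  mean (fun w => f w + g w) = mean f + mean g.
Proof. exact: RintegralD. Qed.

Lemma meanB f g : integ f -> integ g ->
  mean (fun w => f w - g w) = mean f - mean g.
Proof. exact: RintegralB. Qed.

Lemma meanZ (k : R) f : integ f -> mean (fun w => k * f w) = k * mean f.
Proof. by move=> hf; exact: RintegralZl. Qed.

Lemma mean_sum (I : Type) (r : seq I) (Q : pred I) (h : I -> T -> R) :
  (forall i, Q i -> integ (h i)) ->
  mean (fun w => \sum_(i <- r | Q i) h i w) = \sum_(i <- r | Q i) mean (h i).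
Proof.
move=> H; elim: r => [|i r IH].
  by under eq_fun do rewrite big_nil; rewrite mean_cst big_nil.
under eq_fun do rewrite big_cons; rewrite big_cons.
case: ifPn => Qi //; rewrite meanD ?IH //; first exact: H.
exact: integ_sum.
Qed.

Lemma mean_le f g : integ f -> integ g -> (forall w, f w <= g w) ->
  mean f <= mean g.
Proof. by move=> hf hg fg; exact: le_Rintegral. Qed.

Lemma mean_ge0 f : (forall w, 0 <= f w) -> 0 <= mean f.
Proof. by move=> f0; exact: Rintegral_ge0. Qed.

Lemma le_mean_norm f g : integ f -> integ g -> (forall w, `|f w| <= g w) ->
  `|mean f| <= mean g.
Proof.
move=> hf hg fg; apply: le_trans (le_normr_Rintegral measurableT hf) _.
by apply: mean_le => //; exact: integ_norm.
Qed.

Lemma EFin_mean f : integ f -> (mean f)%:E = (\int[P]_w (f w)%:E)%E.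
Proof. by move=> hf; rewrite /mean /Rintegral fineK //; exact: integrable_fin_num. Qed.

Lemma mean_dct (h : nat -> T -> R) f g :
  (forall n, measurable_fun setT (h n)) -> integ g ->
  (forall n w, `|h n w| <= g w) -> (forall w, h ^~ w @ \oo --> f w) ->
  integ f /\ (fun n => mean (h n)) @ \oo --> mean f.
Proof.
move=> mh ig hg hf.
have mf : measurable_fun setT f by apply: (measurable_fun_cvg mh) => w _; exact: hf.
have fg w : `|f w| <= g w.
  have h1 : (fun n => `|h n w|) @ \oo --> `|f w| by exact: cvg_norm.
  rewrite -(cvg_lim _ h1) //; apply: limr_le; first exact: cvgP h1.
  by near=> n; exact: hg.
have intf : integ f by exact: integ_le ig fg.
split=> //.
have := @dominated_convergence _ _ _ P setT measurableT
   (fun n w => (h n w)%:E) (fun w => (f w)%:E) (fun w => (g w)%:E).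
case.
- by move=> n; exact/measurable_EFinP.
- exact/measurable_EFinP.
- by apply: aeW => w _; apply/fine_cvgP; split; [near=> n|exact: hf].
- exact: ig.
- by apply: aeW => w n _ /=; rewrite lee_fin.
move=> _ _; rewrite -EFin_mean // => /fine_cvgP[_]; apply: cvg_trans.
by apply: near_eq_cvg; near=> n.
Unshelve. all: by end_near.
Qed.

(** Serves to prove that the limit is integrable at all; even moments and exponential moments are
    obtained in this way. *)
Lemma mean_fatou (h : nat -> T -> R) f (C : R) :
  (forall n, integ (h n)) -> (forall n w, 0 <= h n w) ->
  (forall n, mean (h n) <= C) -> (forall w, h ^~ w @ \oo --> f w) ->
  integ f /\ mean f <= C.
Proof.
move=> ih h0 hC hf.
have mh n := integ_meas (ih n).
have mf : measurable_fun setT f by apply: (measurable_fun_cvg mh) => w _; exact: hf.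
have f0 w : 0 <= f w.
  rewrite -(cvg_lim _ (hf w)) //; apply: limr_ge; first exact: cvgP (hf w).
  by near=> n; exact: h0.
have := @fatou _ _ _ P setT measurableT (fun n w => (h n w)%:E).
have -> : (fun n => \int[P]_w (h n w)%:E)%E = (fun n => (mean (h n))%:E).
  by apply/funext => n; rewrite EFin_mean.
move=> /(_ (fun n => (measurable_EFinP _ _).2 (mh n))).
move=> /(_ (fun n w _ => h0 n w)) H.
have {}H : (\int[P]_w (f w)%:E <= C%:E)%E.
  have -> : (\int[P]_w (f w)%:E = \int[P]_w limn_einf (fun n => (h n w)%:E))%E.
    apply: eq_integral => w _; have hw : (h n w)%:E @[n --> \oo] --> (f w)%:E.
      by apply/fine_cvgP; split; [near=> n|exact: hf].
    by rewrite is_cvg_limn_einfE; [rewrite (cvg_lim _ hw)|exact: cvgP hw].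
  apply: le_trans H _; rewrite limn_einf_lim; apply: lime_le; first exact: is_cvg_einfs.
  apply: nearW => n; apply: le_trans (_ : (mean (h n))%:E <= _)%E; last by rewrite lee_fin.
  by apply: ereal_inf_lbound; exists n => /=.
have intf : integ f.
  apply/integrableP; split; first exact/measurable_EFinP.
  under eq_integral do rewrite /= ger0_norm //.
  by apply: le_lt_trans H _; exact: ltry.
by split=> //; rewrite -lee_fin EFin_mean.
Unshelve. all: by end_near.
Qed.

Lemma mean_ae f g : measurable_fun setT f -> measurable_fun setT g ->
  {ae P, forall w, f w = g w} -> mean f = mean g.
Proof.
move=> mf mg fg; congr fine; apply: ae_eq_integral => //.
- exact/measurable_EFinP.
- exact/measurable_EFinP.
- by apply: filterS fg => w + _ => ->.
Qed.

Lemma mean0_ae f : integ f -> (forall w, 0 <= f w) -> mean f = 0 ->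
  {ae P, forall w, f w = 0}.
Proof.
move=> hf f0 mf0.
have : ae_eq P setT (EFin \o f) (cst 0%E).
  apply/(ae_eq_integral_abs P measurableT (measurable_int _ hf)).
  under eq_integral do rewrite /= ger0_norm //.
  by rewrite -EFin_mean // mf0.
by apply: filterS => w /(_ I) [].
Qed.

Definition cinteg F := integ (Re \o F) /\ integ (Im \o F).
Definition cmean F : R[i] := mean (Re \o F) +i* mean (Im \o F).

Lemma cinteg_le F g : measurable_fun setT (Re \o F) ->
  measurable_fun setT (Im \o F) -> integ g -> (forall w, normc (F w) <= g w) ->
  cinteg F.
Proof.
move=> mR mI ig Fg; split.
  by apply: (integ_le mR ig) => w; exact: le_trans (normc_Re _) (Fg w).
by apply: (integ_le mI ig) => w; exact: le_trans (normc_Im _) (Fg w).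
Qed.

Lemma cintegD F G : cinteg F -> cinteg G -> cinteg (fun w => F w + G w).
Proof.
move=> [F1 F2] [G1 G2]; split.
  have -> : Re \o (fun w => F w + G w) = fun w => Re (F w) + Re (G w).
    by apply/funext => w /=; rewrite ReD.
  exact: integD.
have -> : Im \o (fun w => F w + G w) = fun w => Im (F w) + Im (G w).
  by apply/funext => w /=; rewrite ImD.
exact: integD.
Qed.

Lemma cmeanD F G : cinteg F -> cinteg G ->
  cmean (fun w => F w + G w) = cmean F + cmean G.
Proof.
move=> [F1 F2] [G1 G2]; apply: complex_eqP; rewrite (ReD, ImD) /= -meanD //.
  by congr mean; apply/funext => w /=; rewrite ReD.
by congr mean; apply/funext => w /=; rewrite ImD.
Qed.

Lemma cintegZ (k : R[i]) F : cinteg F -> cinteg (fun w => k * F w).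
Proof.
move=> [F1 F2]; split.
  have -> : Re \o (fun w => k * F w) = fun w => Re k * Re (F w) - Im k * Im (F w).
    by apply/funext => w /=; rewrite ReM.
  by apply: integB; exact: integZ.
have -> : Im \o (fun w => k * F w) = fun w => Re k * Im (F w) + Im k * Re (F w).
  by apply/funext => w /=; rewrite ImM.
by apply: integD; exact: integZ.
Qed.

Lemma cmeanZ (k : R[i]) F : cinteg F -> cmean (fun w => k * F w) = k * cmean F.
Proof.
move=> [F1 F2]; apply: complex_eqP; rewrite (ReM, ImM) /= -!meanZ //.
  rewrite -meanB; [|exact: integZ|exact: integZ].
  by congr mean; apply/funext => w /=; rewrite ReM.
rewrite -meanD; [|exact: integZ|exact: integZ].
by congr mean; apply/funext => w /=; rewrite ImM.
Qed.

Lemma cinteg_cst (c : R[i]) : cinteg (fun=> c).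
Proof. by split; exact: integ_cst. Qed.

Lemma cmean_cst (c : R[i]) : cmean (fun=> c) = c.
Proof. by apply: complex_eqP; rewrite /= mean_cst. Qed.

Lemma cintegB F G : cinteg F -> cinteg G -> cinteg (fun w => F w - G w).
Proof.
move=> hF hG; have := cintegD hF (cintegZ (-1) hG).
by under eq_fun do rewrite mulN1r.
Qed.

Lemma cmeanB F G : cinteg F -> cinteg G ->
  cmean (fun w => F w - G w) = cmean F - cmean G.
Proof.
move=> hF hG; rewrite -[- cmean G]mulN1r -cmeanZ // -cmeanD //; last exact: cintegZ.
by congr cmean; apply/funext => w; rewrite mulN1r.
Qed.

Lemma cinteg_sum (I : Type) (r : seq I) (Q : pred I) (h : I -> T -> R[i]) :
  (forall i, Q i -> cinteg (h i)) -> cinteg (fun w => \sum_(i <- r | Q i) h i w).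
Proof.
move=> H; elim: r => [|i r IH].
  by under eq_fun do rewrite big_nil; exact: cinteg_cst.
under eq_fun do rewrite big_cons.
case Qi: (Q i) => //.
by apply: cintegD => //; exact: H.
Qed.

Lemma cmean_sum (I : Type) (r : seq I) (Q : pred I) (h : I -> T -> R[i]) :
  (forall i, Q i -> cinteg (h i)) ->
  cmean (fun w => \sum_(i <- r | Q i) h i w) = \sum_(i <- r | Q i) cmean (h i).
Proof.
move=> H; elim: r => [|i r IH].
  by under eq_fun do rewrite big_nil; rewrite cmean_cst big_nil.
under eq_fun do rewrite big_cons; rewrite big_cons.
case: ifPn => Qi //; rewrite cmeanD ?IH //; first exact: H.
exact: cinteg_sum.
Qed.

Lemma integ_complex f : integ f -> cinteg (fun w => (f w)%:C).
Proof. by move=> hf; split=> //; exact: integ_cst. Qed.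

Lemma cmean_complex f : cmean (fun w => (f w)%:C) = (mean f)%:C.
Proof. by apply: complex_eqP => //=; exact: mean_cst. Qed.

(* The constant 2 comes from bounding real and imaginary parts separately. *)
Lemma normc_cmean F g : cinteg F -> integ g -> (forall w, normc (F w) <= g w) ->
  normc (cmean F) <= 2 * mean g.
Proof.
move=> [F1 F2] ig Fg; apply: le_trans (normc_leD _) _.
rewrite mulr_natl mulr2n; apply: lerD; apply: le_mean_norm => // w.
  exact: le_trans (normc_Re _) (Fg w).
exact: le_trans (normc_Im _) (Fg w).
Qed.

Lemma cmean_ae F G : measurable_fun setT (Re \o F) -> measurable_fun setT (Im \o F) ->
  measurable_fun setT (Re \o G) -> measurable_fun setT (Im \o G) ->
  {ae P, forall w, F w = G w} -> cmean F = cmean G.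
Proof.
move=> mF mF' mG mG' FG; apply: complex_eqP => /=; apply: mean_ae => //.
  by apply: filterS FG => w /= ->.
by apply: filterS FG => w /= ->.
Qed.

End Expectation.

(** * Symmetric second differences *)

Section CentralDifference.
Context {R : realType}.
Implicit Types (f : R -> R) (h t : R) (p : {poly R}).

(** Minus the usual second difference: on [t -> cos (t y)] it acts as multiplication by
    [2 - 2 cos (h y)], which is nonnegative, as Fatou's lemma requires. *)
Definition cdiff h f : R -> R := fun t => 2 * f t - f (t + h) - f (t - h).

Lemma size_shift_sub h p :
  (size ((p \Po ('X + h%:P)) - (p \Po ('X - h%:P)))%R <= (size p).-1)%N.
Proof.
elim/poly_ind: p => [|p c IH]; first by rewrite !comp_poly0 subrr size_poly0.
have [->|p0] := eqVneq p 0.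
  by rewrite mul0r add0r !comp_polyC subrr size_poly0.
rewrite size_MXaddC (negbTE p0) /= !comp_poly_MXaddC.
have -> : (p \Po ('X + h%:P)) * ('X + h%:P) + c%:P -
    ((p \Po ('X - h%:P)) * ('X - h%:P) + c%:P) =
    ((p \Po ('X + h%:P)) - (p \Po ('X - h%:P))) * 'X +
    h *: ((p \Po ('X + h%:P)) + (p \Po ('X - h%:P))).
  by rewrite -mul_polyC; ring.
apply: leq_trans (size_polyD _ _) _; rewrite geq_max; apply/andP; split.
  apply: leq_trans (size_polyMleq _ _) _; rewrite size_polyX addn2 /=.
  by rewrite (leq_ltn_trans IH) // ltn_predL size_poly_gt0.
apply: leq_trans (size_scale_leq _ _) _.
apply: leq_trans (size_polyD _ _) _; rewrite geq_max.
apply/andP; split; apply: leq_trans (size_comp_poly_leq _ _) _.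
  by rewrite size_XaddC muln1 prednK // size_poly_gt0.
by rewrite -polyCN size_XaddC muln1 prednK // size_poly_gt0.
Qed.

(** Horner induction: a factor ['X] adds [h] times the odd difference of [p], which loses only one
    degree but carries no factor ['X] itself. *)
Lemma size_cdiff_poly h p :
  (size (2 *: p - (p \Po ('X + h%:P)) - (p \Po ('X - h%:P)))%R <= (size p).-2)%N.
Proof.
elim/poly_ind: p => [|p c IH].
  by rewrite !comp_poly0 scaler0 !subr0 size_poly0.
have [->|p0] := eqVneq p 0.
  rewrite mul0r add0r !comp_polyC -mul_polyC.
  have -> : 2%:P * c%:P - c%:P - c%:P = 0 :> {poly R} by ring.
  by rewrite size_poly0.
rewrite size_MXaddC (negbTE p0) /= !comp_poly_MXaddC.
have -> : 2 *: (p * 'X + c%:P) - ((p \Po ('X + h%:P)) * ('X + h%:P) + c%:P) -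
    ((p \Po ('X - h%:P)) * ('X - h%:P) + c%:P) = (2 *: p - (p \Po ('X + h%:P)) - (p \Po ('X - h%:P))) * 'X -
    h *: ((p \Po ('X + h%:P)) - (p \Po ('X - h%:P))).
  by rewrite -!mul_polyC; ring.
apply: leq_trans (size_polyD _ _) _; rewrite geq_max size_polyN; apply/andP; split.
  set s := 2 *: p - _ - _ in IH *; have [->|s0] := eqVneq s 0.
    by rewrite mul0r size_poly0.
  rewrite size_mulX //; move: s0 IH; rewrite -size_poly_gt0.
  by case: (size p) => [|[|n]] /=; case: (size s).
by apply: leq_trans (size_scale_leq _ _) _; exact: size_shift_sub.
Qed.

Lemma cdiff_horner h p :
  cdiff h (horner p) = horner (2 *: p - (p \Po ('X + h%:P)) - (p \Po ('X - h%:P))).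
Proof.
by apply/funext => t; rewrite /cdiff !hornerE !horner_comp !hornerE.
Qed.

Lemma iter_cdiff_horner n h p : (size p <= n.*2)%N ->
  iter n (cdiff h) (horner p) = fun=> 0.
Proof.
elim: n p => [|n IH] p.
  by rewrite leqn0 size_poly_eq0 => /eqP ->; apply/funext => t; rewrite /= horner0.
move=> sp; rewrite iterSr cdiff_horner IH //.
by apply: leq_trans (size_cdiff_poly _ _) _; move: sp; case: (size p) => [|[|s]].
Qed.

Lemma iter_cdiffD n h f g :
  iter n (cdiff h) (fun t => f t + g t) =
  fun t => iter n (cdiff h) f t + iter n (cdiff h) g t.
Proof.
elim: n => [//|n IH]; rewrite iterS IH; apply/funext => t /=.
by rewrite /cdiff; ring.
Qed.

Lemma iter_cdiff_bound n h f (B r : R) : 0 <= h ->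
  (forall s, `|s| <= r + n%:R * h -> `|f s| <= B) ->
  forall t, `|t| <= r -> `|iter n (cdiff h) f t| <= 4 ^+ n * B.
Proof.
move=> h0; elim: n r => [|n IH] r H t tr.
  by rewrite /= expr0 mul1r; apply: H; rewrite mul0r addr0.
have {}IH s : `|s| <= r + h -> `|iter n (cdiff h) f s| <= 4 ^+ n * B.
  apply: IH => u ur; apply: H; apply: le_trans ur _.
  by rewrite -natr1; lra.
rewrite iterS {1}/cdiff.
have t1 : `|t + h| <= r + h.
  by apply: le_trans (ler_normD _ _) _; rewrite (ger0_norm h0) lerD2r.
have t2 : `|t - h| <= r + h.
  by apply: le_trans (ler_normB _ _) _; rewrite (ger0_norm h0) lerD2r.
have t3 : `|t| <= r + h by lra.
have := IH _ t1; have := IH _ t2; have := IH _ t3.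
rewrite exprS !ler_norml; lra.
Qed.

End CentralDifference.

(** * Even moments from the characteristic function *)

Section Moments.
Context {d : measure_display} {T : measurableType d} {R : realType}.
Variable P : probability T R.
Variable Y : T -> R.
Hypothesis mY : measurable_fun setT Y.

Lemma meas_cos (a : R) : measurable_fun setT (fun w => cos (a * Y w)).
Proof.
apply: (measurableT_comp (f := cos)).
  by apply: continuous_measurable_fun; exact: continuous_cos.
exact: measurable_funM.
Qed.

Lemma meas_sin (a : R) : measurable_fun setT (fun w => sin (a * Y w)).
Proof.
apply: (measurableT_comp (f := sin)).
  by apply: continuous_measurable_fun; exact: continuous_sin.
exact: measurable_funM.
Qed.

Lemma meas_exp (a : R) : measurable_fun setT (fun w => expR (a * Y w)).
Proof. by apply: (measurableT_comp (f := expR)) => //; exact: measurable_funM. Qed.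

Lemma iter_cdiff_mean n h t :
  iter n (cdiff h) (fun s => mean P (fun w => cos (s * Y w))) t =
  mean P (fun w => (2 - 2 * cos (h * Y w)) ^+ n * cos (t * Y w)).
Proof.
elim: n t => [|n IH] t.
  by rewrite /=; congr mean; apply/funext => w; rewrite expr0 mul1r.
have ig s : integ P (fun w => (2 - 2 * cos (h * Y w)) ^+ n * cos (s * Y w)).
  apply: (@integ_bounded _ _ _ _ _ (4 ^+ n)).
    apply: measurable_funM; last exact: meas_cos.
    apply: measurable_funX; apply: measurable_funB => //.
    by apply: measurable_funM => //; exact: meas_cos.
  move=> w; rewrite normrM normrX; apply: le_trans (_ : 4 ^+ n * 1 <= _); last by rewrite mulr1.
  apply: ler_pM; rewrite ?normr_ge0 ?exprn_ge0 ?cos_max //.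
  apply: lerXn2r; rewrite ?nnegrE //.
  by have := cos_le1 (h * Y w); have := cos_geN1 (h * Y w); rewrite ler_norml; lra.
rewrite iterS {1}/cdiff !IH -meanZ // -meanB //; last exact: integZ.
rewrite -meanB //; last by apply: integB => //; exact: integZ.
congr mean; apply/funext => w; rewrite exprSr.
have -> : (t + h) * Y w = t * Y w + h * Y w by ring.
have -> : (t - h) * Y w = t * Y w - h * Y w by ring.
by rewrite cosD cosB; ring.
Qed.

Lemma cos_taylor2 (x : R) : `|cos x - (1 - x ^+ 2 / 2)| <= `|x| ^+ 3.
Proof.
have := cexp_taylor 3 (0 +i* x).
have -> : normc (0 +i* x : R[i]) = `|x| by rewrite /= expr0n add0r sqrtr_sqr.
rewrite /= normr0 expR0 mulr1 => h.
have -> : cos x - (1 - x ^+ 2 / 2) = Re (cexp (0 +i* x) - (expp 3).[0 +i* x]).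
  rewrite ReD ReN /= expR0 mul1r expp_horner !big_ord_recl big_ord0 /=.
  by field.
apply: le_trans (normc_Re _) _; apply: le_trans h _.
have : 0 <= `|x| ^+ 3 by exact: exprn_ge0.
rewrite (_ : 3`! = 6%N) //; lra.
Qed.

Lemma cvg_of_bound (u v : nat -> R) (l : R) :
  (forall k, `|u k - l| <= v k) -> v @ \oo --> 0 -> u @ \oo --> l.
Proof.
move=> H v0; apply/cvgrPdist_le => e e0.
move/cvgrPdist_le : v0 => /(_ e e0); apply: filterS => k.
rewrite sub0r normrN distrC => ve; apply: le_trans (H k) _.
exact: le_trans (ler_norm _) ve.
Qed.

(** The iterated difference of order [2 n] kills [p], so the error bound keeps
    [E ((2 - 2 cos (h Y)) / h^2)^n] bounded as [h] tends to 0. The integrand tends to [Y^(2 n)], and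
    Fatou's lemma applies. *)
Lemma even_moment_of_expansion n (C eta : R) (p : {poly R}) :
  (size p <= n.*2)%N -> 0 < eta ->
  (forall t, `|t| <= eta ->
    `|mean P (fun w => cos (t * Y w)) - p.[t]| <= C * `|t| ^+ n.*2) ->
  integ P (fun w => Y w ^+ n.*2).
Proof.
move=> sp eta0 H.
(* The division by [n.+1] keeps the nodes of the iterated difference at 0, which reach [n * h k], in
   the interval of the expansion. *)
pose h (k : nat) : R := eta / n.+1%:R / k.+1%:R.
have h0 k : 0 < h k by rewrite !divr_gt0.
have nh k : n%:R * h k <= eta.
  rewrite /h mulrA ler_pdivrMr // mulrCA.
  have a1 : n%:R / n.+1%:R <= 1 :> R by rewrite ler_pdivrMr // mul1r ler_nat.
  have a2 : 1 <= k.+1%:R :> R by rewrite ler1n.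
  by rewrite ler_wpM2l ?(ltW eta0) // (le_trans a1 a2).
pose f (k : nat) w := ((2 - 2 * cos (h k * Y w)) / h k ^+ 2) ^+ n.
have [] := @mean_fatou _ _ _ P f (fun w => Y w ^+ n.*2) (4 ^+ n * (`|C| * n%:R ^+ n.*2)).
- move=> k; apply: (@integ_bounded _ _ _ _ _ ((4 / h k ^+ 2) ^+ n)).
    apply: measurable_funX; apply: measurable_funM => //.
    apply: measurable_funB => //.
    by apply: measurable_funM => //; exact: meas_cos.
  move=> w; rewrite normrX; apply: lerXn2r; rewrite ?nnegrE ?divr_ge0 ?sqr_ge0 //.
  rewrite normrM [`|_^-1|]ger0_norm ?invr_ge0 ?sqr_ge0 // ler_wpM2r ?invr_ge0 ?sqr_ge0 //.
  by have := cos_le1 (h k * Y w); have := cos_geN1 (h k * Y w); rewrite ler_norml; lra.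
- by move=> k w; apply: exprn_ge0; rewrite divr_ge0 ?sqr_ge0.
- move=> k.
  have -> : mean P (f k) = (h k ^+ n.*2)^-1 *
      iter n (cdiff (h k)) (fun s => mean P (fun w => cos (s * Y w))) 0.
    rewrite iter_cdiff_mean -meanZ; last first.
      apply: (@integ_bounded _ _ _ _ _ (4 ^+ n)).
        apply: measurable_funM; last exact: meas_cos.
        apply: measurable_funX; apply: measurable_funB => //.
        by apply: measurable_funM => //; exact: meas_cos.
      move=> w; rewrite mul0r cos0 mulr1 normrX.
      apply: lerXn2r; rewrite ?nnegrE //.
      by have := cos_le1 (h k * Y w); have := cos_geN1 (h k * Y w); rewrite ler_norml; lra.
    congr mean; apply/funext => w; rewrite /f expr_div_n mul0r cos0 mulr1 mulrC.
    by rewrite -exprM mul2n.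
  pose e s := mean P (fun w => cos (s * Y w)) - p.[s].
  have -> : (fun s => mean P (fun w => cos (s * Y w))) = (fun s => p.[s] + e s).
    by apply/funext => s; rewrite /e; ring.
  rewrite iter_cdiffD iter_cdiff_horner // add0r.
  have : `|iter n (cdiff (h k)) e 0| <= 4 ^+ n * (`|C| * (n%:R * h k) ^+ n.*2).
    apply: (@iter_cdiff_bound _ _ _ _ _ 0 (ltW (h0 k))) => [s|]; last by rewrite normr0.
    rewrite add0r => sn; apply: le_trans (H s (le_trans sn (nh k))) _.
    rewrite -[X in C * X]mulr1 mulrA.
    have s0 : 0 <= `|s| ^+ n.*2 by exact: exprn_ge0.
    have s1 : `|s| ^+ n.*2 <= (n%:R * h k) ^+ n.*2.
      by apply: lerXn2r; rewrite ?nnegrE // mulr_ge0 ?(ltW (h0 k)).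
    rewrite mulr1; apply: le_trans (_ : `|C| * `|s| ^+ n.*2 <= _).
      by rewrite ler_wpM2r ?ler_norm.
    by rewrite ler_wpM2l.
  rewrite exprMn => He; rewrite mulrC ler_pdivrMr ?exprn_gt0 //.
  by apply: le_trans (le_trans (ler_norm _) He) _; rewrite !mulrA.
- move=> w; rewrite -mul2n exprM.
  have hk : h @ \oo --> 0.
    rewrite /h -[X in _ --> X](mulr0 (eta / n.+1%:R)).
    by apply: cvgM; [exact: cvg_cst|exact: cvg_harmonic].
  apply: (@cvg_comp _ _ _ _ (fun x : R => x ^+ n) _ (nbhs (Y w ^+ 2))); last exact: exprn_continuous.
  apply: (@cvg_of_bound _ (fun k => 2 * `|Y w| ^+ 3 * h k)); last first.
    by rewrite -[X in _ --> X](mulr0 (2 * `|Y w| ^+ 3)); apply: cvgM => //; exact: cvg_cst.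
  move=> k; have hk0 : h k != 0 by rewrite gt_eqF.
  have -> : (2 - 2 * cos (h k * Y w)) / h k ^+ 2 - Y w ^+ 2 =
     - 2 * (cos (h k * Y w) - (1 - (h k * Y w) ^+ 2 / 2)) / h k ^+ 2 by field.
  rewrite normrM normrV ?unitfE ?expf_neq0 // normrX (gtr0_norm (h0 k)).
  rewrite ler_pdivrMr ?exprn_gt0 // normrM normrN (ger0_norm (ler0n _ 2)).
  have := cos_taylor2 (h k * Y w); rewrite [`|h k * Y w|]normrM exprMn (gtr0_norm (h0 k)).
  by lra.
by [].
Qed.

End Moments.

(** * Coefficients that vanish because a sum is small at 0 *)

Section SmallBounds.
Context {R : realType}.

Lemma le0_of_linear_bound (a D eta : R) : 0 < eta ->
  (forall t, 0 < t -> t <= eta -> a <= t * D) -> a <= 0.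
Proof.
move=> eta0 H; rewrite leNgt; apply/negP => a0.
have D0 : 0 < `|D| + 1 by rewrite ltr_wpDl.
pose t := Num.min eta (a / (2 * (`|D| + 1))).
have q0 : 0 < a / (2 * (`|D| + 1)) by rewrite divr_gt0 // mulr_gt0.
have t0 : 0 < t by rewrite lt_min eta0.
have te : t <= eta by rewrite ge_min lexx.
have ta : t * (2 * (`|D| + 1)) <= a by rewrite -ler_pdivlMr ?mulr_gt0 // ge_min lexx orbT.
have := H t t0 te; have := ler_norm D; nra.
Qed.

(** The constant coefficient is [O(t)], hence zero, and division by [t] lowers [n] by one. *)
Lemma coef_vanish n (a : nat -> R[i]) (C eta : R) : 0 < eta ->
  (forall t, 0 < t -> t <= eta ->
     normc (\sum_(k < n) a k * (t%:C) ^+ k) <= C * t ^+ n) ->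
  forall k, (k < n)%N -> a k = 0.
Proof.
elim: n a => [//|n IH] a eta0 H.
have step t : \sum_(k < n.+1) a k * (t%:C) ^+ k =
    a 0 + t%:C * \sum_(k < n) a k.+1 * (t%:C) ^+ k.
  rewrite big_ord_recl expr0 mulr1 mulr_sumr; congr (_ + _).
  by apply: eq_bigr => i _ /=; rewrite exprS; ring.
have a0 : a 0 = 0.
  apply: eq0_normc; apply/eqP; rewrite eq_le normc_ge0 andbT.
  apply: (@le0_of_linear_bound _ (`|C| + \sum_(k < n) normc (a k.+1)) (Num.min eta 1)).
    by rewrite lt_min eta0 ltr01.
  move=> t t0; rewrite le_min => /andP[te t1].
  have := H t t0 te; rewrite step => h.
  have -> : a 0 = (a 0 + t%:C * \sum_(k < n) a k.+1 * (t%:C) ^+ k) -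
     t%:C * \sum_(k < n) a k.+1 * (t%:C) ^+ k by rewrite addrK.
  apply: le_trans (normcD _ _) _; rewrite normc_opp mulrDr; apply: lerD.
    apply: le_trans h _; rewrite exprS mulrCA ler_wpM2l ?(ltW t0) //.
    apply: le_trans (ler_wpM2r (exprn_ge0 _ (ltW t0)) (ler_norm C)) _.
    by rewrite ler_piMr // exprn_ile1 // ltW.
  rewrite normcM normc_real gtr0_norm // ler_wpM2l ?(ltW t0) //.
  apply: le_trans (normc_sum _ _ _) _; apply: ler_sum => i _.
  rewrite normcM normcX normc_real gtr0_norm // ler_piMr ?normc_ge0 //.
  by rewrite exprn_ile1 // ltW.
case=> [//|k] kn; apply: (IH (fun k => a k.+1)) => // t t0 te.
have := H t t0 te; rewrite step a0 add0r normcM normc_real gtr0_norm //.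
by rewrite exprS mulrCA ler_pM2l.
Qed.

End SmallBounds.

(** * The Laplace transform and the moments *)

Section Transform.
Context {d : measure_display} {T : measurableType d} {R : realType}.
Variable P : probability T R.
Variable Y : T -> R.
Hypothesis mY : measurable_fun setT Y.
Implicit Types z omega : R[i].

(** On the imaginary axis this is the characteristic function; elsewhere it is used under
    integrability of [exp (Re z * Y)]. *)
Definition laplace z : R[i] := cmean P (fun w => cexp (z * (Y w)%:C)).

Definition all_exp_moments := forall r : R, integ P (fun w => expR (r * `|Y w|)).

Lemma cexp_mulE z (y : R) : cexp (z * y%:C) =
  (expR (Re z * y) * cos (Im z * y)) +i* (expR (Re z * y) * sin (Im z * y)).
Proof.
by rewrite /cexp ReM ImM /= !mulr0 subr0 add0r.
Qed.

Lemma normc_cexp_mul z (y : R) : normc (cexp (z * y%:C)) = expR (Re z * y).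
Proof. by rewrite normc_cexp ReM /= mulr0 subr0. Qed.

Lemma meas_Re_cexp z : measurable_fun setT (Re \o (fun w => cexp (z * (Y w)%:C))).
Proof.
have -> : Re \o (fun w => cexp (z * (Y w)%:C)) =
    fun w => expR (Re z * Y w) * cos (Im z * Y w).
  by apply/funext => w; rewrite -[LHS]/(Re (cexp (z * (Y w)%:C))) cexp_mulE.
by apply: measurable_funM; [exact: meas_exp|exact: meas_cos].
Qed.

Lemma meas_Im_cexp z : measurable_fun setT (Im \o (fun w => cexp (z * (Y w)%:C))).
Proof.
have -> : Im \o (fun w => cexp (z * (Y w)%:C)) =
    fun w => expR (Re z * Y w) * sin (Im z * Y w).
  by apply/funext => w; rewrite -[LHS]/(Im (cexp (z * (Y w)%:C))) cexp_mulE.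
by apply: measurable_funM; [exact: meas_exp|exact: meas_sin].
Qed.

Lemma cinteg_cexp z : integ P (fun w => expR (Re z * Y w)) ->
  cinteg P (fun w => cexp (z * (Y w)%:C)).
Proof.
move=> ig; apply: (cinteg_le (meas_Re_cexp z) (meas_Im_cexp z) ig) => w.
by rewrite normc_cexp_mul.
Qed.

Lemma integ_cexp_abs (r : R) : integ P (fun w => expR (`|r| * `|Y w|)) ->
  integ P (fun w => expR (r * Y w)).
Proof.
move=> h; apply: (integ_le _ h); first exact: meas_exp.
by move=> w; rewrite ger0_norm ?expR_ge0 // ler_expR -normrM ler_norm.
Qed.

Lemma meas_exp_abs (r : R) : measurable_fun setT (fun w => expR (r * `|Y w|)).
Proof.
apply: (measurableT_comp (f := expR)) => //.
by apply: measurable_funM => //; exact: measurableT_comp.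
Qed.

Definition moment k : R := mean P (fun w => Y w ^+ k).

(** The factor 4 is the 2 of [cexp_taylor] times the 2 of [normc_cmean]. *)
Lemma laplace_moments n z : (forall k, integ P (fun w => Y w ^+ k)) ->
  integ P (fun w => expR (`|Re z| * `|Y w|)) ->
  integ P (fun w => (normc z * `|Y w|) ^+ n / n`!%:R * expR (`|Re z| * `|Y w|)) ->
  normc (laplace z - \sum_(k < n) (moment k)%:C * (z ^+ k / k`!%:R)) <=
  4 * mean P (fun w => (normc z * `|Y w|) ^+ n / n`!%:R * expR (`|Re z| * `|Y w|)).
Proof.
move=> im ie ig.
have mz : cinteg P (fun w => cexp (z * (Y w)%:C)).
  by apply: cinteg_cexp; exact: integ_cexp_abs.
have mk k : cinteg P (fun w => (z ^+ k / k`!%:R) * (Y w ^+ k)%:C).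
  by apply: cintegZ; exact: integ_complex.
have -> : laplace z - \sum_(k < n) (moment k)%:C * (z ^+ k / k`!%:R) =
    cmean P (fun w => cexp (z * (Y w)%:C) - (expp n).[z * (Y w)%:C]).
  have -> : (fun w => cexp (z * (Y w)%:C) - (expp n).[z * (Y w)%:C]) =
     (fun w => cexp (z * (Y w)%:C) -
       \sum_(k < n) (z ^+ k / k`!%:R) * (Y w ^+ k)%:C).
    apply/funext => w; rewrite expp_horner; congr (_ - _); apply: eq_bigr => k _.
    by rewrite exprMn rmorphXn /=; ring.
  rewrite cmeanB //; last by apply: cinteg_sum => k _; exact: mk.
  rewrite cmean_sum // /laplace; congr (_ - _); apply: eq_bigr => k _.
  by rewrite cmeanZ ?cmean_complex 1?mulrC //; exact: integ_complex.
rewrite (_ : 4 = 2 * 2 :> R); last by rewrite -natrM.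
rewrite -mulrA -[2 * mean _ _]meanZ //.
apply: normc_cmean; last 1 first.
- move=> w; apply: le_trans (cexp_taylor _ _) _.
  rewrite normcM normc_real ReM /= mulr0 subr0 normrM.
  by rewrite -mulrA.
- have -> : (fun w => cexp (z * (Y w)%:C) - (expp n).[z * (Y w)%:C]) =
     (fun w => cexp (z * (Y w)%:C) -
       \sum_(k < n) (z ^+ k / k`!%:R) * (Y w ^+ k)%:C).
    apply/funext => w; rewrite expp_horner; congr (_ - _); apply: eq_bigr => k _.
    by rewrite exprMn rmorphXn /=; ring.
  by apply: cintegB => //; apply: cinteg_sum => k _; exact: mk.
- exact: integZ.
Qed.

(** Both sides have expansions of every order along the ray through [omega], and [coef_vanish]
    compares them. The direction [omega = i] demands only polynomial moments; [omega = 1] serves for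
    the normal law, whose transform is first known on the real axis. *)
Lemma moment_match (Q : {poly R[i]}) omega (eta : R) :
  Q`_0 = 0 -> omega != 0 -> 0 < eta ->
  (forall k, integ P (fun w => Y w ^+ k)) ->
  (forall k, integ P (fun w => `|Y w| ^+ k * expR (`|Re omega| * `|Y w|))) ->
  (forall t, 0 < t -> t <= eta -> laplace (t%:C * omega) = cexp Q.[t%:C * omega]) ->
  forall k, (moment k)%:C = k`!%:R * exp_coef Q k.
Proof.
move=> Q0 om0 eta0 im ie H k.
pose a j := ((moment j)%:C / j`!%:R - exp_coef Q j) * omega ^+ j.
have nom0 : 0 < normc omega.
  rewrite lt_def normc_ge0 andbT; apply/negP => /eqP h.
  by move: om0; rewrite (eq0_normc h) eqxx.
suff : a k = 0.
  move/eqP; rewrite mulf_eq0 expf_eq0 (negbTE om0) andbF orbF subr_eq0 => /eqP <-.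
  by rewrite mulrC divfK // pnatr_eq0 -lt0n fact_gt0.
pose n := k.+1.
pose K := mean P (fun w => `|Y w| ^+ n * expR (`|Re omega| * `|Y w|)).
(* The constant adds the two remainders. The radius ensures [normc (t omega) <= 1/2], as
   [cexp_poly_tail] requires for [tau = 1], and [t <= 1], so that up to the factor [t ^+ n] the
   integrand has a bound independent of [t]. *)
apply: (@coef_vanish _ n a (4 * normc omega ^+ n / n`!%:R * K +
   2 * expR (abs_poly Q).[1] * normc omega ^+ n)
   (Num.min eta (Num.min 1 ((normc omega)^-1 / 2)))).
- by rewrite !lt_min eta0 ltr01 /= divr_gt0 // invr_gt0.
- move=> t t0; rewrite !le_min => /and3P[te t1 tw].
  have -> : \sum_(j < n) a j * t%:C ^+ j =
    (cexp Q.[t%:C * omega] - \sum_(j < n) exp_coef Q j * (t%:C * omega) ^+ j) -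
    (laplace (t%:C * omega) - \sum_(j < n) (moment j)%:C * ((t%:C * omega) ^+ j / j`!%:R)).
    rewrite H //.
    have -> : \sum_(j < n) a j * t%:C ^+ j =
        \sum_(j < n) (moment j)%:C * ((t%:C * omega) ^+ j / j`!%:R) -
        \sum_(j < n) exp_coef Q j * (t%:C * omega) ^+ j.
      by rewrite -sumrB; apply: eq_bigr => j _; rewrite /a exprMn; ring.
    by ring.
  apply: le_trans (normcD _ _) _; rewrite normc_opp addrC mulrDl; apply: lerD.
    have dom w : (normc (t%:C * omega) * `|Y w|) ^+ n / n`!%:R *
          expR (`|Re (t%:C * omega)| * `|Y w|) <=
        (t ^+ n * (normc omega ^+ n / n`!%:R)) *
          (`|Y w| ^+ n * expR (`|Re omega| * `|Y w|)).
      rewrite normcM normc_real gtr0_norm // ReMr normrM gtr0_norm // !exprMn.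
      have -> : t ^+ n * normc omega ^+ n * `|Y w| ^+ n / n`!%:R =
        t ^+ n * (normc omega ^+ n / n`!%:R) * `|Y w| ^+ n by ring.
      rewrite -[leLHS]mulrA ler_wpM2l //.
        by rewrite mulr_ge0 ?exprn_ge0 ?(ltW t0) // divr_ge0 ?exprn_ge0 ?normc_ge0.
      rewrite ler_wpM2l ?exprn_ge0 // ler_expR ler_wpM2r //.
      by rewrite ler_piMl.
    have ig : integ P (fun w => (normc (t%:C * omega) * `|Y w|) ^+ n / n`!%:R *
          expR (`|Re (t%:C * omega)| * `|Y w|)).
      apply: (integ_le _ (integZ (t ^+ n * (normc omega ^+ n / n`!%:R)) (ie n))).
        apply: measurable_funM; last first.
          exact: meas_exp_abs.
        apply: measurable_funM => //; apply: measurable_funX.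
        by apply: measurable_funM => //; exact: measurableT_comp.
      by move=> w; rewrite ger0_norm ?dom // mulr_ge0 ?expR_ge0 // divr_ge0 // exprn_ge0 // mulr_ge0 ?normc_ge0.
    apply: le_trans (laplace_moments im _ ig) _.
      apply: (integ_le _ (ie 0)).
        exact: meas_exp_abs.
      move=> w; rewrite ger0_norm ?expR_ge0 // expr0 mul1r ler_expR ler_wpM2r //.
      by rewrite ReMr normrM gtr0_norm // ler_piMl.
    have -> : 4 * normc omega ^+ n / n`!%:R * K * t ^+ n =
       4 * (t ^+ n * (normc omega ^+ n / n`!%:R) * K) by ring.
    rewrite ler_wpM2l // /K -meanZ; last exact: ie.
    by apply: mean_le => //; exact: integZ.
  have := @cexp_poly_tail _ Q Q0 1 (t%:C * omega) n ltr01.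
  rewrite divr1 normcM normc_real gtr0_norm // => h.
  apply: le_trans (h _) _.
    have : t * normc omega <= (normc omega)^-1 / 2 * normc omega.
      by rewrite ler_wpM2r ?normc_ge0.
    by rewrite mulrAC mulVf ?gt_eqF // div1r.
  by rewrite exprMn; lra.
- by [].
Qed.

(** The moments are bounded through [exp_abs_coef], whose series converges everywhere; hence the
    partial sums of [exp (r Y) + exp (- r Y)] have bounded means, and Fatou's lemma gives the
    integrability of the sum. *)
Lemma exp_moments_of_coef (Q : {poly R[i]}) : Q`_0 = 0 ->
  (forall k, integ P (fun w => Y w ^+ k)) ->
  (forall k, (moment k)%:C = k`!%:R * exp_coef Q k) -> all_exp_moments.
Proof.
move=> Q0 im mc.
have mk k : `|moment k| / k`!%:R <= exp_abs_coef Q k.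
  apply: le_trans (exp_coef_le Q0 k).
  have f0 : 0 < k`!%:R :> R by rewrite ltr0n fact_gt0.
  rewrite ler_pdivrMr // -normc_real mc normcM mulrC.
  have -> : (k`!%:R : R[i]) = (k`!%:R)%:C by rewrite rmorph_nat.
  by rewrite normc_real ger0_norm.
suff H r : 0 <= r -> integ P (fun w => expR (r * `|Y w|)).
  move=> r; have h : 0 <= `|r| by [].
  apply: (integ_le _ (H _ h)).
    exact: meas_exp_abs.
  by move=> w; rewrite ger0_norm ?expR_ge0 // ler_expR ler_wpM2r // ler_norm.
move=> r0.
(* Only even powers survive, so the partial sums are nonnegative and their means involve no absolute
   moments. *)
pose f n w := \sum_(k < n) ((1 + (-1) ^+ k) * r ^+ k / k`!%:R) * Y w ^+ k.
have fE n w : f n w = \sum_(k < n) (r * Y w) ^+ k / k`!%:R +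
                      \sum_(k < n) (- (r * Y w)) ^+ k / k`!%:R.
  rewrite -big_split /=; apply: eq_bigr => k _.
  by rewrite [(- (r * _)) ^+ k]exprNn exprMn; ring.
have c0 k : 0 <= 1 + (-1) ^+ k :> R.
  by rewrite -signr_odd; case: (odd k); rewrite ?expr0 ?expr1; lra.
have cvg_exp (x : R) : (fun n => \sum_(k < n) x ^+ k / k`!%:R) @ \oo --> expR x.
  apply: (@cvg_of_bound _ _ (fun n => 2 * expR `|x| * (`|x| ^+ n / n`!%:R))).
    move=> n; have := cexp_taylor n (x%:C); rewrite normc_real /= => h.
    rewrite distrC; apply: le_trans (_ : _ <= 2 * (`|x| ^+ n / n`!%:R) * expR `|x|) _; last by lra.
    apply: le_trans h; apply: le_trans (normc_Re _); rewrite le_eqVlt; apply/orP; left.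
    apply/eqP; congr (`|_|); rewrite ReD ReN /= cos0 mulr1; congr (_ - _).
    rewrite expp_horner Re_sum; apply: eq_bigr => k _.
    have -> : x%:C ^+ k / k`!%:R = (x ^+ k / k`!%:R)%:C.
      by rewrite rmorphM fmorphV rmorph_nat rmorphXn.
    by [].
  rewrite -[X in _ --> X](mulr0 (2 * expR `|x|)).
  by apply: cvgM; [exact: cvg_cst|exact: cvg_pow_fact].
have [] := @mean_fatou _ _ _ P f (fun w => expR (r * Y w) + expR (- (r * Y w)))
    (2 * expR (abs_poly Q).[r]).
- by move=> n; apply: integ_sum => k _; exact: integZ.
- move=> n w; apply: sumr_ge0 => k _.
  rewrite -signr_odd; have [ok|ek] := boolP (odd k).
    by rewrite expr1 subrr !mul0r.
  rewrite expr0 mulr_ge0 //; first by rewrite !mulr_ge0 ?exprn_ge0 ?invr_ge0.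
  by rewrite exprn_even_ge0.
- move=> n; rewrite mean_sum; last by move=> k _; exact: integZ.
  apply: le_trans (_ : \sum_(k < n) 2 * (exp_abs_coef Q k * r ^+ k) <= _); last first.
    by rewrite -mulr_sumr ler_wpM2l // exp_abs_coef_sum.
  apply: ler_sum => k _; rewrite meanZ //.
  have c2 : 1 + (-1) ^+ k <= 2 :> R.
    by rewrite -signr_odd; case: (odd k); rewrite ?expr0 ?expr1; lra.
  have -> : (1 + (-1) ^+ k) * r ^+ k / k`!%:R * mean P (fun w => Y w ^+ k) =
    (1 + (-1) ^+ k) * (moment k / k`!%:R * r ^+ k) by rewrite /moment; ring.
  apply: le_trans (_ : (1 + (-1) ^+ k) * (exp_abs_coef Q k * r ^+ k) <= _).
    rewrite ler_wpM2l // ler_wpM2r ?exprn_ge0 //.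
    apply: le_trans (mk k); rewrite ler_wpM2r ?invr_ge0 //; exact: ler_norm.
  by rewrite ler_wpM2r // mulr_ge0 ?exprn_ge0 ?exp_abs_coef_ge0.
- move=> w; have -> : f ^~ w = (fun n => \sum_(k < n) (r * Y w) ^+ k / k`!%:R) +
      (fun n => \sum_(k < n) (- (r * Y w)) ^+ k / k`!%:R).
    by apply/funext => n; rewrite fE.
  exact: cvgD.
move=> ig _; apply: (integ_le _ ig).
  exact: meas_exp_abs.
move=> w; rewrite ger0_norm ?expR_ge0 //.
have [y0|y0] := leP 0 (Y w).
  by rewrite ger0_norm // lerDl expR_ge0.
by rewrite ltr0_norm // mulrN lerDr expR_ge0.
Qed.

Lemma integ_exp_pow : all_exp_moments ->
  forall k (r : R), integ P (fun w => `|Y w| ^+ k * expR (r * `|Y w|)).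
Proof.
move=> H k r; apply: (integ_le _ (integZ k`!%:R (H (r + 1)))).
  apply: measurable_funM.
    by apply: measurable_funX; exact: measurableT_comp.
  exact: meas_exp_abs.
move=> w; rewrite ger0_norm; last by rewrite mulr_ge0 ?exprn_ge0 ?expR_ge0.
rewrite mulrDl mul1r addrC expRD mulrA ler_wpM2r ?expR_ge0 //.
have f0 : 0 < k`!%:R :> R by rewrite ltr0n fact_gt0.
rewrite mulrC -ler_pdivrMr //.
apply: le_trans (exp_partial_sum k.+1 (normr_ge0 (Y w))).
by rewrite big_ord_recr /= lerDr sumr_ge0.
Qed.

Lemma integ_pow : all_exp_moments -> forall k, integ P (fun w => Y w ^+ k).
Proof.
move=> H k; apply: (integ_le _ (integ_exp_pow H k 0)); first exact: measurable_funX.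
by move=> w; rewrite mul0r expR0 mulr1 normrX.
Qed.

(** Both sides are the sum of the series with coefficients [exp_coef Q]: the remainder of the
    transform tends to 0 by dominated convergence, that of [cexp Q] by the geometric bound. *)
Lemma laplace_entire (Q : {poly R[i]}) : Q`_0 = 0 -> all_exp_moments ->
  (forall k, (moment k)%:C = k`!%:R * exp_coef Q k) ->
  forall z, laplace z = cexp Q.[z].
Proof.
move=> Q0 H mc z.
pose g n w := (normc z * `|Y w|) ^+ n / n`!%:R * expR (`|Re z| * `|Y w|).
have mg n : measurable_fun setT (g n).
  apply: measurable_funM; last first.
    exact: meas_exp_abs.
  apply: measurable_funM => //; apply: measurable_funX.
  by apply: measurable_funM => //; exact: measurableT_comp.
have g0 n w : 0 <= g n w.
  by rewrite mulr_ge0 ?expR_ge0 // divr_ge0 // exprn_ge0 // mulr_ge0 ?normc_ge0.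
have dom n w : `|g n w| <= expR ((normc z + `|Re z|) * `|Y w|).
  rewrite ger0_norm // mulrDl expRD ler_wpM2r ?expR_ge0 //.
  apply: le_trans (exp_partial_sum n.+1 _); last by rewrite mulr_ge0 ?normc_ge0.
  rewrite big_ord_recr /= lerDr sumr_ge0 // => i _.
  by rewrite divr_ge0 ?exprn_ge0 // mulr_ge0 ?normc_ge0.
have [] := @mean_dct _ _ _ P g (fun=> 0) _ mg (H (normc z + `|Re z|)) dom.
  move=> w; rewrite -[X in _ --> X](mul0r (expR (`|Re z| * `|Y w|))).
  by apply: cvgM; [exact: cvg_pow_fact|exact: cvg_cst].
move=> _; rewrite mean_cst => g_cvg.
(* Twice [normc z] makes the geometric bound applicable; the added 1 keeps [tau] positive when
   [z = 0]. *)
pose tau := 2 * normc z + 1.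
have z0 := normc_ge0 z.
have tau0 : 0 < tau by rewrite /tau; lra.
pose q := normc z / tau.
pose u n := 4 * mean P (g n) + 2 * expR (abs_poly Q).[tau] * q ^+ n.
have u0 : u @ \oo --> 0.
  rewrite -[X in _ --> X](addr0 0) -[X in _ --> X + _](mulr0 4).
  rewrite -[X in _ --> _ + X](mulr0 (2 * expR (abs_poly Q).[tau])).
  apply: cvgD; apply: cvgM => //; try exact: cvg_cst.
  apply: cvg_expr; rewrite ger0_norm /q ?divr_ge0 ?(ltW tau0) //.
  by rewrite ltr_pdivrMr // mul1r /tau; lra.
have : normc (laplace z - cexp Q.[z]) <= 0.
  apply: (@le_add_cvg0 _ _ _ u 0) => // n _; rewrite add0r.
  pose S := \sum_(k < n) exp_coef Q k * z ^+ k.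
  have -> : laplace z - cexp Q.[z] = (laplace z - S) - (cexp Q.[z] - S) by ring.
  apply: le_trans (normcD _ _) _; rewrite normc_opp; apply: lerD.
    have -> : S = \sum_(k < n) (moment k)%:C * (z ^+ k / k`!%:R).
      apply: eq_bigr => k _; rewrite mc.
      have : k`!%:R != 0 :> R[i] by rewrite pnatr_eq0 -lt0n fact_gt0.
      by move=> h; field.
    apply: laplace_moments; [exact: integ_pow|exact: H|].
    by apply: (integ_le (mg n) (H (normc z + `|Re z|))) => w; exact: dom.
  by apply: cexp_poly_tail => //; rewrite /tau; lra.
move=> h; apply/eqP; rewrite -subr_eq0; apply/eqP/eq0_normc/eqP.
by rewrite eq_le h normc_ge0.
Qed.

End Transform.

(** * A degree bound from the growth of the real part *)

Section DegreeBound.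
Context {R : realType}.

(** With [r = 1 / t] and after multiplication by [t ^+ N.+1], everything but the top coefficient is
    [O(t)]. *)
Lemma lead_coef_le0 (a : nat -> R) N (c : R) :
  (forall r, 0 < r -> \sum_(k < N.+2) a k * r ^+ k <= c) -> a N.+1 <= 0.
Proof.
move=> H.
apply: (@le0_of_linear_bound _ _ (`|c| + \sum_(k < N.+1) `|a k|) 1) => // t t0 t1.
have := H t^-1; rewrite invr_gt0 => /(_ t0); rewrite big_ord_recr /= => h.
have tN : 0 < t ^+ N.+1 by exact: exprn_gt0.
have {h} : (\sum_(k < N.+1) a k * t^-1 ^+ k + a N.+1 * t^-1 ^+ N.+1) * t ^+ N.+1 <=
   c * t ^+ N.+1 by rewrite ler_pM2r.
rewrite mulrDl -[a N.+1 * _ * _]mulrA -exprMn mulVf ?gt_eqF // expr1n mulr1.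
have h1 : c * t ^+ N.+1 <= t * `|c|.
  rewrite exprS mulrCA ler_pM2l //.
  apply: le_trans (ler_wpM2r (exprn_ge0 _ (ltW t0)) (ler_norm c)) _.
  by rewrite ler_piMr // exprn_ile1 // ltW.
have h2 : - (t * \sum_(k < N.+1) `|a k|) <=
    (\sum_(k < N.+1) a k * t^-1 ^+ k) * t ^+ N.+1.
  rewrite mulr_sumr mulr_suml -sumrN; apply: ler_sum => k _.
  have kN : (k <= N)%N by rewrite -ltnS.
  have -> : a k * t^-1 ^+ k * t ^+ N.+1 = a k * (t * t ^+ (N - k)).
    have tk : t ^+ k != 0 by rewrite expf_neq0 // gt_eqF.
    have -> : t ^+ N.+1 = t ^+ k * t ^+ (N.+1 - k) by rewrite -exprD subnKC // leqW.
    by rewrite exprVn mulrA divfK // -exprS -subSn.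
  have u0 : 0 <= t ^+ (N - k) by rewrite exprn_ge0 // ltW.
  have u1 : t ^+ (N - k) <= 1 by rewrite exprn_ile1 // ltW.
  have : `|a k * (t * t ^+ (N - k))| <= t * `|a k|.
    rewrite normrM (ger0_norm (mulr_ge0 (ltW t0) u0)) mulrC ler_wpM2r //.
    by rewrite ler_piMr // ltW.
  by rewrite ler_norml => /andP[].
by rewrite mulrDr; lra.
Qed.

Lemma cexpX (z : R[i]) n : cexp z ^+ n = cexp (n%:R * z).
Proof.
elim: n => [|n IH]; first by rewrite mul0r cexp0 expr0.
by rewrite exprS IH -cexpD -natr1 mulrDl mul1r addrC.
Qed.

(** Take an [N]-th root of [normc C / C]. If it is real, rotate it by [exp (2 pi i / N)], which is
    not real since [N >= 3] puts the angle strictly between 0 and [pi]. *)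
Lemma exists_nonreal_root (C : R[i]) N : (2 < N)%N -> C != 0 ->
  exists zeta : R[i], [/\ normc zeta = 1, C * zeta ^+ N = (normc C)%:C &
    `|Re zeta| < 1].
Proof.
move=> N2 C0; have N0 : (0 < N)%N by case: N N2.
pose z0 : R[i] := N.-root ((normc C)%:C / C).
have z0N : C * z0 ^+ N = (normc C)%:C by rewrite rootCK // mulrC divfK.
have nC : normc C != 0 by apply: contra C0 => /eqP /eq0_normc ->.
have nz0 : normc z0 = 1.
  have : normc z0 ^+ N = 1.
    apply: (mulfI nC); rewrite -normcX -normcM z0N normc_real ger0_norm ?normc_ge0 //.
    by rewrite mulr1.
  by move/eqP; rewrite pexpr_eq1 ?normc_ge0 // => /eqP.
have Re_lt (z : R[i]) : normc z = 1 -> Im z != 0 -> `|Re z| < 1.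
  move=> nz Iz; rewrite -(@ltr_pXn2r _ 2) ?nnegrE // expr1n real_normK ?num_real //.
  have : normc z ^+ 2 = 1 by rewrite nz expr1n.
  rewrite sqr_normcE => <-; rewrite ltrDl exprn_even_gt0 //.
have [Iz|Iz] := eqVneq (Im z0) 0; last by exists z0; split=> //; exact: Re_lt.
pose th : R := 2 * pi / N%:R.
have thpi : 0 < th < pi.
  have N3 : 3 <= N%:R :> R by rewrite (ler_nat _ 3 N).
  rewrite divr_gt0 ?mulr_gt0 ?pi_gt0 ?ltr0n //= ltr_pdivrMr ?ltr0n //.
  by have := @pi_gt0 R; nra.
pose om := cexp (0 +i* th).
have omN : om ^+ N = 1.
  rewrite /om cexpX; have -> : N%:R * (0 +i* th) = 0 +i* (pi *+ 2) :> R[i].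
    have -> : (N%:R : R[i]) = (N%:R)%:C by rewrite rmorph_nat.
    apply: complex_eqP; rewrite (ReMr, ImMr) /= ?mulr0 //.
    by rewrite /th mulrC divfK ?pnatr_eq0 -?lt0n // mulr_natl.
  by apply: complex_eqP; rewrite /= expR0 mul1r (cos2pi, sin2pi).
exists (z0 * om); split.
- by rewrite normcM nz0 mul1r /om normc_cexp /= expR0.
- by rewrite exprMn omN mulr1.
- apply: Re_lt; first by rewrite normcM nz0 mul1r /om normc_cexp /= expR0.
  rewrite ImM Iz mul0r addr0 mulf_neq0 //; last first.
    by rewrite /om /= expR0 mul1r gt_eqF // sin_gt0_pi.
  apply/negP => /eqP Rz; move: nz0; have -> : z0 = 0 by exact: complex_eqP.
  by rewrite normc0 => /eqP; rewrite eq_sym oner_eq0.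
Qed.

(* If [deg Q = N >= 3], the leading terms along the ray through [zeta] give
   [Re (C zeta^N) <= Re (C (Re zeta)^N)] for all [zeta]; this fails for a
   unit root of [C zeta^N = |C|] other than [1] and [-1]. *)
Lemma size_of_re_bound (Q : {poly R[i]}) (c : R) :
  (forall z, Re Q.[z] <= c + Re Q.[(Re z)%:C]) -> (size Q <= 3)%N.
Proof.
move=> H; rewrite leqNgt; apply/negP => sQ.
have [N sN] : exists N, size Q = N.+3.+1.
  by move: sQ; case: (size Q) => [|[|[|[|N]]]] // _; exists N.
pose C := Q`_N.+3.
have C0 : C != 0.
  have : lead_coef Q != 0 by rewrite lead_coef_eq0 -size_poly_eq0 sN.
  by rewrite lead_coefE sN.
have key zeta : Re (C * zeta ^+ N.+3) <= Re (C * (Re zeta)%:C ^+ N.+3).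
  pose a k := Re (Q`_k * zeta ^+ k) - Re (Q`_k * (Re zeta)%:C ^+ k).
  rewrite -subr_le0 -/(a N.+3); apply: (@lead_coef_le0 a N.+2 c) => r r0.
  have e (x : R[i]) : Re Q.[r%:C * x] = \sum_(k < N.+4) Re (Q`_k * x ^+ k) * r ^+ k.
    rewrite horner_coef sN Re_sum; apply: eq_bigr => k _.
    rewrite exprMn -rmorphXn mulrCA ReMr mulrC //.
  have := H (r%:C * zeta); rewrite ReMr.
  have -> : (r * Re zeta)%:C = r%:C * (Re zeta)%:C by rewrite rmorphM.
  rewrite !e -lerBlDr -sumrB; congr (_ <= _).
  by apply: eq_bigr => k _; rewrite -mulrBl.
have [zeta [nz Cz Rz]] := exists_nonreal_root (isT : (2 < N.+3)%N) C0.
have nC : 0 < normc C.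
  rewrite lt_def normc_ge0 andbT; apply/negP => /eqP h.
  by move: C0; rewrite (eq0_normc h) eqxx.
have := key zeta; rewrite Cz /= => h.
have : Re (C * (Re zeta)%:C ^+ N.+3) <= normc C * `|Re zeta| ^+ N.+3.
  apply: le_trans (ler_norm _) _; apply: le_trans (normc_Re _) _.
  by rewrite normcM normcX normc_real.
have : normc C * `|Re zeta| ^+ N.+3 < normc C.
  by rewrite -[ltRHS]mulr1 ltr_pM2l // exprn_ilt1.
lra.
Qed.

End DegreeBound.

(** * Marcinkiewicz's theorem *)

Section Marcinkiewicz.
Context {d : measure_display} {T : measurableType d} {R : realType}.
Variable P : probability T R.
Variable Y : T -> R.
Hypothesis mY : measurable_fun setT Y.

Definition var_of : R := moment P Y 2 - moment P Y 1 ^+ 2.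

(** Normality expressed by the transform; the value [var_of = 0] is allowed and covers constants. *)
Definition gaussian_transform : Prop :=
  all_exp_moments P Y /\ forall z, laplace P Y z =
    cexp ((moment P Y 1)%:C * z + (var_of / 2)%:C * z ^+ 2).

Lemma exp_coef1 (Q : {poly R[i]}) : Q`_0 = 0 -> exp_coef Q 1 = Q`_1.
Proof.
move=> Q0; rewrite /exp_coef /exp_series !big_ord_recr big_ord0 /= add0r.
by rewrite coefD !coefZ expr0 expr1 coef1 mulr0 add0r invr1 mul1r.
Qed.

Lemma exp_coef2 (Q : {poly R[i]}) : Q`_0 = 0 ->
  2 * exp_coef Q 2 = 2 * Q`_2 + Q`_1 ^+ 2.
Proof.
move=> Q0; rewrite /exp_coef /exp_series !big_ord_recr big_ord0 /= add0r.
rewrite 2!coefD !coefZ expr0 expr1 coef1 mulr0 add0r invr1 mul1r.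
have -> : (Q ^+ 2)`_2 = Q`_1 ^+ 2.
  rewrite expr2 coefM !big_ord_recr big_ord0 /= Q0.
  by rewrite !(mul0r, mulr0, add0r, addr0).
by rewrite (_ : 2`! = 2%N) // mulrDr mulrA mulfV ?mul1r.
Qed.

Lemma gaussian_of_laplace (Q : {poly R[i]}) : Q`_0 = 0 -> all_exp_moments P Y ->
  (forall k, (moment P Y k)%:C = k`!%:R * exp_coef Q k) -> gaussian_transform.
Proof.
move=> Q0 H mc; split=> // z.
have L := laplace_entire mY Q0 H mc; rewrite L.
have sQ : (size Q <= 3)%N.
  (* [ln 2] absorbs the factor 2 of [normc_cmean]; an additive constant does not affect the degree
     bound. *)
  apply: (@size_of_re_bound _ _ (ln 2)) => y.
  rewrite -ler_expR expRD lnK ?posrE //.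
  have -> : expR (Re Q.[y]) = normc (laplace P Y y) by rewrite L normc_cexp.
  have ig : integ P (fun w => expR (Re y * Y w)).
    by apply: integ_cexp_abs => //; exact: H.
  apply: le_trans (_ : 2 * mean P (fun w => expR (Re y * Y w)) <= _).
    apply: normc_cmean => //; first exact: cinteg_cexp.
    by move=> w; rewrite normc_cexp_mul.
  rewrite ler_wpM2l // -normc_cexp -L.
  apply: le_trans (normc_Re _); apply: le_trans (ler_norm _).
  rewrite /laplace /= le_eqVlt; apply/orP; left; apply/eqP; congr mean.
  by apply/funext => w; rewrite -[RHS]/(Re (cexp _)) cexp_mulE /= mul0r cos0 mulr1.
congr cexp; rewrite (horner_coef_wide z sQ) !big_ord_recr big_ord0 /=.
rewrite Q0 mul0r !add0r expr1 mc exp_coef1 //= factS fact0 mul1r.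
congr (_ + _ * _).
have := mc 2; have := mc 1; rewrite /= factS fact0 mul1r exp_coef1 // => m1 m2.
have := exp_coef2 Q0; rewrite -m1.
have -> : 2 * exp_coef Q 2 = (moment P Y 2)%:C.
  by rewrite m2 !factS fact0.
rewrite /var_of => h; have two0 : 2 != 0 :> R[i] by rewrite pnatr_eq0.
rewrite rmorphM rmorphB rmorphXn fmorphV rmorph_nat /= h.
by field.
Qed.

Lemma laplace_im (t : R) :
  Re (laplace P Y (t%:C * 'i%C)) = mean P (fun w => cos (t * Y w)).
Proof.
rewrite /laplace /=; congr mean; apply/funext => w.
by rewrite -[LHS]/(Re (cexp _)) cexp_mulE ReMr ImMr /= mulr0 mul0r expR0 mul1r mulr1.
Qed.

Theorem marcinkiewicz (Q : {poly R[i]}) (delta : R) : Q`_0 = 0 -> 0 < delta ->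
  (forall t, `|t| < delta ->
     laplace P Y (t%:C * 'i%C) = cexp Q.[t%:C * 'i%C]) ->
  gaussian_transform.
Proof.
move=> Q0 d0 H.
have ni : normc ('i%C : R[i]) = 1 by rewrite /= expr0n add0r expr1n sqrtr1.
(* The real part of the transform at [i t] is [E cos (t Y)], and the Taylor polynomial of [exp Q]
   supplies its expansion. *)
have even n : integ P (fun w => Y w ^+ n.*2).
  pose p : {poly R} := \poly_(j < n.*2) Re (exp_coef Q j * 'i%C ^+ j).
  (* The bound 1/2 is the [tau / 2] of [cexp_poly_tail] for [tau = 1]. *)
  pose eta := Num.min (delta / 2) 2^-1.
  apply: (@even_moment_of_expansion _ _ _ _ _ mY n
    (2 * expR (abs_poly Q).[1]) eta p).
  - exact: size_poly.
  - by rewrite /eta lt_min; apply/andP; split; lra.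
  - move=> t; rewrite /eta le_min => /andP[t1 t2].
    have td : `|t| < delta by apply: le_lt_trans t1 _; lra.
    rewrite -laplace_im H //.
    have -> : p.[t] = Re (\sum_(j < n.*2) exp_coef Q j * (t%:C * 'i%C) ^+ j).
      rewrite horner_poly Re_sum; apply: eq_bigr => j _.
      by rewrite exprMn -rmorphXn mulrCA ReMr mulrC.
    rewrite -ReN -ReD; apply: le_trans (normc_Re _) _.
    have := @cexp_poly_tail _ Q Q0 1 (t%:C * 'i%C) n.*2 ltr01.
    by rewrite divr1 normcM normc_real ni mulr1 div1r; exact.
(* Odd moments are covered by [|y|^k <= 1 + y^(2 k)]. *)
have im k : integ P (fun w => Y w ^+ k).
  apply: (integ_le _ (integD (integ_cst P 1) (even k))); first exact: measurable_funX.
  move=> w; rewrite normrX -mul2n mulnC exprM -[Y w ^+ k ^+ 2]real_normK ?num_real //.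
  rewrite normrX; have : 0 <= `|Y w| ^+ k by exact: exprn_ge0.
  by set y := _ ^+ k; nra.
have ri : Re ('i%C : R[i]) = 0 by [].
have mc : forall k, (moment P Y k)%:C = k`!%:R * exp_coef Q k.
  apply: (@moment_match _ _ _ _ _ mY Q 'i%C (delta / 2)) => //.
  - by apply/negP => /eqP h; have := ni; rewrite h normc0 => /eqP; rewrite eq_sym oner_eq0.
  - by rewrite divr_gt0.
  - move=> k; rewrite ri normr0.
    have -> : (fun w => `|Y w| ^+ k * expR (0 * `|Y w|)) = fun w => `|Y w ^+ k|.
      by apply/funext => w; rewrite mul0r expR0 mulr1 normrX.
    exact: integ_norm.
  - by move=> t t0 t1; apply: H; rewrite gtr0_norm //; apply: le_lt_trans t1 _; lra.
exact: gaussian_of_laplace Q0 (exp_moments_of_coef mY Q0 im mc) mc.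
Qed.

End Marcinkiewicz.

(** * Polynomial approximation of a threshold *)

Section ThresholdLimit.
Context {R : realType}.

Lemma cvg_mulrn_expr (q : R) : 0 <= q -> q < 1 -> (fun n => n%:R * q ^+ n) @ \oo --> 0.
Proof.
rewrite le_eqVlt => /predU1P[<-|q0] q1.
  apply: (@cvg_of_bound _ _ (fun=> 0)); last exact: cvg_cst.
  by case=> [|n]; rewrite ?mul0r ?expr0n ?mulr0 subr0 normr0.
pose a := - ln q.
have a0 : 0 < a by rewrite oppr_gt0 ln_lt0 // q0.
have qE n : q ^+ n = (expR (a * n%:R))^-1.
  by rewrite -expRN -mulNr opprK mulrC expRM_natl lnK // posrE.
apply: (@cvg_of_bound _ _ (fun n => 2 / a ^+ 2 / n.+1%:R + 2 / a ^+ 2 / n.+1%:R)).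
  case=> [|n]; first by rewrite mul0r subr0 normr0 addr_ge0 // divr_ge0 // divr_ge0 // sqr_ge0.
  rewrite subr0 ger0_norm; last by rewrite mulr_ge0 ?exprn_ge0 // ltW.
  rewrite qE ler_pdivrMr ?expR_gt0 //.
  have := @exp_partial_sum R 3 (a * n.+1%:R); rewrite mulr_ge0 ?(ltW a0) // => /(_ isT).
  rewrite !big_ord_recr big_ord0 /= (_ : 2`! = 2%N) // => h.
  have h2 : (a * n.+1%:R) ^+ 2 / 2 <= expR (a * n.+1%:R).
    apply: le_trans h; rewrite lerDr add0r addr_ge0 // ?divr_ge0 ?expr0 ?expr1 //.
    by rewrite mulr_ge0 // ltW.
  have c0 : 0 <= 2 / a ^+ 2 / n.+2%:R + 2 / a ^+ 2 / n.+2%:R.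
    by rewrite addr_ge0 // divr_ge0 // divr_ge0 // sqr_ge0.
  apply: le_trans (ler_wpM2l c0 h2).
  have n2 : n.+2%:R != 0 :> R by rewrite pnatr_eq0.
  have -> : (2 / a ^+ 2 / n.+2%:R + 2 / a ^+ 2 / n.+2%:R) *
     ((a * n.+1%:R) ^+ 2 / 2) = 2 * n.+1%:R ^+ 2 / n.+2%:R.
    have an : a != 0 by rewrite gt_eqF.
    by move: n2; move: n.+2%:R n.+1%:R => u v u0; field; rewrite ?u0 ?an.
  rewrite ler_pdivlMr ?ltr0n // expr2 mulrCA ler_wpM2l //.
  by rewrite -natrM ler_nat mul2n -addnn addSn !addnS !ltnS leq_addr.
rewrite -[X in _ --> X](addr0 0); rewrite -[X in _ --> X + _](mulr0 (2 / a ^+ 2)).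
rewrite -[X in _ --> _ + X](mulr0 (2 / a ^+ 2)).
by apply: cvgD; apply: cvgM; [exact: cvg_cst|exact: cvg_harmonic|exact: cvg_cst|exact: cvg_harmonic].
Qed.

(* A sequence of polynomials in [v] converging boundedly on [0, 1] to the
   indicator of [v < 1/2], the value at [1/2] included. *)
Definition threshold (n : nat) (v : R) : R := (1 - v ^+ n) ^+ (n * 2 ^ n).

Lemma threshold_itv n v : 0 <= v <= 1 -> 0 <= threshold n v <= 1.
Proof.
move=> /andP[v0 v1]; have h : 0 <= 1 - v ^+ n <= 1.
  by rewrite subr_ge0 exprn_ile1 //= lerBlDr lerDl exprn_ge0.
by case/andP: h => h0 h1; rewrite /threshold exprn_ge0 //= exprn_ile1.
Qed.

(** Bernoulli's inequality gives [1 - threshold n v <= n (2 v)^n]. *)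
Lemma threshold_lt (v : R) : 0 <= v -> v < 2^-1 -> threshold ^~ v @ \oo --> (1 : R).
Proof.
move=> v0 v2; apply: (@cvg_of_bound _ _ (fun n => n%:R * (2 * v) ^+ n)); last first.
  by apply: cvg_mulrn_expr; lra.
move=> n; have v1 : v <= 1 by lra.
have /andP[_ t1] := @threshold_itv n v (introT andP (conj v0 v1)).
rewrite distrC ger0_norm ?subr_ge0 // lerBlDr -lerBlDl.
have vn0 : 0 <= v ^+ n by exact: exprn_ge0.
have vn1 : v ^+ n <= 1 by exact: exprn_ile1.
have bern k : 1 - k%:R * v ^+ n <= (1 - v ^+ n) ^+ k.
  elim: k => [|k IH]; first by rewrite mul0r subr0 expr0.
  rewrite exprS -natr1; have : 0 <= 1 - v ^+ n by lra.
  have : 0 <= k%:R :> R by [].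
  by move: IH vn0; set b := _ ^+ k; set y := v ^+ n; set kk := k%:R; nra.
apply: le_trans (bern (n * 2 ^ n)%N); rewrite natrM natrX -mulrA exprMn //.
Qed.

(** From [1 - v^n <= exp (- 2^-n)] the threshold is at most [exp (- n)]; the factor [n] in its
    exponent is what forces the limit 0 at [v = 1/2]. *)
Lemma threshold_ge (v : R) : 2^-1 <= v -> v <= 1 -> threshold ^~ v @ \oo --> (0 : R).
Proof.
move=> v2 v1; have v0 : 0 <= v by lra.
apply: (@cvg_of_bound _ _ (fun n => (expR (-1)) ^+ n)); last first.
  by apply: cvg_expr; rewrite ger0_norm ?expR_ge0 // expR_lt1; lra.
move=> n; have /andP[t0 _] := @threshold_itv n v (introT andP (conj v0 v1)).
rewrite subr0 ger0_norm // /threshold mulnC exprM.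
apply: lerXn2r; rewrite ?nnegrE ?expR_ge0 ?exprn_ge0 ?subr_ge0 ?exprn_ile1 //.
have h : 1 - v ^+ n <= expR (- 2^-1 ^+ n).
  apply: le_trans (expR_ge1Dx _); rewrite lerD2l lerN2.
  by apply: lerXn2r; rewrite ?nnegrE.
have : (1 - v ^+ n) ^+ (2 ^ n) <= expR (- 2^-1 ^+ n) ^+ (2 ^ n).
  by apply: lerXn2r; rewrite ?nnegrE ?expR_ge0 ?subr_ge0 ?exprn_ile1.
move=> /le_trans; apply; rewrite -expRM_natl ler_expR.
by rewrite natrX mulrN -exprMn mulfV // expr1n.
Qed.

End ThresholdLimit.

(** * Trigonometric polynomials with real frequencies *)

Section TrigPolynomials.
Context {R : realType}.

(** Phases include the sines and frequency 0 the constants; with arbitrary real frequencies the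
    class is closed under products, by the product formula for cosines. *)
Inductive trig : (R -> R) -> Prop :=
| TrigCos (k c b : R) : trig (fun x => k * cos (c * x + b))
| TrigAdd f g : trig f -> trig g -> trig (fun x => f x + g x).

Lemma trig_cst (k : R) : trig (fun=> k).
Proof.
have -> : (fun=> k) = (fun x : R => k * cos (0 * x + 0)).
  by apply/funext => x; rewrite mul0r addr0 cos0 mulr1.
exact: TrigCos.
Qed.

Lemma trig_mul f g : trig f -> trig g -> trig (fun x => f x * g x).
Proof.
move=> tf; elim: tf g => [k c b|f1 f2 _ H1 _ H2] g tg; last first.
  have -> : (fun x => (f1 x + f2 x) * g x) = (fun x => f1 x * g x + f2 x * g x).
    by apply/funext => x; rewrite mulrDl.
  by apply: TrigAdd; [exact: H1|exact: H2].
elim: tg => [k' c' b'|g1 g2 _ H1 _ H2]; last first.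
  have -> : (fun x => k * cos (c * x + b) * (g1 x + g2 x)) =
     (fun x => k * cos (c * x + b) * g1 x + k * cos (c * x + b) * g2 x).
    by apply/funext => x; rewrite mulrDr.
  exact: TrigAdd.
have -> : (fun x => k * cos (c * x + b) * (k' * cos (c' * x + b'))) =
   (fun x => k * k' / 2 * cos ((c + c') * x + (b + b')) +
             k * k' / 2 * cos ((c - c') * x + (b - b'))).
  apply/funext => x.
  have -> : (c + c') * x + (b + b') = (c * x + b) + (c' * x + b') by ring.
  have -> : (c - c') * x + (b - b') = (c * x + b) - (c' * x + b') by ring.
  by move: (c * x + b) (c' * x + b') => u v; rewrite cosD cosB; field.
by apply: TrigAdd; exact: TrigCos.
Qed.

Lemma trig_exp f n : trig f -> trig (fun x => f x ^+ n).
Proof.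
move=> tf; elim: n => [|n IH].
  by under eq_fun do rewrite expr0; exact: trig_cst.
by under eq_fun do rewrite exprS; exact: trig_mul.
Qed.

Lemma trig_continuous f : trig f -> continuous f.
Proof.
elim=> [k c b|f1 f2 _ H1 _ H2] x; last by apply: cvgD; [exact: H1|exact: H2].
apply: cvgM; first exact: cvg_cst.
apply: (@continuous_comp _ _ _ (fun x : R => c * x + b) (@cos R)); last exact: continuous_cos.
by apply: cvgD; [apply: cvgM; [exact: cvg_cst|exact: cvg_id]|exact: cvg_cst].
Qed.

Lemma trig_bounded f : trig f -> exists C, forall x, `|f x| <= C.
Proof.
elim=> [k c b|f1 f2 _ [C1 H1] _ [C2 H2]].
  by exists `|k| => x; rewrite normrM ler_piMr // cos_max.
by exists (C1 + C2) => x; apply: le_trans (ler_normD _ _) _; exact: lerD.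
Qed.

End TrigPolynomials.

(** * Test functions whose means are determined by the characteristic function *)

Section CharacteristicFunction.
Context {R : realType}.
Context {d : measure_display} {T : measurableType d} (P : probability T R).
Context {d' : measure_display} {T' : measurableType d'} (P' : probability T' R).
Variables (X : T -> R) (X' : T' -> R).
Hypotheses (mX : measurable_fun setT X) (mX' : measurable_fun setT X').
Hypothesis cfE : forall t, laplace P X (t%:C * 'i%C) = laplace P' X' (t%:C * 'i%C).

Lemma laplace_im_sin {dd} {S : measurableType dd} (Q : probability S R) (Y : S -> R) (t : R) :
  Im (laplace Q Y (t%:C * 'i%C)) = mean Q (fun w => sin (t * Y w)).
Proof.
rewrite /laplace /=; congr mean; apply/funext => w.
by rewrite -[LHS]/(Im (cexp _)) cexp_mulE ReMr ImMr /= mulr0 mul0r expR0 mul1r mulr1.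
Qed.

Definition bounded_meas (g : R -> R) :=
  measurable_fun setT g /\ exists C, forall x, `|g x| <= C.

Lemma integ_bounded_meas {dd} {S : measurableType dd} (Q : probability S R) (Y : S -> R) g :
  measurable_fun setT Y -> bounded_meas g -> integ Q (fun w => g (Y w)).
Proof.
move=> mY [mg [C gC]]; apply: (@integ_bounded _ _ _ _ _ C) => //.
exact: measurableT_comp.
Qed.

Lemma trig_bounded_meas f : trig f -> bounded_meas f.
Proof.
move=> tf; split; last exact: trig_bounded.
by apply: continuous_measurable_fun; exact: trig_continuous.
Qed.

Lemma trig_mean f : trig f -> mean P (fun w => f (X w)) = mean P' (fun w => f (X' w)).
Proof.
elim=> [k c b|f1 f2 t1 H1 t2 H2]; last first.
  by rewrite !meanD ?H1 ?H2 //; apply: integ_bounded_meas => //; exact: trig_bounded_meas.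
have E : forall dd (S : measurableType dd) (Q : probability S R) (Y : S -> R),
    measurable_fun setT Y -> mean Q (fun w => k * cos (c * Y w + b)) =
    k * cos b * mean Q (fun w => cos (c * Y w)) +
    - (k * sin b) * mean Q (fun w => sin (c * Y w)).
  move=> dd S Q Y mY.
  have i1 : integ Q (fun w => cos (c * Y w)).
    by apply: (@integ_bounded _ _ _ _ _ 1); [exact: meas_cos|move=> w; exact: cos_max].
  have i2 : integ Q (fun w => sin (c * Y w)).
    by apply: (@integ_bounded _ _ _ _ _ 1); [exact: meas_sin|move=> w; exact: sin_max].
  rewrite -!meanZ // -meanD; [|exact: integZ|exact: integZ].
  by congr mean; apply/funext => w; rewrite cosD; ring.
by rewrite !E // -!laplace_im -!laplace_im_sin cfE.
Qed.

(* Testing against all trigonometric polynomials makes the class stable under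
   multiplication by bounded limits of trigonometric polynomials. *)
Definition agree (g : R -> R) := bounded_meas g /\
  forall h, trig h ->
    mean P (fun w => g (X w) * h (X w)) = mean P' (fun w => g (X' w) * h (X' w)).

Lemma trig_agree f : trig f -> agree f.
Proof.
move=> tf; split; first exact: trig_bounded_meas.
by move=> h th; apply: (trig_mean (trig_mul tf th)).
Qed.

Lemma bounded_measM f g : bounded_meas f -> bounded_meas g ->
  bounded_meas (fun x => f x * g x).
Proof.
move=> [mf [C fC]] [mg [D gD]]; split; first exact: measurable_funM.
by exists (C * D) => x; rewrite normrM ler_pM.
Qed.

Lemma agree_lim (g : nat -> R -> R) f (C : R) : (forall n, agree (g n)) ->
  (forall n x, `|g n x| <= C) -> (forall x, g ^~ x @ \oo --> f x) -> agree f.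
Proof.
move=> ag gC gf.
have bf : bounded_meas f.
  split; first by apply: (measurable_fun_cvg (fun n => (ag n).1.1)) => x _; exact: gf.
  exists C => x.
  have h1 : (fun n => `|g n x|) @ \oo --> `|f x| by apply: cvg_norm; exact: gf.
  rewrite -(cvg_lim _ h1) //; apply: limr_le; first exact: cvgP h1.
  by apply: nearW => n; exact: gC.
split=> // h th; have [D hD] := trig_bounded th.
have E : forall dd (S : measurableType dd) (Q : probability S R) (Y : S -> R),
    measurable_fun setT Y ->
    (fun n => mean Q (fun w => g n (Y w) * h (Y w))) @ \oo -->
    mean Q (fun w => f (Y w) * h (Y w)).
  move=> dd S Q Y mY; have [] := @mean_dct _ _ _ Q (fun n w => g n (Y w) * h (Y w))
    (fun w => f (Y w) * h (Y w)) (fun=> C * D) => //.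
  - move=> n; apply: measurable_funM.
      exact: measurableT_comp (ag n).1.1 mY.
    exact: measurableT_comp (trig_bounded_meas th).1 mY.
  - exact: integ_cst.
  - by move=> n w; rewrite normrM ler_pM.
  - by move=> w; apply: cvgM; [exact: gf|exact: cvg_cst].
have := E _ _ P X mX; have := E _ _ P' X' mX'.
have -> : (fun n => mean P' (fun w => g n (X' w) * h (X' w))) =
          (fun n => mean P (fun w => g n (X w) * h (X w))).
  by apply/funext => n; rewrite (ag n).2.
by move=> h1 h2; exact: (cvg_unique _ h2 h1).
Qed.

Lemma agree_mul_trig f g : agree f -> trig g -> agree (fun x => f x * g x).
Proof.
move=> [bf Hf] tg; split; first exact: bounded_measM bf (trig_bounded_meas tg).
move=> h th; have := Hf _ (trig_mul tg th).
by congr (_ = _); congr mean; apply/funext => w; rewrite mulrA.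
Qed.

(** For [c != 0], the indicator of a periodic family of intervals, one of them centred at [a]. *)
Definition near_center (c a x : R) : R := (0 < cos (c * (x - a)))%R%:R.

(** The condition [v x < 1/2] means [cos (c (x - a)) > 0], so the indicator is the bounded limit of
    the trigonometric polynomials [threshold n (v x)]. *)
Lemma agree_mul_near f c a : agree f -> agree (fun x => f x * near_center c a x).
Proof.
move=> af; have [_ [C fC]] := af.1.
pose v (x : R) := (1 - cos (c * (x - a))) / 2.
have v01 x : 0 <= v x <= 1.
  have := cos_le1 (c * (x - a)); have := cos_geN1 (c * (x - a)); rewrite /v => h1 h2.
  by apply/andP; split; lra.
have tv : trig v.
  have -> : v = (fun x => 2^-1 + (- 2^-1) * cos (c * x + (- (c * a)))).
    by apply/funext => x; rewrite /v mulrBr; field.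
  by apply: TrigAdd; [exact: trig_cst|exact: TrigCos].
have tt n : trig (fun x => threshold n (v x)).
  rewrite /threshold; apply: (@trig_exp _ (fun x => 1 - v x ^+ n)).
  have -> : (fun x => 1 - v x ^+ n) = (fun x => 1 + (-1) * v x ^+ n).
    by apply/funext => x; rewrite mulN1r.
  by apply: TrigAdd; [exact: trig_cst|apply: trig_mul; [exact: trig_cst|exact: trig_exp]].
apply: (@agree_lim (fun n x => f x * threshold n (v x)) _ C).
- by move=> n; exact: agree_mul_trig.
- move=> n x; have /andP[t0 t1] := threshold_itv n (v01 x).
  rewrite normrM (ger0_norm t0); apply: le_trans (fC x).
  by rewrite ler_piMr.
- move=> x; apply: cvgM; first exact: cvg_cst.
  have /andP[v0 v1] := v01 x; rewrite /near_center; case: ltP => h.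
    by apply: threshold_lt => //; rewrite /v; lra.
  by apply: threshold_ge => //; rewrite /v; lra.
Qed.

Lemma agree_near_prod c a J :
  agree (fun x => \prod_(j < J) near_center (c / 2 ^+ j) a x).
Proof.
elim: J => [|J IH].
  by under eq_fun do rewrite big_ord0; exact/trig_agree/trig_cst.
by under eq_fun do rewrite big_ord_recr /=; exact: agree_mul_near.
Qed.

(* Halving the frequency repeatedly removes the periodic copies of the
   interval. *)
Lemma near_prod_cvg c a (x : R) :
  (fun J => \prod_(j < J) near_center (c / 2 ^+ j) a x) @ \oo -->
  ((`|c * (x - a)| < pi / 2)%R%:R : R).
Proof.
set y := c * (x - a).
have E j : near_center (c / 2 ^+ j) a x = (0 < cos (y / 2 ^+ j))%R%:R.
  by rewrite /near_center /y mulrAC.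
have pi0 := @pi_gt0 R.
have two0 j : 0 < 2 ^+ j :> R by exact: exprn_gt0.
have cosy (z : R) : `|z| < pi / 2 -> 0 < cos z.
  by rewrite ltr_norml => h; exact: cos_gt0_pihalf.
have [yp|yp] := ltP `|y| (pi / 2).
  have -> : (fun J => \prod_(j < J) near_center (c / 2 ^+ j) a x) = (fun=> 1).
    apply/funext => J; rewrite big1 // => j _; rewrite E cosy //.
    rewrite normrM normfV (gtr0_norm (two0 j)); apply: le_lt_trans yp.
    by rewrite ler_pdivrMr // ler_peMr // exprn_ege1 // ler1n.
  exact: cvg_cst.
(* The last halving of [|y|] that is still at least [pi / 2] lies below [pi], where the cosine is at
   most 0; from then on the product vanishes. *)
have [j0 hj0] : exists j0, cos (y / 2 ^+ j0) <= 0.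
  have [M My] : exists M : nat, `|y| / 2 ^+ M < pi / 2.
    have h0 : (fun n => `|y| * (2^-1) ^+ n) @ \oo --> 0.
      rewrite -[X in _ --> X](mulr0 `|y|); apply: cvgM; first exact: cvg_cst.
      by apply: cvg_expr; rewrite ger0_norm // invf_lt1 // ltr1n.
    have p2 : 0 < pi / 2 :> R by lra.
    move/cvgrPdist_lt : h0 => /(_ _ p2) [M _ /(_ M (leqnn M))] /=.
    rewrite sub0r normrN => h; exists M; apply: le_lt_trans h.
    by rewrite exprVn ler_norm.
  elim: M My => [|M IH] My; first by move: My; rewrite expr0 divr1 ltNge yp.
  have [yM|yM] := ltP (`|y| / 2 ^+ M) (pi / 2); first exact: IH.
  exists M; rewrite -cos_norm normrM normfV (gtr0_norm (two0 M)).
  set z := `|y| / 2 ^+ M in yM *.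
  have z2 : z < pi by move: My; rewrite exprS invfM mulrCA -/z; lra.
  rewrite -[z](subrK (pi / 2)) cosDpihalf oppr_le0 sin_ge0_pi //.
  by apply/andP; split; lra.
apply: (@cvg_of_bound _ _ (fun n => (n <= j0)%:R)).
  move=> n; rewrite subr0; have [nj|jn] := leqP n j0.
    elim/big_rec: _ => [|i z _ h]; first by rewrite normr1.
    by rewrite E normrM; case: (0 < _); rewrite ?normr1 ?mul1r ?normr0 ?mul0r.
  by rewrite (bigD1 (Ordinal jn)) //= E ltNge hj0 mul0r normr0.
apply/cvgrPdist_le => e e0; near=> n; rewrite sub0r normrN.
by rewrite leqNgt (_ : (j0 < n)%N) ?normr0 ?ltW //; near: n; exact: nbhs_infty_gt.
Unshelve. all: by end_near.
Qed.

Lemma agree_itv (a rho : R) : 0 < rho -> agree (fun x => (`|x - a| < rho)%R%:R).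
Proof.
move=> r0; have pi0 := @pi_gt0 R.
pose c := pi / 2 / rho.
have c0 : 0 < c by rewrite !divr_gt0.
have -> : (fun x => (`|x - a| < rho)%R%:R) = (fun x => (`|c * (x - a)| < pi / 2)%R%:R : R).
  apply/funext => x; rewrite normrM (gtr0_norm c0) /c mulrAC -mulrA gtr_pMr ?divr_gt0 //.
  by rewrite ltr_pdivrMr // mul1r.
apply: (@agree_lim _ _ 1 (agree_near_prod c a)) => [n x|x].
  elim/big_rec: _ => [|i z _ h]; first by rewrite normr1.
  rewrite /near_center normrM.
  by case: (0 < _); rewrite ?normr1 ?mul1r ?normr0 ?mul0r.
exact: near_prod_cvg.
Qed.

End CharacteristicFunction.

(** * A law is determined by its characteristic function *)

Section LawUniqueness.
Context {R : realType}.
Context {d : measure_display} {T : measurableType d} (P : probability T R).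
Context {d' : measure_display} {T' : measurableType d'} (P' : probability T' R).
Variables (X : T -> R) (X' : T' -> R).
Hypotheses (mX : measurable_fun setT X) (mX' : measurable_fun setT X').
Hypothesis cfE : forall t, laplace P X (t%:C * 'i%C) = laplace P' X' (t%:C * 'i%C).

Lemma mean_indic {dd} {S : measurableType dd} (Q : probability S R) (A : set S) :
  measurable A -> ((mean Q \1_A)%:E = Q A)%E.
Proof.
move=> mA; rewrite /mean /Rintegral integral_indic // setIT fineK //.
exact: fin_num_measure.
Qed.

Lemma law_itv (a b : R) :
  P (X @^-1` `]a, b[%classic) = P' (X' @^-1` `]a, b[%classic).
Proof.
have [ba|ab] := leP b a.
  rewrite set_itv_ge ?bnd_simp -?leNgt // !preimage_set0 !measure0 //.
have r0 : 0 < (b - a) / 2 by lra.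
have [_ /(_ _ (trig_cst 1))] := agree_itv mX mX' cfE ((a + b) / 2) r0.
have E : forall dd (S : measurableType dd) (Q : probability S R) (Y : S -> R),
    measurable_fun setT Y ->
    ((mean Q (fun w => (`|Y w - (a + b) / 2| < (b - a) / 2)%R%:R * 1))%:E =
     Q (Y @^-1` `]a, b[%classic))%E.
  move=> dd S Q Y mY; rewrite -mean_indic; last first.
    by rewrite -[X in measurable X]setTI; apply: mY.
  congr (_%:E); congr mean; apply/funext => w; rewrite mulr1 indicE; congr (_%:R).
  congr nat_of_bool; apply/idP/idP.
    rewrite inE /= in_itv /= ltr_norml => /andP[h1 h2]; apply/andP; split; lra.
  rewrite inE /= in_itv /= => /andP[h1 h2]; rewrite ltr_norml; apply/andP; split; lra.
by move=> h; rewrite -!E // h.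
Qed.

(** Open intervals generate the measurable sets and are stable under intersection, so agreement on
    them is enough. *)
Theorem law_unique (B : set R) : measurable B -> P (X @^-1` B) = P' (X' @^-1` B).
Proof.
move=> mB.
pose Y : {mfun T >-> R} := mfun_Sub (mem_set mX).
pose Y' : {mfun T' >-> R} := mfun_Sub (mem_set mX').
apply: (measure_unique (@RGenOpens.G R) (fun n => `](- n%:R), n%:R[%classic)
  _ _ _ _ (distribution P Y) (distribution P' Y')) => //.
- exact: RGenOpens.measurableE.
- move=> _ _ [a [b ->]] [a' [b' ->]].
  exists (Num.max a a'), (Num.min b b'); apply/seteqP.
  split=> x /=; rewrite !in_itv /= gt_max lt_min.
    by move=> [/andP[-> ->] /andP[-> ->]].
  by move=> /andP[/andP[-> ->] /andP[-> ->]].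
- by move=> n; exists (- n%:R), n%:R.
- apply/seteqP; split=> // x _; have [n xn] : exists n : nat, `|x| < n%:R.
    by exists (Num.truncn `|x|).+1; exact: truncnS_gt.
  by exists n => //=; rewrite in_itv /= -ltr_norml.
- by move=> _ [a [b ->]]; exact: law_itv.
- by move=> n; apply: le_lt_trans (probability_le1 _ _) _ => //; exact: ltry.
Qed.

End LawUniqueness.

(** * The transform of the normal law *)

Section NormalTransform.
Context {R : realType}.
Variables (m sigma : R).
Hypothesis sigma0 : 0 < sigma.
Local Notation mu := lebesgue_measure.
Local Notation nu := (normal_prob m sigma).

(** The Radon-Nikodym derivative is identified almost everywhere with the density, both having the
    same integrals over measurable sets. *)
Lemma integral_normal_prob (f : R -> R) : measurable_fun setT f -> (forall x, 0 <= f x) ->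
  (\int[nu]_x (f x)%:E = \int[mu]_x (f x * normal_pdf m sigma x)%:E)%E.
Proof.
move=> mf f0; have dom := normal_prob_dominates m sigma.
have mfE : measurable_fun setT (EFin \o f) by exact/measurable_EFinP.
rewrite -(Radon_Nikodym_SigmaFinite.change_of_variables dom) //.
apply: ae_eq_integral => //.
- apply: emeasurable_funM => //.
  exact: measurable_int (Radon_Nikodym_SigmaFinite.f_integrable dom).
- by apply/measurable_EFinP; apply: measurable_funM => //; exact: measurable_normal_pdf.
have : ae_eq mu setT (Radon_Nikodym_SigmaFinite.f nu mu)
    (fun x => (normal_pdf m sigma x)%:E).
  apply: integral_ae_eq => //.
  - exact: Radon_Nikodym_SigmaFinite.f_integrable.
  - by apply/measurable_EFinP; exact: measurable_normal_pdf.
  - by move=> A _ mA; rewrite -(Radon_Nikodym_SigmaFinite.f_integral dom).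
by apply: filterS => x /(_ I) /= -> _; rewrite EFinM.
Qed.

Lemma normal_mgf (r : R) : integ nu (fun x => expR (r * x)) /\
  mean nu (fun x => expR (r * x)) = expR (r * m + r ^+ 2 * sigma ^+ 2 / 2).
Proof.
have s0 : sigma != 0 by rewrite gt_eqF.
have mexp : measurable_fun setT (fun x : R => expR (r * x)).
  by apply: (measurableT_comp (f := expR)) => //; exact: measurable_funM.
have H : (\int[nu]_x (expR (r * x))%:E =
    (expR (r * m + r ^+ 2 * sigma ^+ 2 / 2))%:E)%E.
  rewrite integral_normal_prob //.
  (* Completing the square: a tilt by [exp (r x)] shifts the mean by [r sigma^2]. *)
  have -> : (fun x => (expR (r * x) * normal_pdf m sigma x)%:E) =
    (fun x => (expR (r * m + r ^+ 2 * sigma ^+ 2 / 2))%:E *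
              (normal_pdf (m + r * sigma ^+ 2) sigma x)%:E)%E.
    apply/funext => x; rewrite !normal_pdfE // -EFinM; congr (_%:E).
    rewrite mulrCA [RHS]mulrCA; congr (_ * _).
    rewrite /normal_fun -!expRD; congr expR.
    by field.
  rewrite integralZl //; last exact: integrable_normal_pdf.
  by rewrite integral_normal_pdf mule1.
have ig : integ nu (fun x => expR (r * x)).
  apply/integrableP; split; first exact/measurable_EFinP.
  under eq_integral do rewrite /= ger0_norm ?expR_ge0 //.
  by rewrite H ltry.
by split=> //; rewrite /mean /Rintegral H.
Qed.

(** The real axis, known from [normal_mgf], fixes the moments, and the moments give the transform on
    the plane. *)
Lemma normal_transform z : laplace nu id z =
  cexp (m%:C * z + (sigma ^+ 2 / 2)%:C * z ^+ 2).
Proof.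
have mid : measurable_fun setT (id : R -> R) by exact: measurable_id.
have H : all_exp_moments nu (id : R -> R).
  move=> r; have [h1 _] := normal_mgf r; have [h2 _] := normal_mgf (- r).
  apply: (integ_le _ (integD h1 h2)); first exact: meas_exp_abs.
  move=> x; rewrite ger0_norm ?expR_ge0 //; have [x0|x0] := leP 0 x.
    by rewrite ger0_norm // lerDl expR_ge0.
  by rewrite ltr0_norm // mulrN mulNr lerDr expR_ge0.
pose Q : {poly R[i]} := m%:C *: 'X + (sigma ^+ 2 / 2)%:C *: 'X^2.
have QE y : Q.[y] = m%:C * y + (sigma ^+ 2 / 2)%:C * y ^+ 2 by rewrite !hornerE.
have Q0 : Q`_0 = 0 by rewrite -horner_coef0 QE expr0n /= !mulr0 addr0.
rewrite -QE; apply: (@laplace_entire _ _ _ nu id mid Q Q0 H).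
apply: (@moment_match _ _ _ nu id mid Q 1 1 Q0) => //.
- exact: (@integ_pow _ _ _ nu id mid H).
- by move=> k; exact: (@integ_exp_pow _ _ _ nu id mid H).
- move=> t _ _; rewrite mulr1 QE.
  have -> : laplace nu id t%:C = (mean nu (fun x => expR (t * x)))%:C.
    rewrite -cmean_complex; congr cmean; apply/funext => x.
    by rewrite cexp_mulE /= mul0r cos0 sin0 mulr1 mulr0.
  rewrite (normal_mgf t).2.
  have -> : m%:C * t%:C + (sigma ^+ 2 / 2)%:C * t%:C ^+ 2 =
      (t * m + t ^+ 2 * sigma ^+ 2 / 2)%:C.
    by rewrite -rmorphXn -!rmorphM -rmorphD /=; congr _%:C; ring.
  by apply: complex_eqP; rewrite /= ?cos0 ?sin0 ?mulr1 ?mulr0.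
Qed.

End NormalTransform.

(** * From a Gaussian transform to a normal law *)

Section GaussianIsNormal.
Context {d : measure_display} {T : measurableType d} {R : realType}.
Variable P : probability T R.

Lemma var_ofE (Y : T -> R) : measurable_fun setT Y -> all_exp_moments P Y ->
  var_of P Y = mean P (fun w => (Y w - moment P Y 1) ^+ 2).
Proof.
move=> mY H; have i1 : integ P Y by have := integ_pow mY H 1; under eq_fun do rewrite expr1.
have i2 := integ_pow mY H 2.
have m1 : mean P Y = moment P Y 1 by congr mean; apply/funext => w; rewrite expr1.
have -> : (fun w => (Y w - moment P Y 1) ^+ 2) =
    (fun w => Y w ^+ 2 + ((- 2 * moment P Y 1) * Y w + moment P Y 1 ^+ 2)).
  by apply/funext => w; ring.
rewrite meanD //; last by apply: integD; [exact: integZ|exact: integ_cst].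
rewrite meanD; [|exact: integZ|exact: integ_cst].
by rewrite meanZ // mean_cst m1 /var_of /moment; ring.
Qed.

Lemma gaussian_real_normal (Y : T -> R) : measurable_fun setT Y ->
  gaussian_transform P Y -> real_normal P Y.
Proof.
move=> mY [H L]; split=> //.
have vE := var_ofE mY H.
have i1 : integ P Y by have := integ_pow mY H 1; under eq_fun do rewrite expr1.
have v0 : 0 <= var_of P Y by rewrite vE; apply: mean_ge0 => w; exact: sqr_ge0.
move: v0; rewrite le_eqVlt => /predU1P[v0|v0].
  left; exists (moment P Y 1).
  have ig : integ P (fun w => (Y w - moment P Y 1) ^+ 2).
    have -> : (fun w => (Y w - moment P Y 1) ^+ 2) =
      (fun w => Y w ^+ 2 + ((- 2 * moment P Y 1) * Y w + moment P Y 1 ^+ 2)).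
      by apply/funext => w; ring.
    apply: integD; first exact: integ_pow.
    by apply: integD; [exact: integZ|exact: integ_cst].
  have := mean0_ae ig (fun w => sqr_ge0 _); rewrite -vE -v0 => /(_ erefl).
  by apply: filterS => w /eqP; rewrite sqrf_eq0 subr_eq0 => /eqP.
right; pose sigma := Num.sqrt (var_of P Y).
have s0 : 0 < sigma by rewrite sqrtr_gt0.
exists (moment P Y 1), sigma; split=> // B mB.
rewrite (@law_unique R _ _ P _ _ (normal_prob (moment P Y 1) sigma) Y id) //.
by move=> t; rewrite L normal_transform // sqr_sqrtr // ltW.
Qed.

End GaussianIsNormal.

(** * Functions with vanishing finite differences *)

Section FiniteDifference.
Context {R : realType}.
Implicit Types (g v : R -> R) (h t : R) (p : {poly R}).

Definition fdiff h g : R -> R := fun t => g (t + h) - g t.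

(** The extension step: if moreover the [N]-th difference is zero, a function vanishing at [N]
    successive nodes vanishes at the next one. *)
Lemma iter_fdiff_vanish N h v t : (forall i, (i < N)%N -> v (t + i%:R * h) = 0) ->
  iter N (fdiff h) v t = v (t + N%:R * h).
Proof.
elim: N t => [|N IH] t H; first by rewrite /= mul0r addr0.
have e i : t + h + i%:R * h = t + i.+1%:R * h by rewrite -natr1; ring.
rewrite iterS {1}/fdiff IH; last by move=> i iN; rewrite e; exact: H.
rewrite IH; last by move=> i iN; apply: H; exact: ltnW.
by rewrite (H N) // subr0 e.
Qed.

Lemma iter_fdiffB N h v g t :
  iter N (fdiff h) (fun s => v s - g s) t = iter N (fdiff h) v t - iter N (fdiff h) g t.
Proof.
elim: N t => [//|N IH] t; have e f : iter N.+1 (fdiff h) f t =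
    iter N (fdiff h) f (t + h) - iter N (fdiff h) f t by [].
by rewrite !e !IH; ring.
Qed.

Lemma size_fdiff_poly h p : (size ((p \Po ('X + h%:P)) - p)%R <= (size p).-1)%N.
Proof.
elim/poly_ind: p => [|p c IH]; first by rewrite comp_poly0 subrr size_poly0.
have [->|p0] := eqVneq p 0.
  by rewrite mul0r add0r !comp_polyC subrr size_poly0.
rewrite size_MXaddC (negbTE p0) /= !comp_poly_MXaddC.
have -> : (p \Po ('X + h%:P)) * ('X + h%:P) + c%:P - (p * 'X + c%:P) =
    ((p \Po ('X + h%:P)) - p) * 'X + h *: (p \Po ('X + h%:P)).
  by rewrite -mul_polyC; ring.
apply: leq_trans (size_polyD _ _) _; rewrite geq_max; apply/andP; split.
  apply: leq_trans (size_polyMleq _ _) _; rewrite size_polyX addn2 /=.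
  by rewrite (leq_ltn_trans IH) // ltn_predL size_poly_gt0.
apply: leq_trans (size_scale_leq _ _) _.
apply: leq_trans (size_comp_poly_leq _ _) _.
by rewrite size_XaddC muln1 prednK // size_poly_gt0.
Qed.

Lemma iter_fdiff_poly N h p t : (size p <= N)%N -> iter N (fdiff h) (horner p) t = 0.
Proof.
elim: N p => [|N IH] p.
  by rewrite leqn0 size_poly_eq0 => /eqP -> /=; rewrite horner0.
move=> sp; rewrite iterSr.
have -> : fdiff h (horner p) = horner ((p \Po ('X + h%:P)) - p).
  by apply/funext => s; rewrite /fdiff !hornerE horner_comp !hornerE.
by apply: IH; apply: leq_trans (size_fdiff_poly _ _) _; case: (size p) sp.
Qed.

(** Newton's scheme: each correction is a multiple of the node polynomial [w], which is zero at the
    earlier nodes. *)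
Lemma interpolation N h (y : nat -> R) : h != 0 ->
  exists2 p : {poly R}, (size p <= N)%N & forall i, (i < N)%N -> p.[i%:R * h] = y i.
Proof.
move=> h0; elim: N => [|N [p sp pE]]; first by exists 0; rewrite ?size_poly0.
pose w : {poly R} := \prod_(i < N) ('X - (i%:R * h)%:P).
have wE x : w.[x] = \prod_(i < N) (x - i%:R * h).
  by rewrite horner_prod; apply: eq_bigr => i _; rewrite !hornerE.
have w0 : w.[N%:R * h] != 0.
  rewrite wE; apply/prodf_neq0 => i _; rewrite -mulrBl mulf_neq0 // subr_eq0 eqr_nat.
  by rewrite gtn_eqF.
have sw : size w = N.+1.
  by rewrite /w size_prod_XsubC [index_enum _]unlock -enumT size_enum_ord.
exists (p + ((y N - p.[N%:R * h]) / w.[N%:R * h]) *: w).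
  apply: leq_trans (size_polyD _ _) _; rewrite geq_max (leqW sp) /=.
  by apply: leq_trans (size_scale_leq _ _) _; rewrite sw.
move=> i; rewrite ltnS leq_eqVlt hornerD hornerZ => /predU1P[->|iN].
  by rewrite divfK // addrC subrK.
have -> : w.[i%:R * h] = 0 by rewrite wE (bigD1 (Ordinal iN)) //= subrr mul0r.
by rewrite mulr0 addr0 pE.
Qed.

(* The interpolation polynomials on the nodes [i h] for [h = eta / k] all agree
   with the one for [h = eta], since they coincide on the coarse nodes; hence
   the function is polynomial on a dense set. *)
Lemma poly_of_fdiff N (delta : R) g : 0 < delta ->
  (forall t h, `|t| < delta -> 0 <= h -> h < delta -> iter N (fdiff h) g t = 0) ->
  (forall (u : nat -> R) t, `|t| < delta -> u @ \oo --> t -> g \o u @ \oo --> g t) ->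
  exists2 p : {poly R}, (size p <= N)%N & forall t, `|t| < delta / 2 -> g t = p.[t].
Proof.
move=> d0 H cont.
(* The origin is moved to [- delta / 2], so that all nodes are nonnegative multiples of the step. *)
pose a := - (delta / 2); pose G s := g (a + s).
(* With this step the nodes [0, ..., N] stay below [delta]. *)
pose eta := delta / N.+1%:R.
have N1 : 1 <= N.+1%:R :> R by rewrite ler1n.
have eta0 : 0 < eta by rewrite divr_gt0.
have eta_d k : eta / k.+1%:R <= eta.
  by rewrite ler_pdivrMr // ler_peMr ?(ltW eta0) // ler1n.
have etaN (i : nat) : (i < N.+1)%N -> i%:R * eta < delta.
  move=> iN; rewrite /eta mulrCA gtr_pMr // ltr_pdivrMr // mul1r ltr_nat //.
(* Strong induction: agreement at the [N] nodes before [j] and a vanishing [N]-th difference force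
   agreement at [j]. *)
have lattice (h : R) (q : {poly R}) : 0 < h -> h <= eta -> (size q <= N)%N ->
    (forall i, (i < N)%N -> q.[i%:R * h] = G (i%:R * h)) ->
    forall j : nat, j%:R * h < delta -> q.[j%:R * h] = G (j%:R * h).
  move=> h0 heta sq qE j; elim/ltn_ind: j => j IH jd.
  have [jN|Nj] := ltnP j N; first exact: qE.
  have [n jE] : exists n, j = (n + N)%N by exists (j - N)%N; rewrite subnK.
  have [N0|N0] := posnP N.
    have q0 : q = 0 by apply/eqP; rewrite -size_poly_eq0 -leqn0 -{1}N0.
    rewrite q0 horner0 /G.
    have := H (a + j%:R * h) 0; rewrite N0 /= => -> //.
      rewrite /a ltr_norml; have : 0 <= j%:R * h by rewrite mulr_ge0 // ltW.
      by move=> ?; apply/andP; split; lra.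
  have nd : n%:R * h < delta.
    by apply: le_lt_trans jd; rewrite ler_wpM2r ?(ltW h0) // ler_nat jE leq_addr.
  pose v s := G s - q.[s].
  have van : forall i, (i < N)%N -> v (n%:R * h + i%:R * h) = 0.
    move=> i iN; rewrite -mulrDl -natrD /v IH ?subrr //; first by rewrite jE ltn_add2l.
    by apply: le_lt_trans jd; rewrite ler_wpM2r ?(ltW h0) // ler_nat jE leq_add2l ltnW.
  have := iter_fdiff_vanish van; rewrite /v iter_fdiffB iter_fdiff_poly // subr0.
  have shift k s : iter k (fdiff h) G s = iter k (fdiff h) g (a + s).
    elim: k s => [//|k IHk] s; have e f y : iter k.+1 (fdiff h) f y =
        iter k (fdiff h) f (y + h) - iter k (fdiff h) f y by [].
    by rewrite !e !IHk addrA.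
  rewrite shift H ?(ltW h0) //; last 2 first.
    rewrite /a ltr_norml; have : 0 <= n%:R * h by rewrite mulr_ge0 // ltW.
    by move=> ?; apply/andP; split; lra.
    apply: le_lt_trans heta _; rewrite /eta ltr_pdivrMr // ltr_pMr // ltr1n.
    by rewrite ltnS.
  by rewrite -mulrDl -natrD -jE => /eqP; rewrite eq_sym subr_eq0 => /eqP.
have [p sp pE] := interpolation N (fun i => G (i%:R * eta)) (lt0r_neq0 eta0).
have fine_lattice (k j : nat) : j%:R * (eta / k.+1%:R) < delta ->
    p.[j%:R * (eta / k.+1%:R)] = G (j%:R * (eta / k.+1%:R)).
  pose h := eta / k.+1%:R; have h0 : 0 < h by rewrite divr_gt0.
  have [q sq qE] := interpolation N (fun i => G (i%:R * h)) (lt0r_neq0 h0).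
  have qL := lattice h q h0 (eta_d k) sq qE.
  suff -> : p = q by exact: qL.
  apply/eqP; rewrite -subr_eq0; apply/eqP.
  apply: (@roots_geq_poly_eq0 _ _ [seq i%:R * eta | i <- iota 0 N]).
  - apply/allP => x /mapP[l]; rewrite mem_iota add0n => /andP[_ lN] ->.
    rewrite rootE hornerD hornerN pE //.
    have ik : l%:R * eta = (l * k.+1)%:R * h.
      by rewrite natrM -mulrA /h [k.+1%:R * _]mulrC divfK ?pnatr_eq0.
    by rewrite ik qL ?subrr // -ik etaN // ltnW.
  - rewrite map_inj_uniq ?iota_uniq // => i i' /(mulIf (lt0r_neq0 eta0)) /eqP.
    by rewrite eqr_nat => /eqP.
  - rewrite size_map size_iota; apply: leq_trans (size_polyD _ _) _.
    by rewrite geq_max sp size_polyN.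
exists (p \Po ('X - a%:P)).
  by rewrite size_comp_poly2 ?size_XsubC.
move=> t td; rewrite horner_comp !hornerE.
pose s := t - a.
have s0 : 0 < s by rewrite /s /a; move: td; rewrite ltr_norml => /andP[]; lra.
have sd : s < delta by rewrite /s /a; move: td; rewrite ltr_norml => /andP[]; lra.
(* [u k] is the largest node of step [eta / k.+1] not exceeding [s]. *)
pose j (k : nat) := Num.truncn (s / (eta / k.+1%:R)).
pose u (k : nat) := (j k)%:R * (eta / k.+1%:R).
have uk k : s - eta / k.+1%:R <= u k <= s.
  have hk : 0 < eta / k.+1%:R by rewrite divr_gt0.
  rewrite /u /j; move: (eta / k.+1%:R) hk => h hk.
  have := @truncn_itv _ (s / h).
  rewrite divr_ge0 ?(ltW s0) ?(ltW hk) // => /(_ isT) /andP[].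
  move: (Num.truncn _) => n; rewrite ler_pdivlMr // ltr_pdivrMr // -natr1.
  by move=> j1 j2; apply/andP; split; lra.
have u_s : u @ \oo --> s.
  apply: (@cvg_of_bound _ _ (fun k => eta / k.+1%:R)) => [k|].
    have h0 : 0 <= eta / k.+1%:R by rewrite divr_ge0 // ltW.
    have := uk k; move: (eta / _) (u k) h0 => b y b0 /andP[h1 h2].
    by rewrite ler_norml; apply/andP; split; lra.
  rewrite -[X in _ --> X](mulr0 eta); apply: cvgM; first exact: cvg_cst.
  exact: cvg_harmonic.
have e1 : (fun k => p.[u k]) @ \oo --> p.[s].
  by apply: continuous_cvg u_s; exact: continuous_horner.
have e2 : (fun k => g (a + u k)) @ \oo --> g t.
  apply: (cont (fun k => a + u k)); first by apply: lt_trans td _; lra.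
  have -> : t = a + s by rewrite /s; ring.
  by apply: cvgD => //; exact: cvg_cst.
have uE : (fun k => g (a + u k)) = (fun k => p.[u k]).
  apply/funext => k; rewrite -/(G (u k)) /u fine_lattice //.
  by apply: le_lt_trans sd; have /andP[] := uk k.
by move: e2; rewrite uE => e2; exact: (cvg_unique _ e2 e1).
Qed.

End FiniteDifference.

(** * Logarithms near 1 *)

Section Logarithm.
Context {R : realType}.
Implicit Types w : R[i].

Definition clog_re w : R := ln (normc w).
(** The principal argument when [0 < Re w], which is the only case needed near 1. *)
Definition clog_im w : R := atan (Im w / Re w).

Lemma clogK w : 0 < Re w -> cexp (clog_re w +i* clog_im w) = w.
Proof.
move=> w0; have nw : 0 < normc w.
  by apply: lt_le_trans w0 (le_trans (ler_norm _) (normc_Re w)).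
pose x := Im w / Re w; pose c := cos (atan x).
have c0 : 0 < c by apply: cos_gt0_pihalf; rewrite atan_gtNpi2 atan_ltpi2.
have sE : sin (atan x) = x * c.
  by rewrite -{2}(atanK x) /tan divfK // gt_eqF.
have Re_c : normc w * c = Re w.
  apply/eqP; rewrite -(@eqrXn2 _ 2) ?mulr_ge0 ?ltW //; apply/eqP.
  have := cos2Dsin2 (atan x); rewrite sE -/c => h.
  have Rw : Re w != 0 by rewrite gt_eqF.
  have nE : normc w ^+ 2 = Re w ^+ 2 * (1 + x ^+ 2).
    by rewrite sqr_normcE /x; field.
  rewrite exprMn nE.
  have -> : Re w ^+ 2 * (1 + x ^+ 2) * c ^+ 2 = Re w ^+ 2 * (c ^+ 2 + (x * c) ^+ 2) by ring.
  by rewrite h mulr1.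
apply: complex_eqP; rewrite /= /clog_re lnK ?posrE // /clog_im -/x.
by rewrite sE mulrCA Re_c /x divfK // gt_eqF.
Qed.

(** [K] will exceed the number of factors, so that the sum of their arguments stays below [pi]. *)
Lemma clog_small (K : nat) : exists2 e : R, 0 < e &
  forall w, normc (w - 1) < e -> 0 < Re w /\ `|clog_im w| * K%:R < pi.
Proof.
have pi0 := @pi_gt0 R.
have K0 : 0 < pi / K.+1%:R :> R by rewrite divr_gt0.
have /cvgrPdist_lt /(_ _ K0) := @continuous_atan R 0.
rewrite atan0 => /nbhs_ballP [r /= r0 H].
exists (Num.min 2^-1 (r / 2)); first by rewrite lt_min invr_gt0 ltr0n divr_gt0.
move=> w; rewrite lt_min => /andP[h1 h2].
have hR := le_lt_trans (normc_Re (w - 1)) h1.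
have hI := le_lt_trans (normc_Im (w - 1)) h2.
rewrite ReD ReN /= in hR; rewrite ImD ImN /= subr0 in hI.
have Rw : 2^-1 < Re w by move: hR; rewrite ltr_norml => /andP[]; lra.
have Rw0 : 0 < Re w by lra.
split=> //.
have : ball 0 r (Im w / Re w).
  rewrite /ball /= sub0r normrN normrM normfV (gtr0_norm Rw0) ltr_pdivrMr //.
  by apply: lt_trans hI _; nra.
move/H; rewrite sub0r normrN -/(clog_im w) => h.
have : `|clog_im w| * K.+1%:R < pi by rewrite -ltr_pdivlMr.
by apply: le_lt_trans; rewrite ler_wpM2l // ler_nat.
Qed.

(** The two sums of logarithms have the same exponential, so they differ by a multiple of [2 pi i];
    the size condition on the arguments leaves only 0. *)
Lemma clog_prod m n (w : 'I_m -> R[i]) (v : 'I_n -> R[i]) :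
  (forall k, 0 < Re (w k) /\ `|clog_im (w k)| * (m + n).+1%:R < pi) ->
  (forall l, 0 < Re (v l) /\ `|clog_im (v l)| * (m + n).+1%:R < pi) ->
  \prod_k w k = \prod_l v l ->
  \sum_k clog_re (w k) = \sum_l clog_re (v l) /\
  \sum_k clog_im (w k) = \sum_l clog_im (v l).
Proof.
move=> Hw Hv E; have pi0 := @pi_gt0 R.
pose Lw := \sum_k (clog_re (w k) +i* clog_im (w k)).
pose Lv := \sum_l (clog_re (v l) +i* clog_im (v l)).
have : cexp Lw = cexp Lv.
  have -> : cexp Lw = \prod_k w k.
    by rewrite cexp_sum; apply: eq_bigr => k _; apply: clogK; case: (Hw k).
  rewrite E cexp_sum; apply: eq_bigr => l _.
  by apply/esym/clogK; case: (Hv l).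
move=> /(congr1 (fun z => z * cexp (- Lv))); rewrite -!cexpD subrr cexp0 => D1.
have RE : Re Lw = \sum_k clog_re (w k) by rewrite /Lw Re_sum.
have RE' : Re Lv = \sum_l clog_re (v l) by rewrite /Lv Re_sum.
have IE : Im Lw = \sum_k clog_im (w k) by rewrite /Lw Im_sum.
have IE' : Im Lv = \sum_l clog_im (v l) by rewrite /Lv Im_sum.
have re0 : Re (Lw - Lv) = 0.
  have := congr1 (@normc _) D1; rewrite normc_cexp normc1 => h.
  by apply: expR_inj; rewrite h expR0.
have cos1 : cos (Im (Lw - Lv)) = 1.
  by have := congr1 (@complex.Re _) D1; rewrite /= re0 expR0 mul1r.
have Ilt : `|Im (Lw - Lv)| < pi.
  have mn0 : 0 < (m + n).+1%:R :> R by rewrite ltr0n.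
  rewrite -(@ltr_pM2r _ (m + n).+1%:R) // ImD ImN IE IE'.
  apply: le_lt_trans (_ : (\sum_k `|clog_im (w k)| + \sum_l `|clog_im (v l)|) *
      (m + n).+1%:R < _).
    rewrite ler_pM2r //; apply: le_trans (ler_normB _ _) _.
    by apply: lerD; exact: ler_norm_sum.
  rewrite mulrDl !mulr_suml.
  have h1 : \sum_(k < m) `|clog_im (w k)| * (m + n).+1%:R <= \sum_(k < m) pi.
    by apply: ler_sum => k _; apply: ltW; case: (Hw k).
  have h2 : \sum_(l < n) `|clog_im (v l)| * (m + n).+1%:R <= \sum_(l < n) pi.
    by apply: ler_sum => l _; apply: ltW; case: (Hv l).
  apply: le_lt_trans (lerD h1 h2) _.
  by rewrite !sumr_const !card_ord -mulrnDr mulr_natr ltr_pMn2l.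
have im0 : Im (Lw - Lv) = 0.
  have : cos `|Im (Lw - Lv)| = cos 0 by rewrite cos_norm cos1 cos0.
  move=> /cos_inj h; apply/eqP; rewrite -normr_eq0; apply/eqP; apply: h.
    by rewrite in_itv /= normr_ge0 ltW.
  by rewrite in_itv /= lexx pi_ge0.
move: re0 im0; rewrite ReD ReN RE RE' ImD ImN IE IE' => /eqP.
by rewrite subr_eq0 => /eqP -> /eqP; rewrite subr_eq0 => /eqP.
Qed.

Lemma clog_re_cvg (u : nat -> R[i]) w : 0 < Re w ->
  (fun k => Re (u k)) @ \oo --> Re w -> (fun k => Im (u k)) @ \oo --> Im w ->
  (fun k => clog_re (u k)) @ \oo --> clog_re w.
Proof.
move=> w0 hR hI.
have nw : 0 < normc w.
  by apply: lt_le_trans w0 (le_trans (ler_norm _) (normc_Re w)).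
have nE (z : R[i]) : normc z = Num.sqrt (Re z ^+ 2 + Im z ^+ 2) by case: z.
have h : (fun k => normc (u k)) @ \oo --> normc w.
  under eq_fun do rewrite nE; rewrite nE.
  have h : (fun k => Re (u k) ^+ 2 + Im (u k) ^+ 2) @ \oo --> Re w ^+ 2 + Im w ^+ 2.
    by apply: cvgD; rewrite expr2; under eq_fun do rewrite expr2; exact: cvgM.
  apply: (cvg_comp _ _ h); exact: sqrt_continuous.
exact: (cvg_comp _ _ h (continuous_ln nw)).
Qed.

Lemma clog_im_cvg (u : nat -> R[i]) w : 0 < Re w ->
  (fun k => Re (u k)) @ \oo --> Re w -> (fun k => Im (u k)) @ \oo --> Im w ->
  (fun k => clog_im (u k)) @ \oo --> clog_im w.
Proof.
move=> w0 hR hI; have h : (fun k => Im (u k) / Re (u k)) @ \oo --> Im w / Re w.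
  by apply: cvgM => //; apply: cvgV => //; rewrite gt_eqF.
exact: (cvg_comp _ _ h (@continuous_atan _ _)).
Qed.

End Logarithm.

(** * Independence and expectations of products *)

Section IndependenceExpectation.
Context {d : measure_display} {T : measurableType d} {R : realType}.
Variable P : probability T R.

(** The sum counts the positive integers up to [y]; it serves to approximate a bounded function by
    its level sets. *)
Lemma layer_bound n (y : R) : 0 <= y -> y <= n%:R ->
  y - 1 <= \sum_(k < n) (k.+1%:R <= y)%R%:R <= y.
Proof.
elim: n => [|n IH] y0 yn.
  by rewrite big_ord0; apply/andP; split; lra.
rewrite big_ord_recr /=; have [yn'|ny] := leP y n%:R.
  have -> : (n.+1%:R <= y) = false.
    by apply/negbTE; rewrite -ltNge (le_lt_trans yn') // ltr_nat.
  by rewrite addr0; exact: IH.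
have -> : \sum_(i < n) (i.+1%:R <= y)%R%:R = n%:R :> R.
  rewrite (eq_bigr (fun=> 1)) ?sumr_const ?card_ord // => i _.
  by rewrite (le_trans _ (ltW ny)) // ler_nat.
by case: (leP n.+1%:R y) => h /=; move: yn h; rewrite -natr1 => yn h; apply/andP; split; lra.
Qed.

(** [g] is uniformly within [1 / (n + 1)] of the average of the indicators of its level sets
    [B n k], for which the factorisation is assumed. *)
Lemma mean_factor_unit dd (U : measurableType dd) (S : T -> U) (W : T -> R) (C c : R)
    (g : U -> R) :
  measurable_fun setT S -> measurable_fun setT W -> (forall w, `|W w| <= C) ->
  (forall B : set U, measurable B ->
     mean P (fun w => (S w \in B)%:R * W w) = mean P (fun w => (S w \in B)%:R) * c) ->
  measurable_fun setT g -> (forall x, 0 <= g x <= 1) ->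
  mean P (fun w => g (S w) * W w) = mean P (fun w => g (S w)) * c.
Proof.
move=> mS mW WC H mg g01.
pose B n k : set U := [set x | k.+1%:R / n.+1%:R <= g x].
have mB n k : measurable (B n k).
  rewrite (_ : B n k = g @^-1` `[k.+1%:R / n.+1%:R, +oo[%classic); last first.
    by apply/seteqP; split=> x /=; rewrite /B /= in_itv /= andbT.
  by rewrite -[X in measurable X]setTI; apply: mg.
pose gn n (x : U) : R := n.+1%:R^-1 * \sum_(k < n.+1) (x \in B n k)%:R.
have mind (A : set U) : measurable A -> measurable_fun setT (fun x : U => (x \in A)%:R : R).
  by move=> mA; exact: (measurable_indic mA).
have mindS (A : set U) : measurable A -> measurable_fun setT (fun w => (S w \in A)%:R : R).
  by move=> mA; exact: measurableT_comp (mind A mA) mS.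
have iind (A : set U) : measurable A -> integ P (fun w => (S w \in A)%:R).
  move=> mA; apply: (@integ_bounded _ _ _ _ _ 1); first exact: mindS.
  by move=> w; case: (_ \in _); rewrite ?normr1 ?normr0.
have iindW (A : set U) : measurable A -> integ P (fun w => (S w \in A)%:R * W w).
  move=> mA; apply: (@integ_bounded _ _ _ _ _ C).
    by apply: measurable_funM => //; exact: mindS.
  move=> w; case: (_ \in _); rewrite ?mul1r // mul0r normr0.
  exact: le_trans (normr_ge0 _) (WC w).
have gn_close n x : `|gn n x - g x| <= n.+1%:R^-1.
  have n0 : 0 < n.+1%:R :> R by [].
  have /andP[g0 g1] := g01 x.
  have ng : n.+1%:R * g x <= n.+1%:R by rewrite ler_piMr.
  have ng0 : 0 <= n.+1%:R * g x by rewrite mulr_ge0.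
  have := layer_bound ng0 ng.
  have -> : \sum_(k < n.+1) (k.+1%:R <= n.+1%:R * g x)%R%:R =
      \sum_(k < n.+1) (x \in B n k)%:R :> R.
    apply: eq_bigr => k _; congr (nat_of_bool _)%:R; apply/idP/idP.
      by rewrite inE /B /= ler_pdivrMr // mulrC.
    by rewrite inE /B /= ler_pdivrMr // mulrC.
  move=> h; rewrite /gn -(@ler_pM2l _ n.+1%:R) // mulfV ?pnatr_eq0 //.
  rewrite -(ger0_norm (ltW n0)) -normrM mulrBr mulrA (ger0_norm (ltW n0)).
  rewrite mulfV ?pnatr_eq0 // mul1r ler_norml.
  by move: h => /andP[h1 h2]; apply/andP; split; lra.
have gn_fact n : mean P (fun w => gn n (S w) * W w) = mean P (fun w => gn n (S w)) * c.
  have -> : (fun w => gn n (S w) * W w) =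
      (fun w => n.+1%:R^-1 * \sum_(k < n.+1) ((S w \in B n k)%:R * W w)).
    by apply/funext => w; rewrite /gn -mulrA mulr_suml.
  rewrite meanZ; last by apply: integ_sum => k _; exact: iindW.
  rewrite mean_sum; last by move=> k _; exact: iindW.
  rewrite /gn meanZ; last by apply: integ_sum => k _; exact: iind.
  rewrite mean_sum; last by move=> k _; exact: iind.
  rewrite -mulrA mulr_suml; congr (_ * _); apply: eq_bigr => k _; exact: H.
have gS x : `|g x| <= 1 by rewrite ger0_norm; case/andP: (g01 x).
have ig : integ P (fun w => g (S w)).
  by apply: (@integ_bounded _ _ _ _ _ 1) => //; exact: measurableT_comp mg mS.
have igW : integ P (fun w => g (S w) * W w).
  apply: (@integ_bounded _ _ _ _ _ (1 * C)).
    by apply: measurable_funM => //; exact: measurableT_comp mg mS.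
  by move=> w; rewrite normrM ler_pM.
have ign n : integ P (fun w => gn n (S w)).
  by apply: integZ; apply: integ_sum => k _; exact: iind.
have ignW n : integ P (fun w => gn n (S w) * W w).
  have -> : (fun w => gn n (S w) * W w) =
      (fun w => n.+1%:R^-1 * \sum_(k < n.+1) ((S w \in B n k)%:R * W w)).
    by apply/funext => w; rewrite /gn -mulrA mulr_suml.
  by apply: integZ; apply: integ_sum => k _; exact: iindW.
have c1 : (fun n => mean P (fun w => gn n (S w))) @ \oo --> mean P (fun w => g (S w)).
  apply: (@cvg_of_bound _ _ (fun n => n.+1%:R^-1)); last exact: cvg_harmonic.
  move=> n; rewrite -meanB // -[n.+1%:R^-1](mean_cst P).
  apply: le_mean_norm => //; [exact: integB|exact: integ_cst].
have c2 : (fun n => mean P (fun w => gn n (S w) * W w)) @ \oo -->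
    mean P (fun w => g (S w) * W w).
  apply: (@cvg_of_bound _ _ (fun n => C * n.+1%:R^-1)); last first.
    by rewrite -[X in _ --> X](mulr0 C); apply: cvgM; [exact: cvg_cst|exact: cvg_harmonic].
  move=> n; rewrite -meanB // -[C * _](mean_cst P).
  apply: le_mean_norm; [exact: integB|exact: integ_cst|].
  move=> w; rewrite -mulrBl normrM mulrC ler_pM //.
have c3 : (fun n => mean P (fun w => gn n (S w) * W w)) @ \oo -->
    mean P (fun w => g (S w)) * c.
  under eq_fun do rewrite gn_fact.
  by apply: cvgM => //; exact: cvg_cst.
exact: (cvg_unique _ c2 c3).
Qed.

Lemma mean_factor dd (U : measurableType dd) (S : T -> U) (W : T -> R) (C c : R)
    (g : U -> R) :
  measurable_fun setT S -> measurable_fun setT W -> (forall w, `|W w| <= C) ->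
  (forall B : set U, measurable B ->
     mean P (fun w => (S w \in B)%:R * W w) = mean P (fun w => (S w \in B)%:R) * c) ->
  measurable_fun setT g -> (forall x, `|g x| <= 1) ->
  mean P (fun w => g (S w) * W w) = mean P (fun w => g (S w)) * c.
Proof.
move=> mS mW WC H mg g1.
pose h x := (g x + 1) / 2.
have mh : measurable_fun setT h by apply: measurable_funM => //; exact: measurable_funD.
have h01 x : 0 <= h x <= 1.
  by have := g1 x; rewrite ler_norml /h => /andP[a b]; apply/andP; split; lra.
have E := mean_factor_unit mS mW WC H mh h01.
have E1 : mean P W = c.
  have := H setT measurableT.
  have -> : (fun w => (S w \in [set: U])%:R * W w) = W.
    by apply/funext => w; rewrite in_setT mul1r.
  have -> : (fun w => (S w \in [set: U])%:R) = (fun=> 1 : R).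
    by apply/funext => w; rewrite in_setT.
  by rewrite mean_cst mul1r.
have ih : integ P (fun w => h (S w)).
  apply: (@integ_bounded _ _ _ _ _ 1); first exact: measurableT_comp mh mS.
  by move=> w; rewrite ger0_norm; case/andP: (h01 (S w)).
have iW : integ P W by exact: integ_bounded mW WC.
have ihW : integ P (fun w => h (S w) * W w).
  apply: (@integ_bounded _ _ _ _ _ (1 * C)).
    by apply: measurable_funM => //; exact: measurableT_comp mh mS.
  by move=> w; rewrite normrM ler_pM // ger0_norm; case/andP: (h01 (S w)).
have -> : (fun w => g (S w) * W w) = (fun w => 2 * (h (S w) * W w) - W w).
  by apply/funext => w; rewrite /h; field.
have -> : (fun w => g (S w)) = (fun w => 2 * h (S w) - 1).
  by apply/funext => w; rewrite /h; field.
rewrite meanB //; last exact: integZ.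
rewrite meanB; [|exact: integZ|exact: integ_cst].
by rewrite !meanZ // mean_cst E E1; ring.
Qed.

Definition unit_meas dd (U : measurableType dd) (G : U -> R[i]) :=
  [/\ measurable_fun setT (Re \o G), measurable_fun setT (Im \o G) &
      forall x, normc (G x) <= 1].

Lemma unit_measM dd (U : measurableType dd) (F G : U -> R[i]) :
  unit_meas F -> unit_meas G -> unit_meas (fun x => F x * G x).
Proof.
move=> [F1 F2 Fb] [G1 G2 Gb]; split.
- have -> : Re \o (fun x => F x * G x) =
      (fun x => (Re \o F) x * (Re \o G) x - (Im \o F) x * (Im \o G) x).
    by apply/funext => x; rewrite /= ReM.
  by apply: measurable_funB; exact: measurable_funM.
- have -> : Im \o (fun x => F x * G x) =
      (fun x => (Re \o F) x * (Im \o G) x + (Im \o F) x * (Re \o G) x).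
    by apply/funext => x; rewrite /= ImM.
  by apply: measurable_funD; exact: measurable_funM.
- by move=> x; rewrite normcM mulr_ile1 ?normc_ge0.
Qed.

Lemma unit_meas1 dd (U : measurableType dd) : unit_meas (fun _ : U => 1 : R[i]).
Proof. by split=> [| |x]; rewrite ?normc1 //; exact: measurable_cst. Qed.

Lemma unit_meas_prod dd (U : measurableType dd) (I : Type) (r : seq I) (Q : pred I)
    (F : I -> U -> R[i]) : (forall k, unit_meas (F k)) ->
  unit_meas (fun x => \prod_(k <- r | Q k) F k x).
Proof.
move=> H; elim: r => [|k r IH].
  by under eq_fun do rewrite big_nil; exact: unit_meas1.
under eq_fun do rewrite big_cons.
by case: (Q k) => //; exact: unit_measM.
Qed.

Lemma cmean_factor dd (U : measurableType dd) (S : T -> U) (W : T -> R[i]) (c : R[i])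
    (G : U -> R[i]) :
  measurable_fun setT S -> unit_meas W ->
  (forall B : set U, measurable B ->
     cmean P (fun w => (S w \in B)%:R * W w) = cmean P (fun w => (S w \in B)%:R) * c) ->
  unit_meas G ->
  cmean P (fun w => G (S w) * W w) = cmean P (fun w => G (S w)) * c.
Proof.
move=> mS uW H uG; have [W1 W2 Wb] := uW; have [G1 G2 Gb] := uG.
have bR (z : R[i]) : normc z <= 1 -> `|Re z| <= 1 by exact/le_trans/normc_Re.
have bI (z : R[i]) : normc z <= 1 -> `|Im z| <= 1 by exact/le_trans/normc_Im.
have natC (b : bool) : (b%:R : R[i]) = (b%:R)%:C by rewrite rmorph_nat.
have HB (B : set U) : measurable B ->
    mean P (fun w => (S w \in B)%:R * Re (W w)) = mean P (fun w => (S w \in B)%:R) * Re c /\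
    mean P (fun w => (S w \in B)%:R * Im (W w)) = mean P (fun w => (S w \in B)%:R) * Im c.
  move=> mB; have := H B mB.
  have -> : (fun w => (S w \in B)%:R) = (fun w => ((S w \in B)%:R)%:C : R[i]).
    by apply/funext => w; exact: natC.
  rewrite cmean_complex => E; split.
    have := congr1 (@complex.Re _) E; rewrite ReMr /= => <-.
    by congr mean; apply/funext => w /=; rewrite natC ReMr.
  have := congr1 (@complex.Im _) E; rewrite ImMr /= => <-.
  by congr mean; apply/funext => w /=; rewrite natC ImMr.
have F1 (g : U -> R) : measurable_fun setT g -> (forall x, `|g x| <= 1) ->
    mean P (fun w => g (S w) * Re (W w)) = mean P (fun w => g (S w)) * Re c.
  apply: (mean_factor mS W1 (C := 1)) => [w|B mB]; first exact: bR (Wb w).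
  exact: (HB B mB).1.
have F2 (g : U -> R) : measurable_fun setT g -> (forall x, `|g x| <= 1) ->
    mean P (fun w => g (S w) * Im (W w)) = mean P (fun w => g (S w)) * Im c.
  apply: (mean_factor mS W2 (C := 1)) => [w|B mB]; first exact: bI (Wb w).
  exact: (HB B mB).2.
have E1 := F1 _ G1 (fun x => bR _ (Gb x)); have E2 := F2 _ G2 (fun x => bI _ (Gb x)).
have E3 := F2 _ G1 (fun x => bR _ (Gb x)); have E4 := F1 _ G2 (fun x => bI _ (Gb x)).
have iG1 : integ P (fun w => Re (G (S w)) * Re (W w)).
  apply: (@integ_bounded _ _ _ _ _ 1); first by apply: measurable_funM => //; exact: measurableT_comp G1 mS.
  by move=> w; rewrite normrM mulr_ile1 ?bR.
have iG2 : integ P (fun w => Im (G (S w)) * Im (W w)).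
  apply: (@integ_bounded _ _ _ _ _ 1); first by apply: measurable_funM => //; exact: measurableT_comp G2 mS.
  by move=> w; rewrite normrM mulr_ile1 ?bI.
have iG3 : integ P (fun w => Re (G (S w)) * Im (W w)).
  apply: (@integ_bounded _ _ _ _ _ 1); first by apply: measurable_funM => //; exact: measurableT_comp G1 mS.
  by move=> w; rewrite normrM mulr_ile1 ?bR ?bI.
have iG4 : integ P (fun w => Im (G (S w)) * Re (W w)).
  apply: (@integ_bounded _ _ _ _ _ 1); first by apply: measurable_funM => //; exact: measurableT_comp G2 mS.
  by move=> w; rewrite normrM mulr_ile1 ?bR ?bI.
apply: complex_eqP.
  rewrite ReM /= -[X in _ = X - _]E1 -[X in _ = _ - X]E2 -meanB //.
  by congr mean; apply/funext => w; rewrite /= ReM.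
rewrite ImM /= -[X in _ = X + _]E3 -[X in _ = _ + X]E4 -meanD //.
by congr mean; apply/funext => w; rewrite /= ImM.
Qed.

Lemma meas_complex_pair (y : T -> R[i]) : complex_rv y ->
  measurable_fun setT (complex_pair \o y).
Proof. by case=> m1 m2; apply/measurable_fun_pairP. Qed.

(** Independence treats products of indicators; they are then replaced by general functions one
    index at a time, each replacement being an instance of [cmean_factor]. *)
Lemma indep_prod m (s : 'I_m -> T -> R[i]) (G : 'I_m -> R * R -> R[i]) :
  (forall i, complex_rv (s i)) -> independent_crv P s -> (forall i, unit_meas (G i)) ->
  cmean P (fun w => \prod_i G i (complex_pair (s i w))) =
  \prod_i cmean P (fun w => G i (complex_pair (s i w))).
Proof.
move=> ms ind uG.
have mS i := meas_complex_pair (ms i).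
(* The functions at indices below [k] are arbitrary, the others are indicators. *)
suff H k (F : 'I_m -> R * R -> R[i]) : (forall i, unit_meas (F i)) ->
    (forall i : 'I_m, (k <= i)%N ->
       exists2 B, measurable B & F i = fun x => (x \in B)%:R) ->
    cmean P (fun w => \prod_i F i (complex_pair (s i w))) =
    \prod_i cmean P (fun w => F i (complex_pair (s i w))).
  by apply: (H m G uG) => i; rewrite leqNgt ltn_ord.
elim: k F => [|k IH] F uF HF.
  pose B i := projT1 (cid2 (HF i (leq0n i))).
  have mB i : measurable (B i) by rewrite /B; case: cid2.
  have FE i : F i = fun x => (x \in B i)%:R by rewrite /B; case: cid2.
  pose A i : set T := (complex_pair \o s i) @^-1` B i.
  have mA i : measurable (A i) by rewrite -[X in measurable X]setTI; exact: mS.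
  have E (D : set T) : cmean P (fun w => (w \in D)%:R) = (mean P \1_D)%:C.
    rewrite -cmean_complex; congr cmean; apply/funext => w.
    by rewrite indicE rmorph_nat.
  have -> : (fun w => \prod_i F i (complex_pair (s i w))) =
      (fun w => (w \in \bigcap_(i in [set i | i \in [set: 'I_m]%SET]) A i)%:R).
    apply/funext => w; have [wA|wA] := boolP (w \in _).
      rewrite big1 // => i _; rewrite FE; move: wA; rewrite inE => /(_ i).
      rewrite /= finset.in_setT => /(_ isT) Aw.
      by rewrite (_ : _ \in B i) //; exact/mem_set.
    have [i wi] : exists i, w \notin A i.
      apply/existsP; apply: contraNT wA; rewrite negb_exists => /forallP wA.
      by rewrite inE => i _; apply/set_mem; have := wA i; rewrite negbK.
    rewrite (bigD1 i) //= FE -[_ \in B i]/(w \in A i) (negbTE wi) mul0r //.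
  have -> : \prod_i cmean P (fun w => F i (complex_pair (s i w))) =
      (\prod_i mean P \1_(A i))%:C.
    rewrite rmorph_prod; apply: eq_bigr => i _.
    transitivity (cmean P (fun w => (w \in A i)%:R)); last exact: E.
    by rewrite FE.
  rewrite E; congr (_%:C); apply: EFin_inj.
  rewrite mean_indic; last first.
    by apply: fin_bigcap_measurable => //; exact: finite_finset.
  rewrite (ind [set: 'I_m]%SET B mB).
  rewrite -prodEFin; apply: eq_big => i; first by rewrite finset.in_setT.
  by move=> _; rewrite mean_indic.
have [km|mk] := ltnP k m; last first.
  apply: IH => // i ki; exfalso; have := leq_trans (leq_trans (ltn_ord i) mk) ki.
  by rewrite ltnn.
pose i0 := Ordinal km.
pose W w := \prod_(j | j != i0) F j (complex_pair (s j w)).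
pose c := \prod_(j | j != i0) cmean P (fun w => F j (complex_pair (s j w))).
have uFS j : unit_meas (fun w => F j (complex_pair (s j w))).
  have [F1 F2 Fb] := uF j; split=> //.
    exact: measurableT_comp F1 (mS j).
  exact: measurableT_comp F2 (mS j).
have -> : (fun w => \prod_i F i (complex_pair (s i w))) =
    (fun w => F i0 ((complex_pair \o s i0) w) * W w).
  by apply/funext => w; rewrite (bigD1 i0).
rewrite [RHS](bigD1 i0) //=.
apply: (cmean_factor (mS i0) _ _ (uF i0)); first exact: unit_meas_prod.
move=> B mB; pose F' j := if j == i0 then (fun x => (x \in B)%:R : R[i]) else F j.
have uI (D : set (R * R)) : measurable D -> unit_meas (fun x => (x \in D)%:R : R[i]).
  move=> mD; split=> [||x]; last by case: (_ \in _); rewrite ?normc1 ?normc0.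
    have -> : Re \o (fun x => (x \in D)%:R : R[i]) = \1_D.
      by apply/funext => x /=; rewrite indicE; case: (_ \in _).
    exact: measurable_indic.
  have -> : Im \o (fun x => (x \in D)%:R : R[i]) = (fun=> 0).
    by apply/funext => x /=; case: (_ \in _).
  exact: measurable_cst.
have := IH F'; have uF' j : unit_meas (F' j) by rewrite /F'; case: eqP => // _; exact: uI.
move=> /(_ uF'); rewrite (bigD1 i0) //=.
have -> : (fun w => \prod_i F' i (complex_pair (s i w))) =
    (fun w => ((complex_pair \o s i0) w \in B)%:R * W w).
  apply/funext => w; rewrite (bigD1 i0) //= {1}/F' eqxx; congr (_ * _).
  by apply: eq_bigr => j /negbTE ji; rewrite /F' ji.
have -> : \prod_(i | i != i0) cmean P (fun w => F' i (complex_pair (s i w))) = c.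
  by apply: eq_bigr => j /negbTE ji; rewrite /F' ji.
have -> : F' i0 = (fun x => (x \in B)%:R) by rewrite /F' eqxx.
apply => i ki; rewrite /F'; case: eqP => [_|/eqP ii0].
  by exists B.
apply: HF; rewrite ltn_neqAle ki andbT; apply: contra ii0 => /eqP h.
by apply/eqP/val_inj.
Qed.

End IndependenceExpectation.

(** * Characteristic functions of complex variables and the log identity *)

Section CharacteristicFunctionLog.
Context {d : measure_display} {T : measurableType d} {R : realType}.
Variable P : probability T R.
Implicit Types (y : T -> R[i]) (z e : R[i]).

(** Pairing by [Re (z * y)], without conjugation, makes the argument at source [k] simply the entry
    [(u *m A) ord0 k]. *)
Definition cf y z : R[i] := cmean P (fun w => cexp (0 +i* Re (z * y w))).

Lemma meas_Re_mul y e : complex_rv y -> measurable_fun setT (fun w => Re (e * y w)).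
Proof.
move=> [m1 m2].
have -> : (fun w => Re (e * y w)) =
    (fun w => Re e * (@complex.Re R \o y) w - Im e * (@complex.Im R \o y) w).
  by apply/funext => w; rewrite ReM.
by apply: measurable_funB; apply: measurable_funM.
Qed.

Lemma cf_laplace y e (t : R) :
  laplace P (fun w => Re (e * y w)) (t%:C * 'i%C) = cf y (t%:C * e).
Proof.
rewrite /laplace /cf; congr cmean; apply/funext => w; congr cexp.
apply: complex_eqP; rewrite (ReM, ImM) /= ?ReMr ?ImMr /=.
  by ring.
by rewrite -mulrA ReMr ReM; ring.
Qed.

Lemma meas_Re_cexp_im (f : T -> R) : measurable_fun setT f ->
  measurable_fun setT (Re \o (fun w => cexp (0 +i* f w))).
Proof.
move=> mf; have -> : Re \o (fun w => cexp (0 +i* f w)) = (fun w => cos (1 * f w)).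
  by apply/funext => w; rewrite /= expR0 mul1r mul1r.
exact: meas_cos.
Qed.

Lemma meas_Im_cexp_im (f : T -> R) : measurable_fun setT f ->
  measurable_fun setT (Im \o (fun w => cexp (0 +i* f w))).
Proof.
move=> mf; have -> : Im \o (fun w => cexp (0 +i* f w)) = (fun w => sin (1 * f w)).
  by apply/funext => w; rewrite /= expR0 mul1r mul1r.
exact: meas_sin.
Qed.

Lemma cinteg_cexp_im (f : T -> R) : measurable_fun setT f ->
  cinteg P (fun w => cexp (0 +i* f w)).
Proof.
move=> mf; apply: (cinteg_le _ _ (integ_cst P 1)).
- exact: meas_Re_cexp_im.
- exact: meas_Im_cexp_im.
- by move=> w; rewrite normc_cexp /= expR0.
Qed.

Lemma cf0 y : cf y 0 = 1.
Proof.
rewrite /cf -[RHS](cmean_cst P); congr cmean; apply/funext => w.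
by rewrite mul0r -[RHS]cexp0.
Qed.

Lemma cexp_im_bound (x : R) : normc (cexp (0 +i* x) - 1) <= 2 * `|x|.
Proof.
have := cexp_taylor 1 (0 +i* x); rewrite expp_horner big_ord1 expr0 fact0 invr1 mulr1.
rewrite expr1 /= normr0 expR0 mulr1 expr0n /= add0r sqrtr_sqr => h.
by apply: le_trans h _; rewrite ler_wpM2l // factS fact0 invr1 mulr1.
Qed.

Lemma cf_near1 y (eps : R) : complex_rv y -> 0 < eps ->
  exists2 rho : R, 0 < rho & forall z, normc z < rho -> normc (cf y z - 1) < eps.
Proof.
move=> my e0; have [m1 m2] := my.
pose N w : R := `|Re (y w)| + `|Im (y w)|.
have mN : measurable_fun setT N.
  by apply: measurable_funD; exact: measurableT_comp.
(* [g n] dominates [normc (cexp (i Re (z y)) - 1)] for all [normc z < 1 / (n + 1)] at once, so one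
   sequence gives continuity at 0. *)
pose g (n : nat) w : R := Num.min 2 (2 * (n.+1%:R^-1 * N w)).
have N0 w : 0 <= N w by exact: addr_ge0.
have mg n : measurable_fun setT (g n).
  apply: measurable_minr; first exact: measurable_cst.
  by apply: measurable_funM => //; apply: measurable_funM.
have g0 n w : 0 <= g n w by rewrite le_min ler0n /= !mulr_ge0 // invr_ge0.
have g2 n w : `|g n w| <= 2 by rewrite ger0_norm // ge_min lexx.
have [] := @mean_dct _ _ _ P g (fun=> 0) _ mg (integ_cst P 2) g2.
  move=> w; apply: (@cvg_of_bound _ _ (fun n => (2 * N w) * n.+1%:R^-1)).
    move=> n; rewrite subr0 ger0_norm // /g ge_min; apply/orP; right.
    by rewrite -mulrA ler_wpM2l // mulrC.
  rewrite -[X in _ --> X](mulr0 (2 * N w)).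
  by apply: cvgM; [exact: cvg_cst|exact: cvg_harmonic].
move=> _; rewrite mean_cst => /cvgrPdist_lt /(_ (eps / 2)).
have e2 : 0 < eps / 2 by lra.
move=> /(_ e2) [n _ /(_ n (leqnn n)) hn'].
have hn : `|mean P (g n)| < eps / 2 by rewrite -normrN -sub0r.
exists n.+1%:R^-1; first by rewrite invr_gt0.
move=> z zn; have mz := meas_Re_mul z my.
have -> : cf y z - 1 = cmean P (fun w => cexp (0 +i* Re (z * y w)) - 1).
  by rewrite cmeanB ?cmean_cst //; [exact: cinteg_cexp_im|exact: cinteg_cst].
apply: le_lt_trans (_ : 2 * mean P (g n) < _); last first.
  by have := ler_norm (mean P (g n)); lra.
apply: normc_cmean.
- by apply: cintegB; [exact: cinteg_cexp_im|exact: cinteg_cst].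
- exact: integ_bounded (mg n) (g2 n).
- move=> w; rewrite le_min; apply/andP; split.
    apply: le_trans (normcD _ _) _.
    by rewrite normc_opp normc1 normc_cexp /= expR0 -natr1.
  apply: le_trans (cexp_im_bound _) _; rewrite ler_wpM2l //.
  apply: le_trans (normc_Re _) _; rewrite normcM; apply: ler_pM; rewrite ?normc_ge0 ?(ltW zn) //.
  exact: normc_leD.
Qed.

Lemma cf_cvg y e (u : nat -> R) (t : R) : complex_rv y -> u @ \oo --> t ->
  (fun k => Re (cf y ((u k)%:C * e))) @ \oo --> Re (cf y (t%:C * e)) /\
  (fun k => Im (cf y ((u k)%:C * e))) @ \oo --> Im (cf y (t%:C * e)).
Proof.
move=> my ut.
have mY := meas_Re_mul e my.
have ER s : Re (cf y (s%:C * e)) = mean P (fun w => cos (s * Re (e * y w))).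
  by rewrite -cf_laplace laplace_im.
have EI s : Im (cf y (s%:C * e)) = mean P (fun w => sin (s * Re (e * y w))).
  by rewrite -cf_laplace laplace_im_sin.
have uw w : (fun k => u k * Re (e * y w)) @ \oo --> t * Re (e * y w).
  by apply: cvgM => //; exact: cvg_cst.
split.
  rewrite ER; under eq_fun do rewrite ER.
  apply: (mean_dct (g := fun=> 1) (fun k => meas_cos mY (u k)) (integ_cst P 1) _ _).2.
    by move=> k w; exact: cos_max.
  by move=> w; apply: (cvg_comp _ _ (uw w)); exact: continuous_cos.
rewrite EI; under eq_fun do rewrite EI.
apply: (mean_dct (g := fun=> 1) (fun k => meas_sin mY (u k)) (integ_cst P 1) _ _).2.
  by move=> k w; exact: sin_max.
by move=> w; apply: (cvg_comp _ _ (uw w)); exact: continuous_sin.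
Qed.

Lemma cf_factor p (x : T -> 'cV[R[i]]_p) m (A : 'M[R[i]]_(p, m)) (s : T -> 'cV[R[i]]_m)
    (u : 'rV[R[i]]_p) :
  complex_rvec x -> complex_rvec s -> independent_crv P (coordinate s) ->
  {ae P, forall w, x w = A *m s w} ->
  cmean P (fun w => cexp (0 +i* Re ((u *m x w) ord0 ord0))) =
  \prod_k cf (coordinate s k) ((u *m A) ord0 k).
Proof.
move=> mx ms ind xE.
pose G k (q : R * R) := cexp (0 +i* Re ((u *m A) ord0 k * (q.1 +i* q.2))).
have mG k : measurable_fun setT (fun q : R * R => Re ((u *m A) ord0 k * (q.1 +i* q.2))).
  have -> : (fun q : R * R => Re ((u *m A) ord0 k * (q.1 +i* q.2))) =
     (fun q => Re ((u *m A) ord0 k) * q.1 - Im ((u *m A) ord0 k) * q.2).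
    by apply/funext => q; rewrite ReM.
  by apply: measurable_funB; apply: measurable_funM.
have := @indep_prod _ _ _ P m (coordinate s) G ms ind.
have uG k : unit_meas (G k).
  split=> [||q]; last by rewrite normc_cexp /= expR0.
    have -> : Re \o G k = cos \o (fun q : R * R => Re ((u *m A) ord0 k * (q.1 +i* q.2))).
      by apply/funext => q; rewrite /G /= expR0 mul1r.
    apply: measurableT_comp (mG k).
    by apply: continuous_measurable_fun; exact: continuous_cos.
  have -> : Im \o G k = sin \o (fun q : R * R => Re ((u *m A) ord0 k * (q.1 +i* q.2))).
    by apply/funext => q; rewrite /G /= expR0 mul1r.
  apply: measurableT_comp (mG k).
  by apply: continuous_measurable_fun; exact: continuous_sin.
move=> /(_ uG).
have pairK (z : R[i]) : (complex_pair z).1 +i* (complex_pair z).2 = z by case: z.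
have -> : \prod_k cmean P (fun w => G k (complex_pair (coordinate s k w))) =
    \prod_k cf (coordinate s k) ((u *m A) ord0 k).
  apply: eq_bigr => k _; congr cmean; apply/funext => w; rewrite /G pairK //.
move=> <-.
have mxu : measurable_fun setT (fun w => Re ((u *m x w) ord0 ord0)).
  have -> : (fun w => Re ((u *m x w) ord0 ord0)) =
      (fun w => \sum_j Re (u ord0 j * x w j ord0)).
    by apply/funext => w; rewrite mxE Re_sum.
  by apply: measurable_sum => j; exact: meas_Re_mul (mx j).
have E w : \prod_i G i (complex_pair (coordinate s i w)) =
    cexp (0 +i* Re ((u *m (A *m s w)) ord0 ord0)).
  rewrite -cexp_sum; congr cexp; apply: complex_eqP.
    by rewrite Re_sum big1.
  rewrite Im_sum /= mulmxA mxE Re_sum; apply: eq_bigr => k _.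
  by rewrite /= pairK.
rewrite (_ : (fun w => \prod_i G i _) = (fun w => cexp (0 +i* Re ((u *m (A *m s w)) ord0 ord0)))); last by apply/funext.
have msu : measurable_fun setT (fun w => Re ((u *m (A *m s w)) ord0 ord0)).
  have -> : (fun w => Re ((u *m (A *m s w)) ord0 ord0)) =
      (fun w => \sum_j Re ((u *m A) ord0 j * s w j ord0)).
    by apply/funext => w; rewrite mulmxA mxE Re_sum.
  by apply: measurable_sum => j; exact: meas_Re_mul (ms j).
apply: cmean_ae.
- exact: meas_Re_cexp_im.
- exact: meas_Im_cexp_im.
- exact: meas_Re_cexp_im.
- exact: meas_Im_cexp_im.
- by apply: filterS xE => w ->.
Qed.

Lemma uniform_radius n (Q : 'I_n -> R[i] -> Prop) :
  (forall k, exists2 rho : R, 0 < rho & forall z, normc z < rho -> Q k z) ->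
  exists2 rho : R, 0 < rho & forall k z, normc z < rho -> Q k z.
Proof.
move=> H; pose rho k := projT1 (cid2 (H k)).
have r0 k : 0 < rho k by rewrite /rho; case: cid2.
have rQ k z : normc z < rho k -> Q k z by rewrite /rho; case: cid2 => ? ? h; exact: h.
exists (\big[Num.min/1]_k rho k).
  by elim/big_ind: _ => // a b a0 b0; rewrite lt_min a0.
move=> k z h; apply: rQ; apply: lt_le_trans h _.
by rewrite (bigD1 k) //= ge_min lexx.
Qed.

Definition vnorm p (u : 'rV[R[i]]_p) : R := \sum_j normc (u ord0 j).

Lemma vnorm_mul p m (u : 'rV[R[i]]_p) (A : 'M[R[i]]_(p, m)) k :
  normc ((u *m A) ord0 k) <= vnorm u * \sum_j \sum_l normc (A j l).
Proof.
rewrite mxE; apply: le_trans (normc_sum _ _ _) _.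
rewrite mulr_suml; apply: ler_sum => j _; rewrite normcM ler_wpM2l ?normc_ge0 //.
rewrite (bigD1 j) //= (bigD1 k) //= -addrA lerDl addr_ge0 //.
  by apply: sumr_ge0 => l _; exact: normc_ge0.
by apply: sumr_ge0 => l _; apply: sumr_ge0 => l' _; exact: normc_ge0.
Qed.

Lemma vnormD p (u v : 'rV[R[i]]_p) : vnorm (u + v) <= vnorm u + vnorm v.
Proof.
by rewrite /vnorm -big_split; apply: ler_sum => j _; rewrite mxE; exact: normcD.
Qed.

Lemma vnormZ p (t : R) (u : 'rV[R[i]]_p) : vnorm (t%:C *: u) = `|t| * vnorm u.
Proof.
by rewrite /vnorm mulr_sumr; apply: eq_bigr => j _; rewrite mxE normcM normc_real.
Qed.

Lemma vnorm_ge0 p (u : 'rV[R[i]]_p) : 0 <= vnorm u.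
Proof. by apply: sumr_ge0 => j _; exact: normc_ge0. Qed.

Lemma log_functional_eq p (x : T -> 'cV[R[i]]_p) m n
    (A : 'M[R[i]]_(p, m)) (s : T -> 'cV[R[i]]_m)
    (B : 'M[R[i]]_(p, n)) (r : T -> 'cV[R[i]]_n) :
  complex_rvec x -> representation P x A s -> representation P x B r ->
  exists2 rho : R, 0 < rho & forall u : 'rV[R[i]]_p, vnorm u < rho ->
    [/\ forall k, 0 < Re (cf (coordinate s k) ((u *m A) ord0 k)),
        forall l, 0 < Re (cf (coordinate r l) ((u *m B) ord0 l)),
        \sum_k clog_re (cf (coordinate s k) ((u *m A) ord0 k)) =
        \sum_l clog_re (cf (coordinate r l) ((u *m B) ord0 l)) &
        \sum_k clog_im (cf (coordinate s k) ((u *m A) ord0 k)) =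
        \sum_l clog_im (cf (coordinate r l) ((u *m B) ord0 l))].
Proof.
move=> mx [ms _ inds xA] [mr _ indr xB].
have [eps eps0 small] := @clog_small R (m + n).+1.
have [r1 r10 H1] := uniform_radius (fun k => cf_near1 (ms k) eps0).
have [r2 r20 H2] := uniform_radius (fun l => cf_near1 (mr l) eps0).
(* [M] bounds the coefficient sums of [vnorm_mul] for both matrices; the added 1 makes it
   positive. *)
pose M := \sum_j \sum_l normc (A j l) + \sum_j \sum_l normc (B j l) + 1.
have MA : \sum_j \sum_l normc (A j l) <= M.
  rewrite /M -addrA lerDl addr_ge0 //; apply: sumr_ge0 => j _.
  by apply: sumr_ge0 => l _; exact: normc_ge0.
have MB : \sum_j \sum_l normc (B j l) <= M.
  rewrite /M addrAC addrC lerDl addr_ge0 //; apply: sumr_ge0 => j _.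
  by apply: sumr_ge0 => l _; exact: normc_ge0.
have M0 : 0 < M.
  apply: ltr_wpDl => //; apply: addr_ge0; apply: sumr_ge0 => j _;
  by apply: sumr_ge0 => l _; exact: normc_ge0.
exists (Num.min r1 r2 / M); first by rewrite divr_gt0 // lt_min r10.
move=> u; rewrite ltr_pdivlMr // lt_min => /andP[u1 u2].
have hA k := small _ (H1 k _ (le_lt_trans (le_trans (vnorm_mul u A k)
   (ler_wpM2l (vnorm_ge0 u) MA)) u1)).
have hB l := small _ (H2 l _ (le_lt_trans (le_trans (vnorm_mul u B l)
   (ler_wpM2l (vnorm_ge0 u) MB)) u2)).
have E : \prod_k cf (coordinate s k) ((u *m A) ord0 k) =
         \prod_l cf (coordinate r l) ((u *m B) ord0 l).
  by rewrite -(cf_factor u mx ms inds xA) (cf_factor u mx mr indr xB).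
have [e1 e2] := clog_prod hA hB E.
by split=> // [k|l]; [case: (hA k)|case: (hB l)].
Qed.

End CharacteristicFunctionLog.

(** * Elimination of columns by differences *)

Section Elimination.
Context {R : realType}.
Implicit Types (p : nat).

Lemma collinearZ p (u v : 'cV[R[i]]_p) (a : R[i]) : u = a *: v -> collinear u v.
Proof.
move=> ->; rewrite /collinear free_cons negb_and negbK span_seq1.
by apply/orP; left; apply/vlineP; exists a.
Qed.

Lemma exists_row_eq p (c : 'cV[R[i]]_p) (e : R[i]) : c != 0 ->
  exists v : 'rV[R[i]]_p, (v *m c) ord0 ord0 = e.
Proof.
move=> c0; have [j cj] : exists j, c j ord0 != 0.
  apply/existsP; apply: contraNT c0; rewrite negb_exists => /forallP H.
  by apply/eqP/colP => j; rewrite mxE; apply/eqP; have := H j; rewrite negbK.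
exists ((e / c j ord0) *: delta_mx ord0 j).
by rewrite -scalemxAl mxE -rowE mxE divfK.
Qed.

(** The row [c0^T] is not in the span of [c^T], so some column of the cokernel of [c^T] does not
    vanish on it; [v] is a multiple of this column, transposed. *)
Lemma exists_annihilator p (c0 c : 'cV[R[i]]_p) (e : R[i]) : ~ collinear c0 c ->
  exists v : 'rV[R[i]]_p, (v *m c) ord0 ord0 = 0 /\ (v *m c0) ord0 ord0 = e.
Proof.
move=> nc.
have [j cj] : exists j, (c0^T *m cokermx c^T) ord0 j != 0.
  apply/existsP; apply: contra_notT nc; rewrite negb_exists => /forallP H.
  have /sub_rVP [a h] : (c0^T <= c^T)%MS.
    by rewrite submxE; apply/eqP/rowP => j; rewrite [RHS]mxE; apply/eqP;
      have := H j; rewrite negbK.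
  by apply: (@collinearZ _ _ _ a); apply: trmx_inj; rewrite h linearZ.
pose v := (col j (cokermx c^T))^T.
have vE (z : 'cV[R[i]]_p) : (v *m z) ord0 ord0 = (z^T *m cokermx c^T) ord0 j.
  rewrite -[v *m z]trmxK trmx_mul trmxK mxE -[RHS]mulr1 !mxE mulr1.
  by apply: eq_bigr => l _; rewrite !mxE.
have sE (b : R[i]) (z : 'cV[R[i]]_p) : ((b *: v) *m z) ord0 ord0 = b * (z^T *m cokermx c^T) ord0 j.
  by rewrite -scalemxAl -vE mxE.
exists ((e / (c0^T *m cokermx c^T) ord0 j) *: v); rewrite !sE divfK //.
have -> : (c^T *m cokermx c^T) ord0 j = 0 by rewrite (mulmx_coker c^T) mxE.
by rewrite mulr0.
Qed.

(** [delta] is fixed before the functions, because the induction replaces them by their differences.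
    Half of [rho] is reserved at each step for the shift of [u]. *)
Lemma elimination p (c0 : 'cV[R[i]]_p) (e : R[i]) (cs : seq 'cV[R[i]]_p) :
  c0 != 0 -> (forall c, c \in cs -> ~ collinear c0 c) ->
  forall rho : R, 0 < rho -> exists2 delta : R, 0 < delta &
  forall (f0 : R[i] -> R) (F : seq ('cV[R[i]]_p * (R[i] -> R))),
    map fst F = cs ->
    (forall u : 'rV[R[i]]_p, vnorm u < rho ->
       f0 ((u *m c0) ord0 ord0) + \sum_(q <- F) q.2 ((u *m q.1) ord0 ord0) = 0) ->
    forall t h : R, `|t| < delta -> 0 <= h -> h < delta ->
      iter (size cs) (fdiff h) (fun t => f0 (t%:C * e)) t = 0.
Proof.
move=> c00; elim: cs => [|c cs IH] Hcs rho rho0.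
  have [w we] := exists_row_eq e c00.
  have w1 : 0 < vnorm w + 1 by rewrite ltr_wpDl ?vnorm_ge0.
  exists (rho / (vnorm w + 1)); first by rewrite divr_gt0.
  move=> f0 [|//] _ H t h td _ _ /=.
  have := H (t%:C *: w); rewrite big_nil addr0 -scalemxAl mxE we; apply.
  rewrite vnormZ; move: td; rewrite ltr_pdivlMr //; apply: le_lt_trans.
  by rewrite ler_wpM2l // lerDl.
have [v [vc ve]] := exists_annihilator e (Hcs c (mem_head _ _)).
have rho2 : 0 < rho / 2 by lra.
have Hcs' c' : c' \in cs -> ~ collinear c0 c'.
  by move=> h; apply: Hcs; rewrite inE h orbT.
have [delta d0 Hd] := IH Hcs' _ rho2.
have v1 : 0 < vnorm v + 1 by rewrite ltr_wpDl ?vnorm_ge0.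
exists (Num.min delta (rho / 2 / (vnorm v + 1))).
  by rewrite lt_min d0 divr_gt0.
move=> f0 [//|[c' fc] F] /= [cE FE] H t h; rewrite !lt_min => /andP[td _] h0 /andP[hd hr].
rewrite -iterS iterSr.
(* Shifting [u] by [h v], with [v c = 0] and [v c0 = e], cancels the term of [c], differences [f0]
   along [e], and leaves functions of the same form on the other columns. *)
pose f0h z := f0 (z + h%:C * e) - f0 z.
pose Fh := [seq (q.1, fun z => q.2 (z + h%:C * (v *m q.1) ord0 ord0) - q.2 z) | q <- F].
have -> : fdiff h (fun t => f0 (t%:C * e)) = (fun t => f0h (t%:C * e)).
  by apply/funext => s; rewrite /fdiff /f0h rmorphD mulrDl.
apply: (Hd f0h Fh) => //; first by rewrite -map_comp -FE; exact: eq_map.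
move=> u ur.
have hv : vnorm (h%:C *: v) < rho / 2.
  rewrite vnormZ ger0_norm //; move: hr; rewrite ltr_pdivlMr //; apply: le_lt_trans.
  by rewrite ler_wpM2l // lerDl.
have ur1 : vnorm u < rho by apply: lt_trans ur _; lra.
have ur2 : vnorm (u + h%:C *: v) < rho.
  by apply: le_lt_trans (vnormD _ _) _; lra.
have := H _ ur1; have := H _ ur2; rewrite !big_cons /=.
have vec (q : 'cV[R[i]]_p) : ((u + h%:C *: v) *m q) ord0 ord0 =
    (u *m q) ord0 ord0 + h%:C * (v *m q) ord0 ord0.
  by rewrite mulmxDl mxE -scalemxAl mxE mxE.
rewrite !vec ve cE vc mulr0 addr0 => e2 e1.
rewrite /f0h /Fh big_map /= sumrB.
have -> : \sum_(q <- F) q.2 ((u *m q.1) ord0 ord0 + h%:C * (v *m q.1) ord0 ord0) =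
   \sum_(q <- F) q.2 (((u + h%:C *: v) *m q.1) ord0 ord0).
  by apply: eq_bigr => q _; rewrite vec.
move: e1 e2; set X := \sum_(q <- F) _; set Y := \sum_(q <- F) _; lra.
Qed.

End Elimination.

(** * Normality of an isolated source *)

Section NormalSource.
Context {d : measure_display} {T : measurableType d} {R : realType}.
Variable P : probability T R.

(* Subtracting the two log-characteristic-function identities, every term other
   than that of [s_k0] has a direction [v] annihilated by its column but not by
   column [k0]; differencing along these directions leaves an iterated
   difference of [log cf s_k0] equal to 0 near the origin. *)
Lemma source_gaussian p (x : T -> 'cV[R[i]]_p) m n
    (A : 'M[R[i]]_(p, m)) (s : T -> 'cV[R[i]]_m)
    (B : 'M[R[i]]_(p, n)) (r : T -> 'cV[R[i]]_n) (k0 : 'I_m) :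
  complex_rvec x -> representation P x A s -> representation P x B r ->
  col k0 A != 0 -> (forall k, k != k0 -> ~ collinear (col k0 A) (col k A)) ->
  (forall l, ~ collinear (col k0 A) (col l B)) ->
  forall e, gaussian_transform P (fun w => Re (e * coordinate s k0 w)).
Proof.
move=> mx rA rB c0 nA nB e.
have [ms _ _ _] := rA.
have [rho rho0 H] := log_functional_eq mx rA rB.
pose cs := [seq col k A | k <- enum 'I_m & k != k0] ++ [seq col l B | l <- enum 'I_n].
have ncs c : c \in cs -> ~ collinear (col k0 A) c.
  rewrite mem_cat => /orP[/mapP[k]|/mapP[l _ ->]]; last exact: nB.
  by rewrite mem_filter => /andP[kk _] ->; exact: nA.
have [delta d0 Hd] := elimination e c0 ncs rho0.
pose Phi t := cf P (coordinate s k0) (t%:C * e).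
have [r1 r10 near1] := cf_near1 P (ms k0) (@ltr01 R).
have e1 : 0 < normc e + 1 by rewrite ltr_wpDl ?normc_ge0.
pose dl := Num.min delta (r1 / (normc e + 1)).
have dl0 : 0 < dl by rewrite lt_min d0 divr_gt0.
have Phi_pos t : `|t| < dl -> 0 < Re (Phi t).
  rewrite lt_min => /andP[_ tr].
  have : normc (t%:C * e) < r1.
    rewrite normcM normc_real; move: tr; rewrite ltr_pdivlMr //; apply: le_lt_trans.
    by rewrite ler_wpM2l // lerDl.
  move/near1 => h; have := le_lt_trans (normc_Re _) h.
  by rewrite ReD ReN /= ltr_norml => /andP[]; rewrite /Phi; lra.
(* Stated for a general [L] because it is applied to the log-modulus and to the argument
   separately. *)
have poly (L : R[i] -> R) :
    (forall u : 'rV[R[i]]_p, vnorm u < rho ->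
       \sum_k L (cf P (coordinate s k) ((u *m A) ord0 k)) =
       \sum_l L (cf P (coordinate r l) ((u *m B) ord0 l))) ->
    (forall (u : nat -> R[i]) (w : R[i]), 0 < Re w ->
      (fun k => Re (u k)) @ \oo --> Re w -> (fun k => Im (u k)) @ \oo --> Im w ->
      (fun k => L (u k)) @ \oo --> L w) ->
    exists q : {poly R}, forall t, `|t| < dl / 2 -> L (Phi t) = q.[t].
  move=> HL contL.
  have [] := @poly_of_fdiff R (size cs) dl (fun t => L (Phi t)) dl0.
  - move=> t h; rewrite !lt_min => /andP[td _] h0 /andP[hd _].
    pose F := [seq (col k A, fun z => L (cf P (coordinate s k) z)) | k <- enum 'I_m & k != k0]
      ++ [seq (col l B, fun z => - L (cf P (coordinate r l) z)) | l <- enum 'I_n].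
    apply: (Hd (fun z => L (cf P (coordinate s k0) z)) F) => //.
      by rewrite /F map_cat; congr (_ ++ _); rewrite -map_comp; exact: eq_map.
    move=> u /HL; rewrite /F big_cat 2!big_map big_filter big_enum_cond big_enum /=.
    rewrite (bigD1 k0) //= sumrN.
    have ucol q (M : 'M[R[i]]_(p, q)) k : (u *m col k M) ord0 ord0 = (u *m M) ord0 k.
      by rewrite !mxE; apply: eq_bigr => l _; rewrite !mxE.
    under [X in _ -> _ + (X - _) = _]eq_bigr do rewrite ucol.
    under [X in _ -> _ + (_ - X) = _]eq_bigr do rewrite ucol.
    by rewrite ucol => <-; rewrite addrA subrr.
  - move=> u t td ut; have [h1 h2] := cf_cvg P e (ms k0) ut.
    exact: (contL _ _ (Phi_pos _ td)).
  - by move=> q _ qE; exists q.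
have [q1 E1] : exists q : {poly R}, forall t, `|t| < dl / 2 -> clog_re (Phi t) = q.[t].
  by apply: poly => [u /H[]|] //; exact: clog_re_cvg.
have [q2 E2] : exists q : {poly R}, forall t, `|t| < dl / 2 -> clog_im (Phi t) = q.[t].
  by apply: poly => [u /H[]|] //; exact: clog_im_cvg.
(* Composition with [-i X] gives [Q (i t) = q1 t + i q2 t], the form that [marcinkiewicz]
   expects. *)
pose Q := (map_poly (real_complex R) q1 + 'i%C *: map_poly (real_complex R) q2)
  \Po (- 'i%C *: 'X).
have dl2 : 0 < dl / 2 by rewrite divr_gt0.
have QE t : Q.[t%:C * 'i%C] = q1.[t] +i* q2.[t].
  rewrite horner_comp hornerD !hornerZ hornerX.
  have -> : - 'i%C * (t%:C * 'i%C) = t%:C :> R[i].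
    by rewrite mulrCA mulNr -expr2 sqr_i opprK mulr1.
  by rewrite !horner_map; apply: complex_eqP; rewrite (ReD, ImD) (ReM, ImM) /=; ring.
apply: (@marcinkiewicz _ _ _ _ _ (meas_Re_mul e (ms k0)) Q (dl / 2)) => //.
  have := QE 0; rewrite mul0r horner_coef0 => ->.
  rewrite -E1 ?normr0 // -E2 ?normr0 // /Phi mul0r cf0 /clog_re /clog_im /=.
  by rewrite mul0r atan0 expr1n expr0n /= addr0 sqrtr1 ln1.
move=> t tdl; rewrite cf_laplace QE -E1 // -E2 // clogK //.
by apply: Phi_pos; apply: lt_trans tdl _; lra.
Qed.
End NormalSource.

(** * Characteristic functions of modulus one *)

Section CircularDispersion.
Context {d : measure_display} {T : measurableType d} {R : realType}.
Variable P : probability T R.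

Lemma gaussian_complex_normal y : complex_rv y ->
  (forall e, gaussian_transform P (fun w => Re (e * y w))) -> complex_normal P y.
Proof.
move=> my H a b; have := gaussian_real_normal (meas_Re_mul (a -i* b) my) (H (a -i* b)).
congr (real_normal P); apply/funext => w.
by rewrite ReM /=; ring.
Qed.

(** With [phi] the characteristic function, this is [E |exp (i t Y) - phi t|^2 = 1 - |phi t|^2]: it
    yields [|phi| <= 1], and equality makes [exp (i t Y)] almost surely constant. *)
Lemma circular_dispersion (Y : T -> R) (t : R) : measurable_fun setT Y ->
  let c := mean P (fun w => cos (t * Y w)) in
  let s := mean P (fun w => sin (t * Y w)) in
  let D := fun w => (cos (t * Y w) - c) ^+ 2 + (sin (t * Y w) - s) ^+ 2 in
  integ P D /\ mean P D = 1 - (c ^+ 2 + s ^+ 2).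
Proof.
move=> mY c s D.
have ic : integ P (fun w => cos (t * Y w)).
  by apply: (@integ_bounded _ _ _ P _ 1); [exact: meas_cos|move=> w; exact: cos_max].
have is_ : integ P (fun w => sin (t * Y w)).
  by apply: (@integ_bounded _ _ _ P _ 1); [exact: meas_sin|move=> w; exact: sin_max].
have DE : D = (fun w => (1 + (c ^+ 2 + s ^+ 2)) -
    ((2 * c) * cos (t * Y w) + (2 * s) * sin (t * Y w))).
  apply/funext => w; have := cos2Dsin2 (t * Y w); rewrite /D.
  set X := cos _; set Y1 := sin _ => h; lra.
have i1 := integ_cst P (1 + (c ^+ 2 + s ^+ 2)).
have i2 := integD (integZ (2 * c) ic) (integZ (2 * s) is_).
rewrite DE; split; first exact: integB.
rewrite meanB // mean_cst meanD; [|exact: integZ|exact: integZ].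
by rewrite !meanZ // -/c -/s; ring.
Qed.

Lemma normc_laplace_im (Y : T -> R) (t : R) : normc (laplace P Y (t%:C * 'i%C)) ^+ 2 =
  mean P (fun w => cos (t * Y w)) ^+ 2 + mean P (fun w => sin (t * Y w)) ^+ 2.
Proof. by rewrite sqr_normcE laplace_im laplace_im_sin. Qed.

Lemma normc_laplace_im_le1 (Y : T -> R) (t : R) : measurable_fun setT Y ->
  normc (laplace P Y (t%:C * 'i%C)) <= 1.
Proof.
move=> mY; rewrite -(@ler_pXn2r _ 2) ?nnegrE ?normc_ge0 // expr1n normc_laplace_im.
have [_ h] := circular_dispersion t mY; rewrite -subr_ge0 -h.
by apply: mean_ge0 => w; rewrite addr_ge0 ?sqr_ge0.
Qed.

(** [exp (i Y / (n + 1))] is almost surely constant for every [n]. For [n] large, depending on the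
    sample point, the angle cannot wrap around, so [Y] itself is determined. *)
Lemma normc_laplace_im_eq1 (Y : T -> R) : measurable_fun setT Y ->
  (forall t : R, normc (laplace P Y (t%:C * 'i%C)) = 1) ->
  exists c, {ae P, forall w, Y w = c}.
Proof.
move=> mY H.
pose c n := mean P (fun w => cos (n.+1%:R^-1 * Y w)).
pose s n := mean P (fun w => sin (n.+1%:R^-1 * Y w)).
have Hn n : {ae P, forall w, cos (n.+1%:R^-1 * Y w) = c n /\ sin (n.+1%:R^-1 * Y w) = s n}.
  have [iD mD] := circular_dispersion n.+1%:R^-1 mY.
  have := normc_laplace_im Y n.+1%:R^-1; rewrite H expr1n => h.
  have := mean0_ae iD (fun w => addr_ge0 (sqr_ge0 _) (sqr_ge0 _)).
  rewrite mD -h subrr => /(_ erefl); apply: filterS => w /eqP.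
  rewrite paddr_eq0 ?sqr_ge0 // !sqrf_eq0 !subr_eq0 => /andP[/eqP -> /eqP ->].
  by [].
have Hall : {ae P, forall w, forall n,
    cos (n.+1%:R^-1 * Y w) = c n /\ sin (n.+1%:R^-1 * Y w) = s n}.
  exact: ae_foralln.
have [w0 Hw0] : exists w0, forall n,
    cos (n.+1%:R^-1 * Y w0) = c n /\ sin (n.+1%:R^-1 * Y w0) = s n.
  apply: contrapT => h.
  have : {ae P, forall w, False} by apply: filterS Hall => w hw; apply: h; exists w.
  case=> N [mN N0 sub]; have : P setT = 0%E.
    by apply: (subset_measure0 _ _ _ N0) => // w _; apply: sub.
  by rewrite probability_setT => /eqP; rewrite onee_eq0.
exists (Y w0); apply: filterS Hall => w Hw.
(* This choice puts the angle below 1, in the range where the cosine is injective. *)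
pose n := Num.truncn `|Y w - Y w0|.
have n1 : 0 < n.+1%:R :> R by [].
have cos1 : cos (n.+1%:R^-1 * `|Y w - Y w0|) = 1.
  have -> : cos (n.+1%:R^-1 * `|Y w - Y w0|) = cos (n.+1%:R^-1 * (Y w - Y w0)).
    by case: (ger0P (Y w - Y w0)) => // _; rewrite mulrN cosN.
  have [h1 h2] := Hw0 n.
  rewrite mulrBr cosB h1 h2.
  by rewrite -(Hw n).1 -(Hw n).2 -!expr2 cos2Dsin2.
have : n.+1%:R^-1 * `|Y w - Y w0| = 0.
  apply: (@cos_inj R); rewrite ?cos0 // in_itv /= ?lexx ?pi_ge0 //.
  rewrite mulr_ge0 ?invr_ge0 //= mulrC ler_pdivrMr //.
  apply: le_trans (ltW (truncnS_gt _)) _.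
  by rewrite ler_peMl // (le_trans _ (pi_ge2 R)) // ler1n.
by move/eqP; rewrite mulf_eq0 invr_eq0 gt_eqF //= normr_eq0 subr_eq0 => /eqP.
Qed.

Lemma normc_cf_le1 y z : complex_rv y -> normc (cf P y z) <= 1.
Proof.
move=> my; rewrite -[z]mul1r -(cf_laplace P y z 1).
exact: normc_laplace_im_le1 (meas_Re_mul z my).
Qed.

Lemma normc_cf_eq1 y : complex_rv y -> (forall z, normc (cf P y z) = 1) ->
  ~ non_degenerate P y.
Proof.
move=> my H; apply.
have cst e : exists c, {ae P, forall w, Re (e * y w) = c}.
  apply: normc_laplace_im_eq1; first exact: meas_Re_mul.
  by move=> t; rewrite cf_laplace.
have [c1 h1] := cst 1; have [c2 h2] := cst (- 'i%C).
exists (c1 +i* c2); apply: filterS2 h1 h2 => w e1 e2.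
by apply: complex_eqP; rewrite -?e1 -?e2 ?mul1r // ReM /=; ring.
Qed.

(** The characteristic function of the constant 0 is 1 and factors over the sources; as no factor
    exceeds 1 in modulus, each has modulus 1. If [M k l] were nonzero, multiples of row [k] would
    reach every argument of source [l], making it degenerate. *)
Lemma linear_relation n q (r : T -> 'cV[R[i]]_n) (M : 'M[R[i]]_(q, n)) :
  complex_rvec r -> (forall l, non_degenerate P (coordinate r l)) ->
  independent_crv P (coordinate r) ->
  {ae P, forall w, M *m r w = 0} -> M = 0.
Proof.
move=> mr ndr indr H; apply/matrixP => k l; rewrite mxE; apply: contrapT => Mkl.
apply: (normc_cf_eq1 (mr l) _ (ndr l)) => z.
have mx0 : complex_rvec (fun _ : T => 0 : 'cV[R[i]]_q) by move=> ?; split; exact: measurable_cst.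
have xE : {ae P, forall w, (0 : 'cV[R[i]]_q) = M *m r w}.
  by apply: filterS H => w ->.
have := cf_factor ((z / M k l) *: delta_mx 0 k) mx0 mr indr xE.
rewrite mulmx0 mxE -[cexp _]/(cexp 0) cexp0 cmean_cst => /(congr1 (@normc R)).
rewrite (bigD1 l) // normcM -scalemxAl mxE -rowE mxE divfK; last exact/eqP.
set X := \prod_(_ | _) _ => E.
have X1 : normc X <= 1.
  rewrite /X; elim/big_ind: _ => [|a b a1 b1|j _]; last exact: normc_cf_le1.
    by rewrite normc1.
  by rewrite normcM mulr_ile1 ?normc_ge0.
have n1 : normc (1 : R[i]) = 1 by rewrite normc_real normr1.
rewrite -[RHS]n1 E; apply: le_anti; rewrite ler_piMr ?normc_ge0 // -E n1 normc_cf_le1 //.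
Qed.

End CircularDispersion.

(** * Second moments and the circularity coefficient *)

Section SecondMoments.
Context {d : measure_display} {T : measurableType d} {R : realType}.
Variable P : probability T R.
Implicit Types y : T -> R[i].

Definition square_integ y :=
  integ P (fun w => Re (y w) ^+ 2) /\ integ P (fun w => Im (y w) ^+ 2).

Definition total_var y : R := mean P (fun w => normc (y w - cmean P y) ^+ 2).

Definition pseudo_var y : R[i] := cmean P (fun w => (y w - cmean P y) ^+ 2).

Lemma integ_of_sqr (f : T -> R) : measurable_fun setT f ->
  integ P (fun w => f w ^+ 2) -> integ P f.
Proof.
move=> mf i2; apply: (integ_le mf (integD (integ_cst P 1) i2)) => w.
by rewrite ler_norml; have := sqr_ge0 (f w + 1); have := sqr_ge0 (f w - 1); nra.
Qed.

Lemma square_integ_cinteg y : complex_rv y -> square_integ y -> cinteg P y.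
Proof. by move=> [m1 m2] [i1 i2]; split; apply: integ_of_sqr. Qed.

Lemma centered_rv y c : complex_rv y -> complex_rv (fun w => y w - c).
Proof.
move=> [m1 m2]; split.
  have -> : Re \o (fun w => y w - c) = (fun w => (Re \o y) w - Re c).
    by apply/funext => w /=; rewrite ReD ReN.
  by apply: measurable_funB.
have -> : Im \o (fun w => y w - c) = (fun w => (Im \o y) w - Im c).
  by apply/funext => w /=; rewrite ImD ImN.
by apply: measurable_funB.
Qed.

Lemma integ_centered y (m : R[i]) : complex_rv y -> square_integ y ->
  integ P (fun w => normc (y w - m) ^+ 2) /\ cinteg P (fun w => (y w - m) ^+ 2).
Proof.
move=> my sy; have [i1 i2] := sy; have [j1 j2] := square_integ_cinteg my sy.
have iN : integ P (fun w => normc (y w - m) ^+ 2).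
  have := integD (integD i1 i2) (integB (integ_cst P (Re m ^+ 2 + Im m ^+ 2))
    (integD (integZ (2 * Re m) j1) (integZ (2 * Im m) j2))).
  congr (integ P); apply/funext => w /=.
  by rewrite sqr_normcE !(ReD, ReN, ImD, ImN); ring.
split=> //; have [m1 m2] := centered_rv m my.
have E1 : Re \o (fun w => (y w - m) ^+ 2) =
   (fun w => (Re \o (fun w => y w - m)) w ^+ 2 - (Im \o (fun w => y w - m)) w ^+ 2).
  by apply/funext => w /=; rewrite expr2 ReM -!expr2.
have E2 : Im \o (fun w => (y w - m) ^+ 2) =
   (fun w => 2 * ((Re \o (fun w => y w - m)) w * (Im \o (fun w => y w - m)) w)).
  by apply/funext => w /=; rewrite expr2 ImM; ring.
apply: (cinteg_le _ _ iN).
- by rewrite E1; apply: measurable_funB; apply: measurable_funX.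
- by rewrite E2; do 2 apply: measurable_funM => //.
- by move=> w; rewrite normcX.
Qed.

Lemma Re_sqr (z : R[i]) : Re z ^+ 2 = 2^-1 * (normc z ^+ 2 + Re (z ^+ 2)).
Proof. by rewrite sqr_normcE expr2 ReM; field. Qed.

Lemma mean_sqr_Re y z : complex_rv y -> square_integ y ->
  mean P (fun w => Re (z * (y w - cmean P y)) ^+ 2) =
  2^-1 * (normc z ^+ 2 * total_var y + Re (z ^+ 2 * pseudo_var y)).
Proof.
move=> my sy; have [i1 i2] := integ_centered (cmean P y) my sy.
have i2' := cintegZ (z ^+ 2) i2.
rewrite /pseudo_var -cmeanZ // /total_var -meanZ // -[Re (cmean _ _)]/(mean _ _).
rewrite -meanD; [|exact: integZ|by case: i2'].
rewrite -meanZ; last by apply: integD; [exact: integZ|case: i2'].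
by congr mean; apply/funext => w /=; rewrite Re_sqr exprMn normcM exprMn.
Qed.

Lemma mean_Re_mul y z : cinteg P y -> mean P (fun w => Re (z * y w)) = Re (z * cmean P y).
Proof. by move=> iy; rewrite -cmeanZ. Qed.

Lemma gaussian_square_integ y : complex_rv y ->
  (forall e, gaussian_transform P (fun w => Re (e * y w))) -> square_integ y.
Proof.
move=> my H; split.
  have := integ_pow (meas_Re_mul 1 my) (H 1).1 2.
  by congr (integ P); apply/funext => w; rewrite mul1r.
have := integ_pow (meas_Re_mul (- 'i%C) my) (H (- 'i%C)).1 2.
by congr (integ P); apply/funext => w; rewrite ReM /=; ring.
Qed.

(** The log-modulus is minus half the variance of [Re (z y)], which splits by
    [Re (u)^2 = (|u|^2 + Re (u^2)) / 2]. *)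
Lemma clog_re_gaussian_cf y z : complex_rv y ->
  (forall e, gaussian_transform P (fun w => Re (e * y w))) ->
  clog_re (cf P y z) =
  - 4^-1 * (normc z ^+ 2 * total_var y + Re (z ^+ 2 * pseudo_var y)).
Proof.
move=> my H; have sy := gaussian_square_integ my H.
have [Hm Hl] := H z; have mY := meas_Re_mul z my.
have V := var_ofE mY Hm.
have M1 : moment P (fun w => Re (z * y w)) 1 = Re (z * cmean P y).
  rewrite -mean_Re_mul; last exact: square_integ_cinteg.
  by congr mean; apply/funext => w; rewrite expr1.
have -> : - 4^-1 * (normc z ^+ 2 * total_var y + Re (z ^+ 2 * pseudo_var y)) =
   - var_of P (fun w => Re (z * y w)) / 2.
  rewrite V M1; have -> : (fun w => (Re (z * y w) - Re (z * cmean P y)) ^+ 2) =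
     (fun w => Re (z * (y w - cmean P y)) ^+ 2).
    by apply/funext => w; rewrite mulrBr ReD ReN.
  by rewrite mean_sqr_Re //; field.
rewrite -[z in cf P y z]mul1r -(cf_laplace P y z 1) Hl /clog_re normc_cexp expRK.
rewrite exprMn sqr_i mul1r expr1n mul1r ReD !ReMr.
by rewrite -[Re 'i%C]/0 -[Re (- 1)]/(- 1); field.
Qed.

Lemma total_var_gt0 y : complex_rv y -> square_integ y -> non_degenerate P y ->
  0 < total_var y.
Proof.
move=> my sy nd; have [iN _] := integ_centered (cmean P y) my sy.
rewrite lt_neqAle (mean_ge0 _ (fun w => sqr_ge0 _)) andbT.
apply/negP => /eqP h; apply: nd; exists (cmean P y).
have := mean0_ae iN (fun w => sqr_ge0 _) (esym h); apply: filterS => w /eqP.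
by rewrite sqrf_eq0 => /eqP /eq0_normc /eqP; rewrite subr_eq0 => /eqP.
Qed.

Lemma cexpectationE y : cexpectation P y = cmean P y.
Proof. by rewrite /cexpectation unlock. Qed.

(** For [Q] nonzero, [c] is a square root of [(normc Q / K) / Q], which removes the phase of [Q] and
    normalises [K]; for [Q = 0] a real scaling is enough. *)
Lemma exists_circular_scaling (K : R) (Q : R[i]) : 0 < K ->
  exists2 c : R[i], c != 0 & normc c ^+ 2 * K = 1 /\ c ^+ 2 * Q = (normc Q / K)%:C.
Proof.
move=> K0.
have [c [c1 c2]] : exists c : R[i], normc c ^+ 2 * K = 1 /\ c ^+ 2 * Q = (normc Q / K)%:C.
  have [->|Q0] := eqVneq Q 0.
    exists (Num.sqrt K^-1)%:C; rewrite normc_real real_normK ?num_real // sqr_sqrtr ?invr_ge0 ?ltW //.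
    by rewrite mulVf ?gt_eqF // mulr0 normc0 mul0r.
  pose a : R[i] := (normc Q / K)%:C / Q.
  exists (sqrtC a); rewrite sqrtCK -normcX sqrtCK /a; split; last by rewrite divfK.
  have nQ : normc Q != 0 by apply: contra Q0 => /eqP /eq0_normc ->.
  have : normc ((normc Q / K)%:C / Q) * normc Q = normc Q / K.
    rewrite -normcM divfK // normc_real ger0_norm //.
    by rewrite divr_ge0 ?normc_ge0 // ltW.
  move=> h; apply: (mulIf nQ); rewrite mul1r mulrAC h divfK // gt_eqF //.
exists c => //; apply: contra_eq_neq c1 => ->.
by rewrite normc0 expr0n mul0r eq_sym oner_eq0.
Qed.

Lemma gaussian_circularity y : complex_rv y -> square_integ y -> non_degenerate P y ->
  circularity_coefficient P y (normc (pseudo_var y) / total_var y).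
Proof.
move=> my sy nd; have K0 := total_var_gt0 my sy nd.
have iy := square_integ_cinteg my sy; have [iN iW] := integ_centered (cmean P y) my sy.
split=> //.
- rewrite /square_integrable unlock.
  have sE w : Re (`|y w| ^+ 2) = Re (y w) ^+ 2 + Im (y w) ^+ 2.
    by rewrite -sqr_normcE -[`|y w|]/((normc (y w))%:C) -rmorphXn.
  under eq_integral do rewrite sE.
  by have [i1 i2] := sy; rewrite -EFin_mean ?ltry //; exact: integD.
- by rewrite divr_ge0 ?normc_ge0 // ltW.
have [c c0 [c1 c2]] := exists_circular_scaling (pseudo_var y) K0.
exists c => //; rewrite /cov /pcov !cexpectationE cmeanZ //.
split.
  have -> : (fun w => `|c * y w - c * cmean P y| ^+ 2) =
     (fun w => (normc c ^+ 2 * normc (y w - cmean P y) ^+ 2)%:C).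
    by apply/funext => w; rewrite -mulrBr normrM exprMn rmorphM !rmorphXn.
  by rewrite cmean_complex meanZ // -/(total_var y) c1.
have -> : (fun w => (c * y w - c * cmean P y) ^+ 2) =
   (fun w => c ^+ 2 * (y w - cmean P y) ^+ 2).
  by apply/funext => w; rewrite -mulrBr exprMn.
by rewrite cmeanZ.
Qed.

End SecondMoments.

(** * Linear algebra for the quadratic terms *)

Section BilinearAlgebra.

(** In matrix form [C diag(w) E^T] is diagonal, and multiplication on the right by [F^T], a right
    inverse of [E^T], isolates [C diag(w)]. *)
Lemma diagonal_weights (K : comNzRingType) m n (C E : 'M[K]_(m, n)) (F : 'M[K]_(n, m))
    (w : 'I_n -> K) : F *m E = 1%:M ->
  (forall k k', k != k' -> \sum_j C k j * w j * E k' j = 0) ->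
  forall k l, C k l * w l = (\sum_j C k j * w j * E k j) * F l k.
Proof.
move=> FE off k l.
have -> : C k l * w l = \sum_j C k j * w j * (F *m E) l j.
  rewrite FE (bigD1 l) //= mxE eqxx mulr1 big1 ?addr0 // => j jl.
  by rewrite mxE eq_sym (negbTE jl) mulr0.
under eq_bigr do rewrite mxE mulr_sumr.
rewrite exchange_big /= (bigD1 k) //= [X in _ + X]big1 ?addr0 => [|k' k'k].
  by rewrite mulr_suml; apply: eq_bigr => j _; ring.
have := off k k'; rewrite eq_sym => /(_ k'k) h.
transitivity ((\sum_j C k j * w j * E k' j) * F l k'); last by rewrite h mul0r.
by rewrite mulr_suml; apply: eq_bigr => j _; ring.
Qed.

(** Taking [a] and [b] among 1 and [i] gives four real equations that determine the four real
    unknowns. *)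
Lemma sesquilinear_eq0 (R : realType) (X Y : R[i]) :
  (forall a b : R[i], Re (a * conjc b * X + a * b * Y) = 0) -> X = 0 /\ Y = 0.
Proof.
move=> H.
have := H 1 1; have := H 'i%C 1; have := H 1 'i%C; have := H 'i%C 'i%C.
case: X H => x1 x2; case: Y => y1 y2 H /=.
move=> h1 h2 h3 h4; split; apply: complex_eqP => /=; lra.
Qed.

Lemma mixed_difference_eq0 (R : realType) (f : R[i] -> R) (z w : R[i]) :
  f 0 = 0 -> z = 0 \/ w = 0 -> f (z + w) - f z - f w = 0.
Proof. by move=> f0 [] ->; rewrite ?add0r ?addr0 f0 ?subr0 subrr ?subr0. Qed.

End BilinearAlgebra.

(** * Matching the columns of two representations *)

Section Identifiability.
Context {d : measure_display} {T : measurableType d} {R : realType}.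
Variables (P : probability T R) (p : nat) (x : T -> 'cV[R[i]]_p).
Hypothesis mx : complex_rvec x.

Lemma unmatched_source_gaussian m n
    (A : 'M[R[i]]_(p, m)) (s : T -> 'cV[R[i]]_m)
    (B : 'M[R[i]]_(p, n)) (r : T -> 'cV[R[i]]_n) k :
  representation P x A s -> reduced A -> representation P x B r ->
  (forall l, ~ collinear (col k A) (col l B)) ->
  forall e, gaussian_transform P (fun w => Re (e * coordinate s k w)).
Proof.
move=> rA [A0 Ac] rB; apply: source_gaussian mx rA rB (A0 k) _ => k' kk.
by apply: Ac; rewrite eq_sym.
Qed.

Lemma matched_no_normal m n
    (A : 'M[R[i]]_(p, m)) (s : T -> 'cV[R[i]]_m)
    (B : 'M[R[i]]_(p, n)) (r : T -> 'cV[R[i]]_n) :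
  Defs.proper P x (@no_normal_source d T R P p) A s -> representation P x B r ->
  forall k, exists l, collinear (col k A) (col l B).
Proof.
move=> [rA redA nA] rB k; apply: contrapT => /forallNP h.
apply: (nA k); apply: gaussian_complex_normal; first exact: (repr_rvec rA).
exact: unmatched_source_gaussian rA redA rB h.
Qed.

(** Polarisation of the quadratic form of [clog_re_gaussian_cf]; the cross terms double the constant
    1/4. *)
Lemma clog_re_gaussian_mixed y (z w : R[i]) : complex_rv y ->
  (forall e, gaussian_transform P (fun w => Re (e * y w))) ->
  clog_re (cf P y (z + w)) - clog_re (cf P y z) - clog_re (cf P y w) =
  - 2^-1 * Re (z * conjc w * (total_var P y)%:C + z * w * pseudo_var P y).
Proof.
move=> my H; rewrite !clog_re_gaussian_cf //.
move: (total_var P y) (pseudo_var P y) => K [q1 q2].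
by case: z w => z1 z2 [w1 w2]; rewrite !sqr_normcE /=; field.
Qed.

Lemma clog_re_cf0 y : clog_re (cf P y 0) = 0.
Proof. by rewrite cf0 /clog_re normc_real normr1 ln1. Qed.

(* With [u = v *m L], [u *m A = v] and [u *m B = v *m C]; mixed differences along
   two distinct basis vectors kill the left-hand side of the log identity. *)
Lemma mixed_difference m n
    (A : 'M[R[i]]_(p, m)) (s : T -> 'cV[R[i]]_m)
    (B : 'M[R[i]]_(p, n)) (r : T -> 'cV[R[i]]_n) (L : 'M[R[i]]_(m, p)) k k' (a b : R[i]) :
  representation P x A s -> representation P x B r -> L *m A = 1%:M -> k != k' ->
  let g l z := clog_re (cf P (coordinate r l) z) in
  let C := L *m B in
  exists2 t : R, 0 < t & \sum_l (g l (t%:C * (a * C k l) + t%:C * (b * C k' l))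
     - g l (t%:C * (a * C k l)) - g l (t%:C * (b * C k' l))) = 0.
Proof.
move=> rA rB LA kk g C.
have aux (a1 a2 a3 : R) : 0 <= a1 -> 0 <= a2 -> 0 <= a3 ->
  [/\ a1 < a3 + a1 + a2 + 1, a2 < a3 + a1 + a2 + 1 & a3 < a3 + a1 + a2 + 1].
  by move=> *; split; lra.
have [rho rho0 H] := log_functional_eq mx rA rB.
pose va : 'rV[R[i]]_m := a *: delta_mx 0 k.
pose vb : 'rV[R[i]]_m := b *: delta_mx 0 k'.
pose M := vnorm ((va + vb) *m L) + vnorm (va *m L) + vnorm (vb *m L) + 1.
have M0 : 0 < M by rewrite /M !(ltr_wpDl, addr_ge0, vnorm_ge0).
pose t := rho / M; have t0 : 0 < t by rewrite divr_gt0.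
have feq (v : 'rV[R[i]]_m) : vnorm (v *m L) < M ->
   \sum_j clog_re (cf P (coordinate s j) (t%:C * v ord0 j)) =
   \sum_l g l (t%:C * (v *m C) ord0 l).
  move=> vM; have : vnorm (t%:C *: (v *m L)) < rho.
    by rewrite vnormZ gtr0_norm // mulrAC ltr_pdivrMr // ltr_pM2l.
  move/H => [_ _ + _]; rewrite -!scalemxAl -!mulmxA LA mulmx1 => E.
  transitivity (\sum_j clog_re (cf P (coordinate s j) ((t%:C *: v) ord0 j))).
    by apply: eq_bigr => j _; rewrite mxE.
  by rewrite E; apply: eq_bigr => l _; rewrite mxE.
have vaE l : (va *m C) ord0 l = a * C k l.
  by rewrite -scalemxAl mxE -rowE [row _ _ _ _]mxE.
have vbE l : (vb *m C) ord0 l = b * C k' l.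
  by rewrite -scalemxAl mxE -rowE [row _ _ _ _]mxE.
have vabE l : ((va + vb) *m C) ord0 l = a * C k l + b * C k' l.
  by rewrite mulmxDl mxE vaE vbE.
have n1 := vnorm_ge0 (va *m L); have n2 := vnorm_ge0 (vb *m L).
have n3 := vnorm_ge0 ((va + vb) *m L).
have [m1 m2 m3] := aux _ _ _ n1 n2 n3.
pose f j z := clog_re (cf P (coordinate s j) z).
have e3 : \sum_l g l (t%:C * (a * C k l) + t%:C * (b * C k' l)) =
   \sum_j f j (t%:C * (va + vb) ord0 j).
  by rewrite (feq _ m3); apply: eq_bigr => l _; rewrite vabE mulrDr.
have e1 : \sum_l g l (t%:C * (a * C k l)) = \sum_j f j (t%:C * va ord0 j).
  by rewrite (feq _ m1); apply: eq_bigr => l _; rewrite vaE.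
have e2 : \sum_l g l (t%:C * (b * C k' l)) = \sum_j f j (t%:C * vb ord0 j).
  by rewrite (feq _ m2); apply: eq_bigr => l _; rewrite vbE.
exists t => //; rewrite !sumrB e1 e2 e3.
rewrite -!sumrB; apply: big1 => j _.
have -> : (va + vb) ord0 j = va ord0 j + vb ord0 j by rewrite mxE.
rewrite mulrDr; apply: (mixed_difference_eq0 (f := f j)); first exact: clog_re_cf0.
rewrite !mxE !eqxx /=; have [->|_] := eqVneq j k; last by left; rewrite !mulr0.
by right; rewrite (negbTE kk) !mulr0.
Qed.

Lemma matched_full_rank m n
    (A : 'M[R[i]]_(p, m)) (s : T -> 'cV[R[i]]_m)
    (B : 'M[R[i]]_(p, n)) (r : T -> 'cV[R[i]]_n) :
  Defs.proper P x (@full_rank_distinct_circularity d T R P p) A s ->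
  Defs.proper P x (@full_rank_distinct_circularity d T R P p) B r ->
  forall l, exists k, collinear (col l B) (col k A).
Proof.
move=> [rA [A0 _] [rkA _]] [rB redB [rkB distB]] l0; apply: contrapT => /forallNP nc.
have [L LA] : exists L, L *m A = 1%:M by apply/row_fullP; rewrite /row_full rkA.
have [L' LB] : exists L, L *m B = 1%:M by apply/row_fullP; rewrite /row_full rkB.
have [mr ndr indr BE] := rB; have AE := repr_eq rA.
(* The almost sure relations between [x], [s] and [r] become matrix identities through
   [linear_relation]. *)
pose C := L *m B; pose D := L' *m A.
have sE : {ae P, forall w, s w = C *m r w}.
  by apply: filterS2 AE BE => w e1 e2; rewrite -mulmxA -e2 e1 mulmxA LA mul1mx.
have DC : D *m C = 1%:M.
  apply/eqP; rewrite -subr_eq0; apply/eqP; apply: (linear_relation mr ndr indr).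
  apply: filterS3 AE BE sE => w e1 e2 e3.
  by rewrite mulmxBl mul1mx -mulmxA -e3 -mulmxA -e1 e2 mulmxA LB mul1mx subrr.
have ACB : A *m C = B.
  apply/eqP; rewrite -subr_eq0; apply/eqP; apply: (linear_relation mr ndr indr).
  apply: filterS3 AE BE sE => w e1 e2 e3.
  by rewrite mulmxBl -mulmxA -e3 -e1 e2 subrr.
pose G l := [exists k, [exists k', [&& k != k', C k l != 0 & C k' l != 0]]].
(* If column [l] of [B] were a multiple of column [j] of [A], then [L] would send it to a multiple
   of a basis vector, which has no two nonzero entries. *)
have Gnc l : G l -> forall k, ~ collinear (col l B) (col k A).
  move=> /existsP[k /existsP[k' /and3P[kk ck ck']]] j.
  rewrite /collinear free_cons negb_and negbK seq1_free (A0 j) orbF span_seq1.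
  move=> /vlineP[a aE]; have : col l C = a *: delta_mx j 0.
    rewrite colE -mulmxA -colE aE -scalemxAr; congr (_ *: _).
    by rewrite colE mulmxA LA mul1mx.
  move=> /colP h; have hC k1 : C k1 l = a * (k1 == j)%:R.
    by have := h k1; rewrite mxE [RHS]mxE [delta_mx _ _ _ _]mxE andbT.
  move: ck ck' kk; rewrite !hC; have [->|_] := eqVneq k j; last by rewrite mulr0 eqxx.
  by have [_|_] := eqVneq k' j; rewrite ?mulr0 ?eqxx.
have gauss l : G l -> forall e, gaussian_transform P (fun w => Re (e * coordinate r l w)).
  by move=> /Gnc; exact: unmatched_source_gaussian rB redB rA.
(* With a single nonzero entry, at row [k], in column [l0] of [C], the identity [A *m C = B] would
   make column [l0] of [B] a multiple of column [k] of [A]. *)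
have Gl0 : G l0.
  have [k ck] : exists k, C k l0 != 0.
    apply/existsP; apply: contraT; rewrite negb_exists => /forallP h.
    have := redB.1 l0; rewrite -ACB colE -mulmxA -colE (_ : col l0 C = 0) ?mulmx0 ?eqxx //.
    by apply/colP => k; rewrite !mxE; apply/eqP; have := h k; rewrite negbK mxE.
  apply: contra_notT (nc k) => nG; apply: (@collinearZ _ _ _ _ (C k l0)).
  rewrite -ACB colE -mulmxA -colE.
  have -> : col l0 C = C k l0 *: delta_mx k 0.
    apply/colP => k'; rewrite [LHS]mxE [RHS]mxE [delta_mx _ _ _ _]mxE andbT.
    have [->|kk] := eqVneq k' k; first by rewrite mulr1.
    rewrite mulr0; apply/eqP; apply: contraNT nG => ck'.
    by apply/existsP; exists k'; apply/existsP; exists k; rewrite kk ck' ck.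
  by rewrite -scalemxAr -colE.
pose K l := total_var P (coordinate r l); pose Q l := pseudo_var P (coordinate r l).
(* Columns of [C] with at most one nonzero entry contribute nothing to a mixed difference. Their
   weights are set to 0, so no second moments of those sources enter. *)
pose K' l : R[i] := if G l then (K l)%:C else 0.
pose Q' l : R[i] := if G l then Q l else 0.
have off k k' : k != k' -> \sum_l C k l * K' l * conjc (C k' l) = 0 /\
    \sum_l C k l * Q' l * C k' l = 0.
  move=> kk; apply: sesquilinear_eq0 => a b.
  have [t t0] := mixed_difference a b rA rB LA kk; rewrite -/C.
  rewrite (eq_bigr (fun l => - (t ^+ 2 / 2) * Re (a * conjc b * (C k l * K' l * conjc (C k' l))
     + a * b * (C k l * Q' l * C k' l)))) => [|l _].
    rewrite -mulr_sumr -Re_sum big_split -!mulr_sumr /= => /eqP.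
    by rewrite mulf_eq0 oppr_eq0 mulf_eq0 expf_eq0 invr_eq0 (gt_eqF t0) ?pnatr_eq0 /= => /eqP.
  rewrite /K' /Q'; case: ifPn => [/gauss gl|nG].
    rewrite (clog_re_gaussian_mixed _ _ (mr l) gl) -/(K l) -/(Q l).
    have -> : t%:C * (a * C k l) * conjc (t%:C * (b * C k' l)) * (K l)%:C +
       t%:C * (a * C k l) * (t%:C * (b * C k' l)) * Q l =
       (t ^+ 2)%:C * (a * conjc b * (C k l * (K l)%:C * conjc (C k' l)) +
          a * b * (C k l * Q l * C k' l)).
      have -> : conjc (t%:C * (b * C k' l)) = t%:C * (conjc b * conjc (C k' l)).
        by case: (b) (C k' l) => [b1 b2] [c1 c2]; apply: complex_eqP => /=; ring.
      rewrite rmorphXn /=.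
      move: (conjc b) (conjc (C k' l)) (C k l) (C k' l) (Q l) (K l)%:C t%:C => *; ring.
    by rewrite ReMr; move: (Re _) => z; field.
  rewrite !mulr0 !mul0r !mulr0 addr0 [Re 0]/= mulr0.
  apply: (mixed_difference_eq0 (f := fun z => clog_re (cf P (coordinate r l) z))).
    exact: clog_re_cf0.
  move: nG; rewrite negb_exists => /forallP /(_ k); rewrite negb_exists => /forallP /(_ k').
  by rewrite kk /= negb_and !negbK => /orP[] /eqP ->; [left|right]; rewrite !mulr0.
(* Multiplying the diagonal matrices [C K' C^*] and [C Q' C^T] by [D^*] and
   [D^T], with [D C = 1]: all normal sources seen by row [k] share one
   circularity coefficient. *)
have hK k l : C k l * K' l = (\sum_j C k j * K' j * conjc (C k j)) * conjc (D l k).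
  have := @diagonal_weights _ _ _ C (map_mx conjc C) (map_mx conjc D) K'.
  rewrite -map_mxM DC map_mx1 => /(_ erefl) H.
  rewrite H => [|k1 k2 /off[h _]]; last first.
    by rewrite -[RHS]h; apply: eq_bigr => j _; rewrite [map_mx _ _ _ _]mxE.
  by rewrite [map_mx _ D _ _]mxE; congr (_ * _); apply: eq_bigr => j _; rewrite [map_mx _ _ _ _]mxE.
have hQ k l : C k l * Q' l = (\sum_j C k j * Q' j * C k j) * D l k.
  by apply: (diagonal_weights DC) => k1 k2 /off[].
have sq l : G l -> square_integ P (coordinate r l).
  by move=> /gauss; exact: gaussian_square_integ (mr l).
have K0 l : G l -> 0 < K l by move=> /sq sl; exact: total_var_gt0 (mr l) sl (ndr l).
have ratio k l : G l -> C k l != 0 ->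
   normc (Q l) / K l = normc (\sum_j C k j * Q' j * C k j) /
       normc (\sum_j C k j * K' j * conjc (C k j)).
  move=> Gl ckl; have := hK k l; have := hQ k l; rewrite /K' /Q' Gl.
  set u := \sum_j _; set v := \sum_j _ => /(congr1 (@normc R)) h1 /(congr1 (@normc R)) h2.
  have nconj (z : R[i]) : normc (conjc z) = normc z by case: z => *; rewrite /= sqrrN.
  rewrite !normcM nconj normc_real gtr0_norm ?K0 // in h1 h2.
  have cn : normc (C k l) != 0 by apply: contra ckl => /eqP /eq0_normc ->.
  have Kl0 : K l != 0 by rewrite gt_eqF ?K0.
  (* The factor [D l k] is common to both identities and nonzero because [C k l] and [K l] are; it
     cancels in the quotient. *)
  have : normc v * normc (D l k) != 0 by rewrite -h2 mulf_neq0.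
  rewrite mulf_eq0 negb_or => /andP[v0 d0].
  apply/eqP; rewrite eqr_div //; apply/eqP; apply: (mulfI cn).
  by rewrite mulrA h1 mulrCA h2; ring.
have uniq k l l' : G l -> G l' -> C k l != 0 -> C k l' != 0 -> l = l'.
  move=> Gl Gl' cl cl'; apply: contrapT => /eqP ll; apply: distB.
  exists l, l'; split=> //.
  - by apply: gaussian_complex_normal (mr l) _; exact: gauss.
  - by apply: gaussian_complex_normal (mr l') _; exact: gauss.
  exists (normc (Q l) / K l); split; first exact: gaussian_circularity (mr l) (sq _ Gl) (ndr l).
  rewrite (ratio k l) // -(ratio k l') //.
  exact: gaussian_circularity (mr l') (sq _ Gl') (ndr l').
have /existsP[k /existsP[k' /and3P[kk ck ck']]] := Gl0.
(* By [uniq] the off-diagonal entry reduces to its term at [l0], which is not zero. *)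
have [+ _] := off k k' kk; rewrite (bigD1 l0) //= big1 ?addr0 => [/eqP|l ll].
  by rewrite /K' Gl0 !mulf_eq0 (negbTE ck) conjc_eq0 (negbTE ck') orbF /= fmorph_eq0 gt_eqF ?K0.
rewrite /K'; case: ifPn => [Gl|_]; last by rewrite mulr0 mul0r.
have -> : C k l = 0 by apply: contra_neq_eq ll => cl; exact: (uniq k).
by rewrite !mul0r.
Qed.

End Identifiability.

Theorem theorem7 (d : measure_display) (T : measurableType d) (R : realType)
    (P : probability T R) (p : nat) (hp : (2 <= p)%N)
    (x : T -> 'cV[R[i]]_p) (hx : complex_rvec x) :
  identifiable P x (@no_normal_source d T R P p) /\
  identifiable P x (@full_rank_distinct_circularity d T R P p).
Proof.
split=> m n A s B r hA hB; have [rA _ _] := hA; have [rB _ _] := hB; split.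
- exact: (matched_no_normal hx hA rB).
- exact: (matched_no_normal hx hB rA).
- exact: (matched_full_rank hx hB hA).
- exact: (matched_full_rank hx hA hB).
Qed.
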